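(* Up to isomorphism, the Petersen graph is the unique connected graph on $10$ vertices with cop number exactly $3$.
   Context: Cops and Robbers is played on a finite, connected, undirected graph $G$. A set of cops first each choose a starting vertex, then the robber chooses a starting vertex; thereafter the players alternate rounds, cops first. In the cops' round each cop either moves to an adjacent vertex or stays put (several cops may occupy the same vertex); in the robber's round the robber moves to an adjacent vertex or stays put. The cops win if after finitely many rounds some cop occupies the robber's vertex. Both players have full information. The cop number $c(G)$ is the minimum number of cops for which the cops have a winning strategy; $G$ is $k$-cop-win if $c(G)=k$. *)

(* Defs.v *)
From mathcomp Require Import all_boot.
From mathcomp Require Import boolp.

Set Implicit Arguments.
Unset Strict Implicit.
Unset Printing Implicit Defensive.

Record sgraph := SGraph {
  vertex :> finType;
  adj : rel vertex;
  adj_sym : symmetric adj;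
  adj_irr : irreflexive adj }.

Definition connected_graph (G : sgraph) : Prop :=
  forall x y : G, connect (@adj G) x y.

Definition graph_iso (G H : sgraph) : Prop :=
  exists f : G -> H, bijective f /\ forall x y, adj (f x) (f y) = adj x y.

Definition step (G : sgraph) : rel G := [rel x y | (x == y) || adj x y].

(* [r n] is the robber's vertex after his n-th round; [r 0] is his starting
   vertex. *)
Definition robber_walk (G : sgraph) (r : nat -> G) : Prop :=
  forall n, step (r n) (r n.+1).

Definition positions (G : sgraph) (k : nat) := {ffun 'I_k -> G}.

(* A strategy for k cops maps the list of the robber's positions so far to the
   cops' next positions, its value at [::] being their starting vertices. The
   cops' own past positions are determined by the strategy and that list, so
   this is a strategy depending on the whole history of the game. *)
Definition strategy (G : sgraph) (k : nat) := seq G -> positions G k.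

(* The cops' vertices after their n-th round against r; this depends on
   r 0, ..., r n.-1 only. *)
Definition cops_at (G : sgraph) (k : nat) (s : strategy G k) (r : nat -> G)
    (n : nat) : positions G k :=
  s (mkseq r n).

Definition legal_strategy (G : sgraph) (k : nat) (s : strategy G k) : Prop :=
  forall r : nat -> G, robber_walk r ->
  forall n (i : 'I_k), step (cops_at s r n i) (cops_at s r n.+1 i).

(* The first disjunct is a capture after the robber's n-th round (n = 0: after
   his initial placement), the second after the cops' round n.+1. *)
Definition captures (G : sgraph) (k : nat) (s : strategy G k)
    (r : nat -> G) : Prop :=
  exists n (i : 'I_k), cops_at s r n i = r n \/ cops_at s r n.+1 i = r n.

Definition cops_win (G : sgraph) (k : nat) : Prop :=
  exists s : strategy G k,
    legal_strategy s /\ forall r, robber_walk r -> captures s r.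

Lemma cops_win_card (G : sgraph) : cops_win G #|G|.
Proof.
exists (fun _ => [ffun i => enum_val i]); split=> [r _ n i | r _].
  by rewrite /cops_at /step /= eqxx.
by exists 0, (enum_rank (r 0)); left; rewrite /cops_at ffunE enum_rankK.
Qed.

Lemma ex_cops_win (G : sgraph) : exists k, `[< cops_win G k >].
Proof. by exists #|G|; apply/asboolP/cops_win_card. Qed.

Definition cop_number (G : sgraph) : nat := ex_minn (ex_cops_win G).

(* The Petersen graph as the Kneser graph K(5, 2). *)
Definition petersen_vertex := {A : {set 'I_5} | #|A| == 2}.

Definition petersen_adj : rel petersen_vertex :=
  fun A B => [disjoint val A & val B].

Lemma petersen_sym : symmetric petersen_adj.
Proof. by move=> A B; rewrite /petersen_adj /= disjoint_sym. Qed.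

Lemma petersen_irr : irreflexive petersen_adj.
Proof.
move=> [A A2]; apply/negbTE; rewrite /petersen_adj /= -setI_eq0 setIid.
by rewrite -cards_eq0 (eqP A2).
Qed.

Definition petersen : sgraph := SGraph petersen_sym petersen_irr.

(* Main.v *)
(** The Petersen graph is dominated by three vertices; it has girth 5 and is
    3-regular, so two cops can never block all the moves of the robber.

    For uniqueness, call a clause a set of pairs of labels in [0, 10) prescribed
    to be edges and a set of pairs prescribed to be non-edges.  A clause is
    refuted when every connected graph with a labelling satisfying it is won by
    two cops or isomorphic to the Petersen graph.  The empty clause is refuted by
    resolution (case distinction on one pair), where an earlier clause may be
    reused under any relabelling, so that all "without loss of generality"
    arguments come for free.  The axioms are the clauses on which two cops win
    even though they only use the prescribed edges while the robber may use every
    pair that is not a prescribed non-edge.  Connectedness enters through one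
    rule: while one cop confines the robber, the other can walk anywhere.  The
    clauses refuted on the way are essentially: a vertex of degree at least 5,
    then at least 4, 3, 2, 1. *)
Require Import Defs.
From mathcomp Require Import all_boot.

Set Implicit Arguments.
Unset Strict Implicit.
Unset Printing Implicit Defensive.

(** There are more than eleven million connected graphs on ten vertices up to isomorphism, so
    uniqueness is not proved by enumeration: a clause leaves most pairs undecided and is refuted for
    all its completions at once. Clauses speak of [step], that is, of pairs that are equal or
    adjacent, because both players may stay put. A labelling then need only be surjective, and the
    distinctness of the vertices is recovered in one place, for the Petersen graph itself. The order
    by decreasing degree has two reasons. A cop standing on a vertex of large degree leaves the
    robber few vertices outside its closed neighbourhood, so little is left for the second cop to
    search. And once larger degrees are refuted, an additional neighbour found in a clause of
    smaller degree can close its branch by a citation. Whatever is evaluated, for the Petersen graph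
    as for the certificate, is phrased with numerals and boolean lists, on which [vm_compute] runs;
    abstract finite graphs enter only in the lemmas that transfer the result. *)

Lemma stepE (G : sgraph) (x y : G) : step x y = (x == y) || adj x y.
Proof. by []. Qed.

(** * Positions won by two cops, and the strategy they yield *)

Section TwoCops.
Variable G : sgraph.
Implicit Types (c d r : G) (S : G -> Prop).

Lemma step_refl c : step c c.
Proof. by rewrite stepE eqxx. Qed.

(** A least fixed point with the cops to move, so that a derivation is a well-founded plan without
    an explicit bound on its length. A robber who steps onto a cop needs no case of his own: the cop
    captures by standing still. *)
Inductive two_win : G -> G -> G -> Prop :=
| TwoCatch c1 c2 d1 d2 r of step c1 d1 & step c2 d2 & (d1 == r) || (d2 == r) :
    two_win c1 c2 r
| TwoMove c1 c2 d1 d2 r of step c1 d1 & step c2 d2 &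
    (forall r', step r r' -> two_win d1 d2 r') : two_win c1 c2 r.

Lemma two_win_sym c1 c2 r : two_win c1 c2 r -> two_win c2 c1 r.
Proof.
elim=> {c1 c2 r} [c1 c2 d1 d2 r s1 s2 hr|c1 c2 d1 d2 r s1 s2 _ ih].
  by apply: (TwoCatch s2 s1); rewrite orbC.
exact: (TwoMove s2 s1).
Qed.

Lemma two_win_step c1 c2 r : step c1 r || step c2 r -> two_win c1 c2 r.
Proof.
by case/orP=> s; [apply: (TwoCatch s (step_refl c2)) |
  apply: (TwoCatch (step_refl c1) s)]; rewrite eqxx ?orbT.
Qed.

(* While the first cop stays put, a robber who is safe from him can never
   leave [S], so the second cop has the time to walk to any vertex. *)
Lemma two_win_confined c d S : connected_graph G ->
    (forall r r', S r -> step r r' -> S r' \/ step c r') ->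
    (forall r, S r -> two_win c d r) ->
  forall d' r, S r -> two_win c d' r.
Proof.
move=> conG clS winS d'; have /connectP[p] := conG d' d.
elim: p d' => [|x p IHp] d' /=; first by move=> _ <-.
case/andP=> d'x px lastp r Sr.
apply: (@TwoMove c d' c x); rewrite ?step_refl //; first by rewrite stepE d'x orbT.
move=> r' rr'; have [Sr'|cr'] := clS _ _ Sr rr'; first exact: IHp.
by apply: two_win_step; rewrite cr'.
Qed.

Definition good_move (W : G -> G -> pred G) c1 c2 r (d : G * G) :=
  [&& step c1 d.1, step c2 d.2 & [|| d.1 == r, d.2 == r |
    [forall r', step r r' ==> W d.1 d.2 r']]].

(** A derivation of [two_win] lives in [Prop] and hands no move to a strategy. This boolean version
    counts rounds, so that [pick] can select a move and the counter measures progress. *)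
Fixpoint win_in (n : nat) c1 c2 : pred G := fun r =>
  if n is n'.+1 then [exists d, good_move (win_in n') c1 c2 r d] else false.

Lemma win_inS n c1 c2 r : win_in n c1 c2 r -> win_in n.+1 c1 c2 r.
Proof.
elim: n c1 c2 r => // n IHn c1 c2 r /existsP[d /and3P[s1 s2 h]].
apply/existsP; exists d; rewrite /good_move s1 s2 /=.
case/or3P: h => [-> //|->|/forall_inP h]; first by rewrite orbT.
by apply/or3P/Or33/forall_inP=> r' /h; apply: IHn.
Qed.

Lemma win_in_leq m n c1 c2 r : m <= n -> win_in m c1 c2 r -> win_in n c1 c2 r.
Proof.
by move/subnK <-; elim: (n - m) => // k IHk /IHk; rewrite addSn; apply: win_inS.
Qed.

(** The robber has finitely many replies, so the bounds for the single replies have a maximum: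
    finiteness of the graph turns a well-founded plan into a bounded one. *)
Lemma two_win_in c1 c2 r : two_win c1 c2 r -> exists n, win_in n c1 c2 r.
Proof.
elim=> {c1 c2 r} [c1 c2 d1 d2 r s1 s2 hr|c1 c2 d1 d2 r s1 s2 _ ih].
  exists 1; apply/existsP; exists (d1, d2); rewrite /good_move s1 s2 /=.
  by case/orP: hr => -> //; rewrite orbT.
have /fin_all_exists[f hf] : forall r', exists n, step r r' -> win_in n d1 d2 r'.
  move=> r'; case h: (step r r'); last by exists 0.
  by have [n hn] := ih _ h; exists n.
exists (\max_r' f r').+1; apply/existsP; exists (d1, d2); rewrite /good_move s1 s2 /=.
apply/or3P/Or33/forall_inP=> r' /hf; apply: win_in_leq.
exact: (@leq_bigmax _ f).
Qed.

(** The state consists of the two cops and the number of rounds left. Legality is demanded against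
    every walk, also after a capture, when no good move need exist; the default [s.1] lets the cops
    stand still there. *)
Definition chase (s : G * G * nat) r : G * G * nat :=
  (odflt s.1 [pick d | good_move (win_in s.2.-1) s.1.1 s.1.2 r d], s.2.-1).

Definition pair_pos (c : G * G) : positions G 2 :=
  [ffun i : 'I_2 => if i == ord0 then c.1 else c.2].

(** The cops fold [chase] over the robber's history, starting with one number of rounds that
    suffices for every initial vertex of the robber. *)
Lemma two_win_cops_win c1 c2 : (forall r, two_win c1 c2 r) -> cops_win G 2.
Proof.
move=> win; have [n winn] : exists n, forall r, win_in n c1 c2 r.
  have /fin_all_exists[f hf] := fun r => two_win_in (win r).
  by exists (\max_r f r) => r; apply: win_in_leq (hf r); apply: (@leq_bigmax _ f).
pose st h := foldl chase (c1, c2, n) h.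
have stS (w : nat -> G) k : st (mkseq w k.+1) = chase (st (mkseq w k)) (w k).
  by rewrite /st mkseqS foldl_rcons.
exists (fun h => pair_pos (st h).1); split.
  move=> r _ k i; rewrite /cops_at stS /chase !ffunE /=.
  by case: pickP => [d /and3P[s1 s2 _]|_] /=; case: ifP; rewrite ?step_refl.
move=> r wr.
suff cap (m k : nat) : (st (mkseq r k)).2 = m ->
    win_in m (st (mkseq r k)).1.1 (st (mkseq r k)).1.2 (r k) ->
    captures (fun h => pair_pos (st h).1) r.
  exact: (cap n 0 erefl (winn _)).
(* [win_in 0] is false, so the counter cannot run out before a capture. *)
elim: m k => // m IHm k stk /existsP[d0 gd0].
have := stS r k; rewrite /chase stk /=.
case: pickP => [d /and3P[_ _ hd] /= eqst|/(_ d0)]; last by rewrite gd0.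
case/or3P: hd => [/eqP hd|/eqP hd|/forall_inP hd].
- by exists k, ord0; right; rewrite /cops_at eqst ffunE.
- by exists k, ord_max; right; rewrite /cops_at eqst ffunE.
by apply: (IHm k.+1); rewrite eqst //=; apply: hd.
Qed.

End TwoCops.

(** * The Petersen graph on numeric labels *)

(* Label [a] of the Petersen graph is the [a]-th 2-subset of {0, ..., 4} in
   lexicographic order. *)
Definition pairs5 : seq (nat * nat) :=
  [seq (i, j) | i <- iota 0 5, j <- iota i.+1 (4 - i)].

(** A purely numerical counterpart of disjointness, so that a claim about all vertices becomes a
    boolean check over labels. Labels out of range read as the pair (0, 1), which keeps
    [petersen_label] total. *)
Definition petersen_rel (a b : nat) : bool :=
  let: (i, j) := nth (0, 1) pairs5 a in let: (k, l) := nth (0, 1) pairs5 b in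
  ~~ [|| eqn i k, eqn i l, eqn j k | eqn j l].

Lemma pairs5P a : let: (i, j) := nth (0, 1) pairs5 a in (i < j) && (j < 5).
Proof. by do 11?[case: a => [//|a]]; rewrite nth_default. Qed.

Lemma mem_pairs5 m n : m < n -> n < 5 -> (m, n) \in pairs5.
Proof. by case: n m => [|[|[|[|[|//]]]]] [|[|[|[|m]]]]. Qed.

Lemma label_subproof a : #|[set (inord (nth (0, 1) pairs5 a).1 : 'I_5);
  inord (nth (0, 1) pairs5 a).2]| == 2.
Proof.
have := pairs5P a; case: (nth _ _ a) => i j /andP[ij j5] /=.
rewrite cards2 -val_eqE /= !inordK //; last exact: ltn_trans ij j5.
by rewrite (ltn_eqF ij).
Qed.

Definition petersen_label (a : nat) : petersen :=
  exist (fun A : {set 'I_5} => #|A| == 2) _ (label_subproof a).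

Lemma petersen_label_adj a b :
  adj (petersen_label a) (petersen_label b) = petersen_rel a b.
Proof.
rewrite /adj /= /petersen_adj /= /petersen_rel.
have := pairs5P a; case: (nth _ _ a) => i j /andP[ij j5] /=.
have := pairs5P b; case: (nth _ _ b) => k l /andP[kl l5] /=.
have i5 := ltn_trans ij j5; have k5 := ltn_trans kl l5.
have E m n : m < 5 -> n < 5 -> ((inord m : 'I_5) == inord n) = eqn m n.
  by move=> m5 n5; rewrite -val_eqE /= !inordK // eqnE.
by rewrite disjoints_subset subUset !sub1set !inE !E // !negb_or -andbA.
Qed.

Lemma petersen_label_surj (x : petersen) : exists2 a, a < 10 & x = petersen_label a.
Proof.
case: x => A A2; have /cards2P[i [j [ij defA]]] := A2.
have key (m n : 'I_5) : m < n -> A = [set m; n] ->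
    exists2 a, a < 10 & exist (fun B : {set 'I_5} => #|B| == 2) A A2 = petersen_label a.
  move=> mn Amn.
  have mnP : (val m, val n) \in pairs5.
    exact: mem_pairs5 mn (ltn_ord n).
  exists (index (val m, val n) pairs5); first by rewrite -[10]/(size pairs5) index_mem.
  by apply: val_inj; rewrite /= nth_index //= !inord_val.
case: (ltngtP i j) => [|ji|/val_inj e]; first by move/key; apply.
  by apply: key ji _; rewrite setUC.
by rewrite e eqxx in ij.
Qed.

Lemma card_petersen : #|petersen| = 10.
Proof.
have := card_draws 'I_5 2; rewrite card_ord -[10]/('C(5, 2)) => <-.
by rewrite card_sig; apply: eq_card => A; rewrite !inE.
Qed.

Lemma all_iota10 (P : pred nat) :
  all P (iota 0 10) -> forall a, a < 10 -> P a.
Proof. by move/allP=> h a a10; apply: h; rewrite mem_iota. Qed.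

Definition petersen_step (a b : nat) := eqn a b || petersen_rel a b.

(** No two vertices have the same neighbourhood, so the adjacency table alone separates the
    labels. *)
Lemma petersen_label_eq a b :
  a < 10 -> b < 10 -> (petersen_label a == petersen_label b) = eqn a b.
Proof.
move=> a10 b10; apply/eqP/eqnP=> [eab|-> //].
have : all (fun c => petersen_rel a c == petersen_rel b c) (iota 0 10).
  by apply/allP=> c _; rewrite -!petersen_label_adj eab.
have chk : all (fun a => all (fun b => eqn a b ||
  has (fun c => petersen_rel a c != petersen_rel b c) (iota 0 10)) (iota 0 10))
  (iota 0 10).
  by vm_compute.
move=> eqrel; have /orP[/eqnP //|/hasP[c c10]] := all_iota10 (all_iota10 chk a10) b10.
by rewrite (allP eqrel).
Qed.

Lemma petersen_label_step a b : a < 10 -> b < 10 ->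
  step (petersen_label a) (petersen_label b) = petersen_step a b.
Proof. by move=> a10 b10; rewrite stepE petersen_label_eq // petersen_label_adj. Qed.

(** The diameter is 2, so one intermediate vertex always suffices. *)
Lemma petersen_connected : connected_graph petersen.
Proof.
move=> x y; have [a a10 ->] := petersen_label_surj x.
have [b b10 ->] := petersen_label_surj y.
have chk : all (fun a => all (fun b => has (fun c =>
  petersen_step a c && petersen_step c b) (iota 0 10)) (iota 0 10)) (iota 0 10).
  by vm_compute.
have st_con u v : step u v -> connect (@adj petersen) u v.
  by case/orP=> [/eqP->|/connect1].
have /hasP[c] := all_iota10 (all_iota10 chk a10) b10.
rewrite mem_iota add0n => /= c10 /andP[ac cb].
by apply: connect_trans (st_con _ _ _) (st_con _ _ _);
  rewrite -?petersen_label_step in ac cb *; eassumption.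
Qed.

(** * Two cops fail and three succeed on the Petersen graph *)

(** Among the three neighbours of [r], a cop standing on one reaches only that one, as there are no
    triangles, and a cop further away reaches at most one, as there are no 4-cycles. So some
    neighbour is out of reach of both. The proof checks all triples of labels. *)
Lemma petersen_escape (c d r : petersen) : c != r -> d != r ->
  exists r', [&& step r r', ~~ step c r' & ~~ step d r'].
Proof.
have [a a10 ->] := petersen_label_surj c; have [b b10 ->] := petersen_label_surj d.
have [e e10 ->] := petersen_label_surj r; rewrite !petersen_label_eq // => ae be.
have chk : all (fun a => all (fun b => all (fun e => eqn a e || eqn b e ||
  has (fun u => [&& petersen_step e u, ~~ petersen_step a u & ~~ petersen_step b u])
   (iota 0 10)) (iota 0 10)) (iota 0 10)) (iota 0 10) by vm_compute.
have := all_iota10 (all_iota10 (all_iota10 chk a10) b10) e10.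
rewrite (negbTE ae) (negbTE be) !orFb => /hasP[u]; rewrite mem_iota add0n => u10 h.
by exists (petersen_label u); rewrite !petersen_label_step.
Qed.

(** Two closed neighbourhoods contain at most 8 of the 10 vertices. *)
Lemma petersen_undominated (c d : petersen) : exists r, ~~ step c r && ~~ step d r.
Proof.
have [a a10 ->] := petersen_label_surj c; have [b b10 ->] := petersen_label_surj d.
have chk : all (fun a => all (fun b => has (fun u => ~~ petersen_step a u &&
  ~~ petersen_step b u) (iota 0 10)) (iota 0 10)) (iota 0 10) by vm_compute.
have := all_iota10 (all_iota10 chk a10) b10.
move=> /hasP[u]; rewrite mem_iota add0n => u10 h.
by exists (petersen_label u); rewrite !petersen_label_step.
Qed.

(** Treats zero, one and two cops uniformly: a single cop is doubled, and [z] stands in when there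
    is none. *)
Lemma positions_pair (G : sgraph) k (p : positions G k) (Q : pred G) (z : G) :
    k <= 2 -> Q z -> (forall i, Q (p i)) ->
  exists c d, [/\ Q c, Q d & forall i, p i = c \/ p i = d].
Proof.
case: k p => [|[|[|//]]] p _ Qz Qp.
- by exists z, z; split=> // -[].
- by exists (p ord0), (p ord0); split=> // i; left; rewrite (ord1 i).
exists (p ord0), (p ord_max); split=> // i.
case: (unliftP ord0 i) => [j ->|->]; last by left.
by right; congr (p _); apply/val_inj; rewrite (ord1 j).
Qed.

(** The robber reads the cops' vertices off the strategy and his own history and moves out of their
    reach. Invariant: after each of his rounds no cop is on or next to his vertex, so the following
    cops' round cannot capture him. *)
Lemma petersen_evade k : k <= 2 -> ~ cops_win petersen k.
Proof.
move=> k2 [s [legal win]].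
have z : petersen := petersen_label 0.
pose safe (p : positions petersen k) r := [forall i, ~~ step (p i) r].
(* The defaults make the sequence a walk before anything is known about safety, as an appeal to
   [legal] requires; the proof of [safeP] then rules them out. *)
pose next (h : seq petersen) := if h is _ :: _
  then odflt (last z h) [pick r | step (last z h) r && safe (s h) r]
  else odflt z [pick r | safe (s h) r].
pose hist := fix hist n := if n is m.+1 then rcons (hist m) (next (hist m)) else [::].
pose r n := next (hist n).
have hE n : mkseq r n = hist n by elim: n => // n IH; rewrite mkseqS IH.
have rS n : r n.+1 = odflt (r n) [pick x | step (r n) x && safe (s (hist n.+1)) x].
  by rewrite /r /= /next -/(r n); case: (hist n) => [|y t] //=; rewrite last_rcons.
have walk : robber_walk r.
  move=> n; rewrite rS; case: pickP => [x /andP[] //|_].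
  exact: step_refl.
have safeP n : safe (s (hist n)) (r n).
  elim: n => [|n IHn].
    rewrite /r /=; case: pickP => // none.
    have [c [d [_ _ cd]]] := @positions_pair _ k (s [::]) predT z k2 isT (fun=> isT).
    have [x /andP[cx dx]] := petersen_undominated c d.
    have /negP[] := negbT (none x).
    by apply/forallP=> i; case: (cd i) => ->.
  rewrite rS; case: pickP => [x /andP[] //|none].
  (* The cops' new vertices are one legal step away from vertices that do not reach [r n]. *)
  have ne i : s (hist n.+1) i != r n.
    apply: contra (forallP IHn i) => /eqP <-.
    by have := legal _ walk n i; rewrite /cops_at !hE.
  (* A stand-in for missing cops; any vertex off [r n] will do. *)
  have [z' z'r] : exists z', z' != r n.
    have [x] := petersen_undominated (r n) (r n).
    by rewrite andbb => nx; exists x; apply: contraNneq nx => ->; apply: step_refl.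
  have [c [d [cr dr cd]]] := @positions_pair _ k _ (fun x => x != r n) z' k2 z'r ne.
  have [x /and3P[rx cx dx]] := petersen_escape cr dr.
  have /negP[] := negbT (none x); rewrite rx.
  by apply/forallP=> i; case: (cd i) => ->.
have [n [i []]] := win _ walk; rewrite /cops_at hE => E.
  by have /forallP/(_ i) := safeP n; rewrite E step_refl.
have /forallP/(_ i)/negP[] := safeP n.
by have := legal _ walk n i; rewrite /cops_at !hE E.
Qed.

(** Labels 0, 1 and 4 are the 2-subsets of {0, 1, 2}. Any other 2-subset meets {0, 1, 2} in at most
    one point, hence is disjoint from one of them; so the three vertices dominate the graph and the
    robber is caught in the first cops' round. *)
Lemma petersen_cops_win3 : cops_win petersen 3.
Proof.
pose dom (i : 'I_3) := petersen_label (nth 0 [:: 0; 1; 4] i).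
have domP r : exists i, step (dom i) r.
  have [a a10 ->] := petersen_label_surj r.
  have chk : all (fun a => has (fun i => (nth 0 [:: 0; 1; 4] i < 10) &&
    petersen_step (nth 0 [:: 0; 1; 4] i) a) (iota 0 3)) (iota 0 10) by [].
  have /hasP[i] := all_iota10 chk a10; rewrite mem_iota => /= i3 /andP[i10 ia].
  by exists (Ordinal i3); rewrite petersen_label_step.
(* Only the head [r] of the history, the robber's initial vertex, is consulted: a cop in reach of it
   goes there and stays, the others never move. *)
exists (fun h => [ffun i => if h is r :: _ then if step (dom i) r then r else dom i
  else dom i]); split.
  move=> r _ [|n] i; rewrite /cops_at !ffunE ?step_refl //=.
  by case: ifP; rewrite ?step_refl.
move=> r _; have [i ir] := domP (r 0); exists 0, i; right.
by rewrite /cops_at ffunE /= ir.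
Qed.

Lemma cop_number_petersen : cop_number petersen = 3.
Proof.
rewrite /cop_number; case: ex_minnP => m /boolp.asboolP win /(_ 3).
move/(_ (introT (boolp.asboolP _) petersen_cops_win3)) => m3.
apply/eqP; rewrite eqn_leq m3 ltnNge; apply/negP=> m2.
exact: petersen_evade m2 win.
Qed.

Lemma cop_number_not_win (G : sgraph) k : k < cop_number G -> ~ cops_win G k.
Proof.
rewrite /cop_number; case: ex_minnP => m _ minm km win.
by have := minm k (introT (boolp.asboolP _) win); rewrite leqNgt km.
Qed.

(** * Sets of labels and partially known graphs as boolean lists *)

(** Lists are read with default [false], so sets given by lists of different lengths, such as the
    empty list at the base of [known], can be combined. *)
Fixpoint vor (s t : seq bool) : seq bool :=
  match s, t with
  | x :: s', y :: t' => (x || y) :: vor s' t'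
  | [::], _ => t
  | _, [::] => s
  end.

Fixpoint vsub (s t : seq bool) : bool :=
  match s, t with
  | x :: s', y :: t' => (x ==> y) && vsub s' t'
  | x :: s', [::] => ~~ x && vsub s' [::]
  | [::], _ => true
  end.

Lemma nth_vor s t i : nth false (vor s t) i = nth false s i || nth false t i.
Proof.
by elim: s t i => [|x s IHs] [|y t] [|i] //=; rewrite ?orbF.
Qed.

Lemma vsubP s t i : vsub s t -> nth false s i -> nth false t i.
Proof.
elim: s t i => [|x s IHs] [|y t] [|i] //=; rewrite ?nth_nil //.
- by case/andP=> /negPf->.
- by case/andP=> _ /IHs/[apply]; rewrite nth_nil.
- by case/andP=> /implyP.
by case/andP=> _; apply: IHs.
Qed.

Definition vmk (P : pred nat) : seq bool := [seq P r | r <- iota 0 10].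
Arguments vmk : simpl never.

Lemma nth_vmk P r : r < 10 -> nth false (vmk P) r = P r.
Proof. by move=> r10; rewrite (nth_map 0) ?size_iota // nth_iota. Qed.

Definition vset (s : seq nat) : seq bool := vmk (fun r => has (eqn r) s).

Lemma nth_vset s r : r < 10 -> nth false (vset s) r -> r \in s.
Proof. by move=> r10; rewrite nth_vmk // => /hasP[x xs /eqnP->]. Qed.

Arguments vor : simpl never.
Arguments vsub : simpl never.
Arguments vset : simpl never.

(* A partially known graph on the labels 0, ..., 9, as boolean matrices: [must]
   holds the pairs known to satisfy [step], [may] those not known to fail it, so
   both contain the diagonal. *)
Record pgraph := PGraph { must : seq (seq bool); may : seq (seq bool) }.

Definition row (m : seq (seq bool)) a := nth [::] m a.
Definition bit m a b := nth false (row m a) b.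
Definition set_bit v m a b := set_nth [::] m a (set_nth false (row m a) b v).
Definition set_bits v m a b := set_bit v (set_bit v m a b) b a.

Lemma bit_set_bits v m a b c d : bit (set_bits v m a b) c d =
  if ((c, d) == (a, b)) || ((c, d) == (b, a)) then v else bit m c d.
Proof.
have E w n i j k l : bit (set_bit w n i j) k l =
    if (k, l) == (i, j) then w else bit n k l.
  rewrite /bit /set_bit /row nth_set_nth /= xpair_eqE.
  by case: eqP => [->|//]; rewrite nth_set_nth.
by rewrite !E; case: (_ == (b, a)); rewrite ?orbT ?orbF.
Qed.

Definition no_info : pgraph :=
  PGraph [seq vmk (eqn a) | a <- iota 0 10] (nseq 10 (nseq 10 true)).
Definition add_edge g a b := PGraph (set_bits true (must g) a b) (may g).
Definition del_edge g a b := PGraph (must g) (set_bits false (may g) a b).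

(** * Certificates and their checker *)

(* [Go c d c' d']: cops on [c], [d] move to [c'], [d'].
   [Trap c d s]: the cop on [c] confines the robber to [s], where the cops win
   once the other cop reaches [d]. *)
Inductive rule :=
| Go of nat & nat & nat & nat
| Trap of nat & nat & seq nat.

(* Cops to move win from the first two labels against a robber in the given set;
   [None] stands for an arbitrary second vertex. *)
Definition fact := (nat * option nat * seq bool)%type.

Definition about (F : fact) c d :=
  match F with
  | (c', Some d', _) => eqn c' c && eqn d' d || eqn c' d && eqn d' c
  | (c', None, _) => eqn c' c || eqn c' d
  end.

(** An under-approximation of the robber vertices that are lost against cops on [c] and [d]. All
    tests ask for inclusion in it, so a missing fact can only make a check fail. *)
Definition known g (L : seq fact) c d : seq bool :=
  vor (row (must g) c) (vor (row (must g) d)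
    (foldr (fun F v => if about F c d then vor F.2 v else v) [::] L)).

(** Rules are listed backwards in play: each relies on facts recorded before it, and the first on
    immediate captures alone. A rule whose side condition fails records nothing, so any list of
    rules is sound and only the final test in [Play] can reject. The robber's option to stay is
    covered by the diagonal of [may]. *)
Definition infer g (L : seq fact) (u : rule) : seq fact :=
  match u with
  | Go c d c' d' =>
    if bit (must g) c c' && bit (must g) d d' then
      let v := known g L c' d' in
      (c, Some d, vmk (fun r => [|| eqn r c', eqn r d' | vsub (row (may g) r) v])) :: L
    else L
  | Trap c d s =>
    let v := vset s in
    if vsub v (known g L c d) &&
       all (fun r => vsub (row (may g) r) (vor v (row (must g) c))) s
    then (c, None, v) :: L else L
  end.

(* Pairs that are equal or adjacent, and pairs that are neither. *)
Definition clause := (seq (nat * nat) * seq (nat * nat))%type.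

(* [Fork] distinguishes whether a pair is an edge; [Cite i s] uses the [i]-th
   clause of the library (the last one refuted is number 0) with its label [a]
   replaced by the [a]-th entry of [s]; [Play c d us] derives a win of two cops
   starting on [c] and [d]. *)
Inductive tree :=
| Fork of nat & nat & tree & tree
| Cite of nat & seq nat
| Play of nat & nat & seq rule.

(** Every label must occur at a position below 10, so that composing a labelling with [s] keeps it
    surjective. *)
Definition relabels (s : seq nat) :=
  (size s <= 10) && all (fun a => has (eqn a) s) (iota 0 10).

(** A bit outside a matrix reads [false]. In [must] this claims nothing, but in [may] it would pass
    for a known non-edge, hence the bounds on the second kind of pairs. *)
Definition covers g (l : clause) (s : seq nat) :=
  all (fun p => bit (must g) (nth 0 s p.1) (nth 0 s p.2)) l.1 &&
  all (fun p => let: a := nth 0 s p.1 in let: b := nth 0 s p.2 in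
    [&& a < 10, b < 10 & ~~ bit (may g) a b]) l.2.

Fixpoint check_tree (lib : seq clause) g (t : tree) : bool :=
  match t with
  | Fork a b t1 t0 =>
    check_tree lib (add_edge g a b) t1 && check_tree lib (del_edge g a b) t0
  | Cite i s =>
    if onth lib i is Some l then relabels s && covers g l s else false
  | Play c d us =>
    vsub (nseq 10 true) (known g (foldl (infer g) [::] us) c d)
  end.

Definition graph_of (l : clause) : pgraph :=
  foldl (fun g p => del_edge g p.1 p.2)
    (foldl (fun g p => add_edge g p.1 p.2) no_info l.1) l.2.

Fixpoint check_cert (lib : seq clause) (lems : seq (clause * tree)) (t : tree) : bool :=
  if lems is (l, u) :: lems' then
    check_tree lib (graph_of l) u && check_cert (l :: lib) lems' t
  else check_tree lib no_info t.

(** * Soundness of the checker *)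

Section Soundness.
Variable G : sgraph.
Hypothesis conG : connected_graph G.
(** Abstract, so that a branch may end in a win of two cops or in a clause refuted for another
    reason. For a graph of cop number 3 it becomes isomorphism with the Petersen graph, and
    [goal_win] then holds by contradiction. *)
Variable goal : Prop.
Hypothesis goal_win : cops_win G 2 -> goal.

(** Labels may be repeated: two labels of one vertex satisfy [step] and are treated like an edge. *)
Definition labels (f : nat -> G) := forall x, exists2 a, a < 10 & x = f a.

Definition models (f : nat -> G) g :=
  (forall a b, bit (must g) a b -> step (f a) (f b)) /\
  (forall a b, a < 10 -> b < 10 -> step (f a) (f b) -> bit (may g) a b).

Definition satisfies (f : nat -> G) (l : clause) :=
  all (fun p => step (f p.1) (f p.2)) l.1 && all (fun p => ~~ step (f p.1) (f p.2)) l.2.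

Lemma step_sym (x y : G) : step x y = step y x.
Proof. by rewrite !stepE eq_sym adj_sym. Qed.

Lemma models_no_info f : models f no_info.
Proof.
split=> a b; last by move=> a10 b10 _; rewrite /bit /row !(nth_nseq, a10, b10).
rewrite /bit /row; case: (ltnP a 10) => a10; last by rewrite (nth_default [::]) ?nth_nil.
rewrite (nth_map 0) ?size_iota // nth_iota // add0n.
case: (ltnP b 10) => b10; last by rewrite nth_default.
by rewrite nth_vmk // => /eqnP->; rewrite step_refl.
Qed.

Lemma models_add_edge f g a b :
  models f g -> step (f a) (f b) -> models f (add_edge g a b).
Proof.
move=> [mu ma] ab; split=> // c d; rewrite bit_set_bits.
by case: ifP => [/orP[]/eqP[-> ->]|_ /mu] //; rewrite step_sym.
Qed.

Lemma models_del_edge f g a b :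
  models f g -> ~~ step (f a) (f b) -> models f (del_edge g a b).
Proof.
move=> [mu ma] ab; split=> // c d c10 d10; rewrite bit_set_bits.
case: ifP => [/orP[]/eqP[-> ->]|_] //; last exact: ma.
  by rewrite (negbTE ab).
by rewrite step_sym (negbTE ab).
Qed.

Lemma models_graph_of f l : satisfies f l -> models f (graph_of l).
Proof.
case: l => ys ns /andP[/= hys hns]; rewrite /graph_of /=.
have: models f (foldl (fun g p => add_edge g p.1 p.2) no_info ys).
  elim: ys no_info hys (models_no_info f) => //= p ys IH g /andP[hp hys] mg.
  by apply: IH => //; apply: models_add_edge.
elim: ns {ys hys} (foldl _ _ _) hns => //= p ns IH g /andP[hp hns] mg.
by apply: IH => //; apply: models_del_edge.
Qed.

Section Play.
Variables (f : nat -> G) (g : pgraph).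
Hypotheses (labf : labels f) (modf : models f g).

Definition true_fact (F : fact) :=
  match F with
  | (c, Some d, v) => forall r, r < 10 -> nth false v r -> two_win (f c) (f d) (f r)
  | (c, None, v) =>
    forall r, r < 10 -> nth false v r -> forall x, two_win (f c) x (f r)
  end.

Fixpoint true_facts (L : seq fact) : Prop :=
  if L is F :: L' then true_fact F /\ true_facts L' else True.

Lemma known_win L c d r : true_facts L -> r < 10 ->
  nth false (known g L c d) r -> two_win (f c) (f d) (f r).
Proof.
move=> trL r10; rewrite !nth_vor => /or3P[/(proj1 modf) h|/(proj1 modf) h|].
- by apply: two_win_step; rewrite h.
- by apply: two_win_step; rewrite h orbT.
elim: L trL => [|F L IHL] /=; first by rewrite nth_nil.
case=> trF trL; case: ifP => [|_]; last exact: IHL.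
rewrite nth_vor => aF /orP[|]; last exact: IHL.
move: F aF trF => [[c' [d'|]] v] /= /orP[].
- by case/andP=> /eqnP-> /eqnP-> h; apply: h.
- by case/andP=> /eqnP-> /eqnP-> h hr; apply: two_win_sym; apply: h.
- by move=> /eqnP-> h hr; apply: h.
by move=> /eqnP-> h hr; apply: two_win_sym; apply: h.
Qed.

Lemma infer_true L u : true_facts L -> true_facts (infer g L u).
Proof.
move=> trL; case: u => [c d c' d'|c d s] /=; case: ifP => // /andP[h1 h2]; split=> //=.
  have sc := proj1 modf _ _ h1; have sd := proj1 modf _ _ h2.
  move=> r r10; rewrite nth_vmk //.
  case/or3P=> [/eqnP->|/eqnP->|hv].
  - by apply: (TwoCatch sc sd); rewrite eqxx.
  - by apply: (TwoCatch sc sd); rewrite eqxx orbT.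
  apply: (TwoMove sc sd) => x; have [r' r'10 ->] := labf x => rr'.
  apply: (known_win trL r'10); apply: (vsubP hv).
  exact: (proj2 modf r r' r10 r'10 rr').
move=> r r10 rv x.
(* The robber's region is the set of vertices carrying a label in [s]. The rule bounds his moves by
   [may], so a move out of the region lands in reach of the cop on [c]. *)
pose S y := exists r', [/\ r' < 10, nth false (vset s) r' & y = f r'].
apply: (@two_win_confined G (f c) (f d) S conG); last by exists r.
  move=> _ y [r' [r'10 r'v ->]]; have [b b10 ->] := labf y => st.
  have rs : vsub (row (may g) r') (vor (vset s) (row (must g) c)).
    by apply: (allP h2); apply: nth_vset.
  have := vsubP rs (proj2 modf _ _ r'10 b10 st).
  rewrite nth_vor => /orP[bv|/(proj1 modf)]; last by right.
  by left; exists b.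
move=> _ [r' [r'10 r'v ->]]; apply: (known_win trL r'10).
exact: (vsubP h1 r'v).
Qed.

Lemma play_win us c d :
  vsub (nseq 10 true) (known g (foldl (infer g) [::] us) c d) -> goal.
Proof.
move=> h; apply: goal_win; apply: (@two_win_cops_win G (f c) (f d)) => x.
have [r r10 ->] := labf x.
have trL : true_facts (foldl (infer g) [::] us).
  have: true_facts [::] by [].
  by elim: us [::] {h} => //= u us IH L trL; apply/IH/infer_true.
by apply: (known_win trL r10); apply: vsubP h _; rewrite nth_nseq r10.
Qed.

End Play.

Definition refuted (l : clause) := forall f, labels f -> satisfies f l -> goal.

Lemma check_tree_sound lib g t : (forall i l, onth lib i = Some l -> refuted l) ->
  check_tree lib g t -> forall f, labels f -> models f g -> goal.
Proof.
move=> libP; elim: t g => [a b t1 IH1 t0 IH0|i s|c d us] g /=.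
- case/andP=> /IH1 h1 /IH0 h0 f labf modf.
  case ab: (step (f a) (f b)); first by apply: (h1 f) => //; apply: models_add_edge.
  by apply: (h0 f) => //; apply: models_del_edge; rewrite ?ab.
- case E: (onth lib i) => [l|//].
  case/andP=> /andP[s10 sP] /andP[/allP ys /allP ns] f labf [mu ma].
  (* The cited clause is applied to the labelling composed with [s]; this is what justifies
     arguments by symmetry. *)
  apply: (libP i l E (fun a => f (nth 0 s a))) => [x|].
    have [a a10 ->] := labf x.
    have /hasP[b bs /eqnP ab] : has (eqn a) s by apply: (allP sP); rewrite mem_iota.
    exists (index b s); last by rewrite nth_index ?ab.
    by apply: leq_trans s10; rewrite index_mem.
  apply/andP; split; apply/allP=> p.
    by move/ys/mu.
  by case/ns/and3P=> a10 b10; apply: contra => /ma; apply.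
by move=> h f labf modf; apply: play_win h.
Qed.

(** Each clause is checked against the library of its predecessors and only then put in front of it,
    so citations cannot be circular. *)
Lemma check_cert_sound lib lems t : (forall i l, onth lib i = Some l -> refuted l) ->
  check_cert lib lems t -> forall f, labels f -> goal.
Proof.
elim: lems lib => [|[l u] lems IH] lib libP /=.
  by move/(check_tree_sound libP)=> h f labf; apply: h labf (models_no_info f).
case/andP=> hu; apply: IH => -[|i] l' /=; last exact: libP.
case=> <- f labf sat; apply: (check_tree_sound libP hu labf).
exact: models_graph_of.
Qed.

End Soundness.

(** * From the Petersen clause to an isomorphism *)

Definition petersen_clause : clause :=
  let ps := [seq (a, b) | a <- iota 0 10, b <- iota a.+1 (9 - a)] in
  ([seq p <- ps | petersen_rel p.1 p.2], [seq p <- ps | ~~ petersen_rel p.1 p.2]).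

(** The clause yields a table of [step], in which equalities between vertices could hide. The closed
    neighbourhoods of the Petersen graph are pairwise distinct, so the labels name distinct vertices
    and the table becomes one of adjacency. *)
Lemma petersen_clauseP (G : sgraph) (f : nat -> G) :
  labels f -> satisfies f petersen_clause -> graph_iso G petersen.
Proof.
move=> labf /andP[/allP ys /allP ns].
have lt_step a b : a < b -> b < 10 -> step (f a) (f b) = petersen_rel a b.
  move=> ab b10.
  have abP : (a, b) \in [seq (a, b) | a <- iota 0 10, b <- iota a.+1 (9 - a)].
    apply/allpairsPdep; exists a, b.
    rewrite !mem_iota add0n (ltn_trans ab b10) ab addSn subnKC //.
    by rewrite -ltnS (ltn_trans ab b10).
  case E: (petersen_rel a b).
    by apply: (ys (a, b)); rewrite mem_filter E.
  by apply/negbTE/(ns (a, b)); rewrite mem_filter E.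
have stepf a b : a < 10 -> b < 10 -> step (f a) (f b) = petersen_step a b.
  rewrite /petersen_step; case: (ltngtP a b) => [ab|ba|->] a10 b10.
  - by rewrite lt_step // eqnE (ltn_eqF ab).
  - rewrite step_sym lt_step // eqnE (gtn_eqF ba) -!petersen_label_adj.
    exact: adj_sym.
  by rewrite step_refl eqnE eqxx.
have injf a b : a < 10 -> b < 10 -> (f a == f b) = eqn a b.
  move=> a10 b10; apply/eqP/eqnP=> [eab|-> //].
  have eqrow : all (fun c => petersen_step a c == petersen_step b c) (iota 0 10).
    by apply/allP=> c; rewrite mem_iota => c10; rewrite -!stepf // eab.
  have chk : all (fun a => all (fun b => eqn a b || has (fun c =>
    petersen_step a c != petersen_step b c) (iota 0 10)) (iota 0 10)) (iota 0 10).
    by vm_compute.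
  have /orP[/eqnP //|/hasP[c c10]] := all_iota10 (all_iota10 chk a10) b10.
  by rewrite (allP eqrow).
(* A right inverse of [f], by choice over the finite vertex set; [injf] makes it two-sided on labels
   below 10. *)
have [h hlt hK] : exists2 h : G -> nat, (forall x, h x < 10) & forall x, f (h x) = x.
  have /fin_all_exists2[h h1 h2] := labf.
  by exists h => // x; rewrite -h2.
have hf a : a < 10 -> h (f a) = a.
  by move=> a10; apply/eqnP; rewrite -injf // hK.
have /fin_all_exists2[k k1 k2] := petersen_label_surj.
exists (fun x => petersen_label (h x)); split.
  exists (fun y => f (k y)) => [x|y].
    suff -> : k (petersen_label (h x)) = h x by [].
    by apply/eqnP; rewrite -petersen_label_eq // -k2.
  by rewrite hf // -k2.
move=> x y; rewrite petersen_label_adj -{2}(hK x) -{2}(hK y).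
(* Off the diagonal, [step] and adjacency agree in both graphs; on it, both adjacencies are
   false. *)
have := stepf _ _ (hlt x) (hlt y); rewrite stepE injf // /petersen_step.
case: eqnP => [-> _|//]; rewrite adj_irr -petersen_label_adj.
exact: adj_irr.
Qed.

(* Found by a depth-first search that generalises each clause it refutes; only the
   check below is trusted. *)
Definition cert_lemmas : seq (clause * tree) := [::

(* Certificate: degree at least 6 *)
(([:: (0, 1); (0, 2); (0, 3); (0, 4); (0, 5); (0, 6); (7, 8); (7, 9)], [:: ]),
 (* Cops on 0 and 7 reach all ten labels. While one of them waits on 7, the robber is confined to
    the closed neighbourhood of 0, and he is lost once the other arrives at 0. *)
 Play 9 7 [:: Trap 7 0 [:: 0; 1; 2; 3; 4; 5; 6]]);
(([:: (0, 1); (0, 2); (0, 3); (0, 4); (0, 5); (0, 6); (7, 8)], [:: (7, 9); (8, 9)]),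
 (* The cop on 0 watches 0 to 6 and no edge leads from 7 or 8 to 9, so a robber on 7 or 8 has to
    wait there for the other cop. *)
 Play 9 0 [:: Trap 0 7 [:: 7; 8]]);
(([:: (0, 1); (0, 2); (0, 3); (0, 4); (0, 5); (0, 6); (7, 8)], [:: (7, 9)]),
 Fork 8 9
(Cite 1 [:: 0; 1; 2; 3; 4; 5; 6; 8; 7; 9])
(Cite 0 [:: 0; 1; 2; 3; 4; 5; 6; 7; 8; 9]));
(([:: (0, 1); (0, 2); (0, 3); (0, 4); (0, 5); (0, 6)], [:: ]),
 Fork 7 8
(Fork 7 9
(Cite 2 [:: 0; 1; 2; 3; 4; 5; 6; 7; 8; 9])
(Cite 0 [:: 0; 1; 2; 3; 4; 5; 6; 7; 8; 9]))
(Fork 7 9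
(Cite 0 [:: 0; 1; 2; 3; 4; 5; 6; 7; 9; 8])
(Fork 8 9
(Cite 1 [:: 0; 1; 2; 3; 4; 5; 6; 8; 9; 7])
(Play 9 0 [:: Trap 0 7 [:: 7]; Trap 0 8 [:: 8]]))));

(* Certificate: degree 5 *)
(([:: (0, 1); (0, 2); (0, 3); (0, 4); (0, 5); (6, 7); (6, 8); (8, 9)], [:: (7, 9)]),
 (* Cops on 0 and 8 leave only 7 out of reach. Moving from 8 to 6 attacks 7, and the one label then
    uncovered is 9, which is not adjacent to 7. Hence (0, 8) wins against every robber, and the trap
    extends this to any place of the first cop. *)
 Play 9 8 [:: Go 0 8 0 6; Trap 8 0 [:: 0; 1; 2; 3; 4; 5; 7]]);
(([:: (0, 2); (0, 3); (0, 4); (0, 5); (1, 6); (5, 9); (6, 7); (6, 8)], [:: (2, 9); (3, 9); (4, 9)]),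
 Play 9 8 [:: Go 5 6 0 6; Go 0 8 5 6; Trap 8 0 [:: 0; 1; 2; 3; 4; 5; 7; 9]]);
(([:: (0, 2); (0, 3); (0, 4); (0, 5); (1, 6); (6, 7); (6, 8)], [:: (0, 9); (2, 9); (3, 9); (4, 9); (5, 9)]),
 Play 9 6 [:: Trap 6 0 [:: 0; 2; 3; 4; 5]]);
(([:: (0, 2); (0, 3); (0, 4); (0, 5); (1, 6); (6, 7); (6, 8)], [:: (0, 9); (2, 9); (3, 9); (4, 9)]),
 Fork 5 9
(Cite 1 [:: 0; 1; 2; 3; 4; 5; 6; 7; 8; 9])
(Cite 0 [:: 0; 1; 2; 3; 4; 5; 6; 7; 8; 9]));
(([:: (0, 1); (0, 2); (0, 3); (0, 4); (0, 5); (1, 6); (5, 9); (6, 7); (6, 8); (8, 9)], [:: (2, 9); (3, 9); (4, 7)]),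
 Play 9 6 [:: Go 5 6 0 6; Go 5 6 0 8; Trap 6 5 [:: 0; 2; 3; 4; 5; 9]]);
(([:: (0, 1); (0, 2); (0, 3); (0, 4); (0, 5); (1, 6); (4, 9); (5, 9); (6, 7); (6, 8); (7, 9); (8, 9)], [:: (2, 9); (3, 9)]),
 Fork 5 7
(Fork 4 8
(Fork 1 7
(Play 9 8 [:: Go 4 7 0 6; Go 8 1 4 7; Trap 8 1 [:: 0; 1; 2; 3; 5; 7; 9]])
(Play 9 8 [:: Go 5 8 0 6; Go 5 8 0 8; Trap 8 5 [:: 0; 1; 2; 3; 5; 7]]))
(Cite 0 [:: 0; 1; 2; 3; 4; 5; 6; 8; 7; 9]))
(Cite 0 [:: 0; 1; 2; 3; 5; 4; 6; 7; 8; 9]));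
(([:: (0, 1); (0, 2); (0, 3); (0, 4); (0, 5); (1, 6); (4, 9); (6, 7); (6, 8); (7, 9); (8, 9)], [:: (2, 9); (3, 9)]),
 Fork 5 9
(Cite 0 [:: 0; 1; 2; 3; 4; 5; 6; 7; 8; 9])
(Cite 4 [:: 0; 1; 2; 3; 5; 4; 6; 7; 8; 9]));
(([:: (0, 1); (0, 2); (0, 3); (0, 4); (0, 5); (1, 6); (3, 9); (4, 9); (5, 9); (6, 7); (6, 8); (7, 9); (8, 9)], [:: (0, 7); (0, 8)]),
 Fork 2 6
(Fork 3 6
(Cite 1 [:: 6; 3; 7; 8; 1; 2; 9; 4; 5; 0])
(Fork 4 6
(Cite 1 [:: 6; 4; 7; 8; 1; 2; 9; 3; 5; 0])
(Cite 1 [:: 0; 5; 3; 4; 1; 2; 9; 7; 8; 6])))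
(Cite 6 [:: 9; 3; 4; 5; 7; 8; 0; 2; 1; 6]));
(([:: (0, 1); (0, 2); (0, 3); (0, 4); (0, 5); (1, 6); (3, 9); (4, 9); (6, 7); (6, 8); (7, 9); (8, 9)], [:: (0, 7); (0, 8); (2, 9)]),
 Fork 5 9
(Cite 0 [:: 0; 1; 2; 3; 4; 5; 6; 7; 8; 9])
(Cite 2 [:: 0; 1; 2; 5; 3; 4; 6; 7; 8; 9]));
(([:: (0, 1); (0, 2); (0, 3); (0, 4); (0, 5); (1, 6); (3, 9); (6, 7); (6, 8); (7, 9); (8, 9)], [:: (0, 7); (0, 8); (2, 9)]),
 Fork 4 9
(Cite 0 [:: 0; 1; 2; 3; 4; 5; 6; 7; 8; 9])
(Cite 2 [:: 0; 1; 2; 4; 3; 5; 6; 7; 8; 9]));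
(([:: (0, 1); (0, 2); (0, 3); (0, 4); (0, 5); (1, 6); (6, 7); (6, 8); (7, 9); (8, 9)], [:: (0, 7); (0, 8); (0, 9)]),
 Fork 2 9
(Fork 3 6
(Fork 4 6
(Cite 2 [:: 0; 2; 5; 1; 3; 4; 9; 7; 8; 6])
(Cite 1 [:: 0; 2; 4; 1; 3; 5; 9; 7; 8; 6]))
(Cite 0 [:: 0; 2; 3; 1; 4; 5; 9; 7; 8; 6]))
(Fork 3 9
(Cite 0 [:: 0; 1; 2; 3; 4; 5; 6; 7; 8; 9])
(Fork 4 9
(Cite 3 [:: 0; 1; 2; 3; 4; 5; 6; 7; 8; 9])
(Cite 6 [:: 0; 1; 2; 3; 4; 5; 6; 7; 8; 9]))));
(([:: (0, 1); (0, 2); (0, 3); (0, 4); (0, 5); (6, 7); (6, 8); (8, 9)], [:: (0, 6); (0, 7); (0, 8); (0, 9)]),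
 (* The pair 7 9 closes the four labels outside the neighbourhood of 0 to the cycle 6, 7, 9, 8. An
    induced 4-cycle is the only connected graph on four vertices in which a single cop cannot
    win. *)
 Fork 7 9
(Fork 1 6
(Cite 0 [:: 0; 1; 2; 3; 4; 5; 6; 7; 8; 9])
(Fork 2 6
(Cite 0 [:: 0; 2; 1; 3; 4; 5; 6; 7; 8; 9])
(Fork 3 6
(Cite 0 [:: 0; 3; 1; 2; 4; 5; 6; 7; 8; 9])
(Fork 4 6
(Cite 0 [:: 0; 4; 1; 2; 3; 5; 6; 7; 8; 9])
(Fork 5 6
(Cite 0 [:: 0; 5; 1; 2; 3; 4; 6; 7; 8; 9])
(* Now 6 is adjacent to none of 0 to 5, and a cop on 9 watches 7, 8 and 9, so the robber cannot
   change between the two regions. *)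
(Play 9 9 [:: Trap 9 0 [:: 0; 1; 2; 3; 4; 5]; Trap 9 6 [:: 6]]))))))
(Cite 10 [:: 0; 1; 2; 3; 4; 5; 6; 7; 8; 9]));
(([:: (0, 1); (0, 2); (0, 3); (0, 4); (0, 5); (6, 7); (8, 9)], [:: (6, 8); (6, 9)]),
 Fork 7 8
(Cite 11 [:: 0; 1; 2; 3; 4; 5; 7; 6; 8; 9])
(Fork 7 9
(Cite 11 [:: 0; 1; 2; 3; 4; 5; 7; 6; 9; 8])
(Play 9 0 [:: Trap 0 6 [:: 6; 7]])));
(([:: (0, 1); (0, 2); (0, 3); (0, 4); (0, 5); (6, 7); (8, 9)], [:: (0, 6); (0, 7); (0, 8); (0, 9); (6, 8)]),
 Fork 6 9
(Cite 1 [:: 0; 1; 2; 3; 4; 5; 6; 7; 9; 8])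
(Cite 0 [:: 0; 1; 2; 3; 4; 5; 6; 7; 8; 9]));
(([:: (0, 1); (0, 2); (0, 3); (0, 4); (0, 5); (6, 7); (6, 8)], [:: (6, 9); (7, 9); (8, 9)]),
 Play 9 0 [:: Trap 0 6 [:: 6; 7; 8]]);
(([:: (0, 1); (0, 2); (0, 3); (0, 4); (0, 5); (6, 7); (6, 8)], [:: (7, 9); (8, 9)]),
 Fork 6 9
(Play 9 6 [:: Trap 6 0 [:: 0; 1; 2; 3; 4; 5]])
(Cite 0 [:: 0; 1; 2; 3; 4; 5; 6; 7; 8; 9]));
(([:: (0, 1); (0, 2); (0, 3); (0, 4); (0, 5); (6, 7); (6, 8)], [:: (8, 9)]),
 Fork 7 9
(Cite 15 [:: 0; 1; 2; 3; 4; 5; 6; 8; 7; 9])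
(Cite 0 [:: 0; 1; 2; 3; 4; 5; 6; 7; 8; 9]));
(([:: (0, 1); (0, 2); (0, 3); (0, 4); (0, 5); (6, 7)], [:: (6, 8); (6, 9); (7, 8); (7, 9); (8, 9)]),
 Play 9 0 [:: Trap 0 6 [:: 6; 7]; Trap 0 8 [:: 8]]);
(([:: (0, 1); (0, 2); (0, 3); (0, 4); (0, 5); (6, 7)], [:: (6, 8); (6, 9); (7, 8); (8, 9)]),
 Fork 7 9
(Cite 3 [:: 0; 1; 2; 3; 4; 5; 7; 6; 9; 8])
(Cite 0 [:: 0; 1; 2; 3; 4; 5; 6; 7; 8; 9]));
(([:: (0, 1); (0, 2); (0, 3); (0, 4); (0, 5); (6, 7)], [:: (6, 8); (7, 8); (8, 9)]),
 Fork 6 9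
(Cite 4 [:: 0; 1; 2; 3; 4; 5; 6; 7; 9; 8])
(Cite 0 [:: 0; 1; 2; 3; 4; 5; 6; 7; 8; 9]));
(([:: (0, 1); (0, 2); (0, 3); (0, 4); (0, 5); (6, 7)], [:: (6, 8); (8, 9)]),
 Fork 7 8
(Cite 3 [:: 0; 1; 2; 3; 4; 5; 7; 6; 8; 9])
(Cite 0 [:: 0; 1; 2; 3; 4; 5; 6; 7; 8; 9]));
(([:: (0, 1); (0, 2); (0, 3); (0, 4); (0, 5); (6, 7)], [:: (0, 6); (0, 7); (0, 8); (0, 9)]),
 Fork 8 9
(Fork 6 8
(Cite 9 [:: 0; 1; 2; 3; 4; 5; 6; 7; 8; 9])
(Cite 7 [:: 0; 1; 2; 3; 4; 5; 6; 7; 8; 9]))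
(Fork 6 8
(Cite 4 [:: 0; 1; 2; 3; 4; 5; 6; 7; 8; 9])
(Cite 0 [:: 0; 1; 2; 3; 4; 5; 6; 7; 8; 9])));
(([:: (0, 1); (0, 2); (0, 3); (0, 4); (0, 5)], [:: (0, 6); (0, 7); (0, 8); (0, 9)]),
 Fork 6 7
(Cite 0 [:: 0; 1; 2; 3; 4; 5; 6; 7; 8; 9])
(Fork 6 8
(Cite 0 [:: 0; 1; 2; 3; 4; 5; 6; 8; 7; 9])
(Fork 6 9
(Cite 0 [:: 0; 1; 2; 3; 4; 5; 6; 9; 7; 8])
(Fork 7 8
(Cite 2 [:: 0; 1; 2; 3; 4; 5; 7; 8; 6; 9])
(Fork 7 9
(Cite 3 [:: 0; 1; 2; 3; 4; 5; 7; 9; 6; 8])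
(Fork 8 9
(Cite 4 [:: 0; 1; 2; 3; 4; 5; 8; 9; 6; 7])
(Play 9 0 [:: Trap 0 6 [:: 6]; Trap 0 7 [:: 7]; Trap 0 8 [:: 8]])))))));
(([:: (0, 1); (0, 2); (0, 3); (0, 4); (0, 5)], [:: (0, 6); (0, 7); (0, 8)]),
 Fork 0 9
(Cite 23 [:: 0; 1; 2; 3; 4; 5; 9; 6; 7; 8])
(Cite 0 [:: 0; 1; 2; 3; 4; 5; 6; 7; 8; 9]));
(([:: (0, 1); (0, 2); (0, 3); (0, 4); (0, 5)], [:: (0, 6); (0, 7)]),
 Fork 0 8
(Cite 24 [:: 0; 1; 2; 3; 4; 5; 8; 6; 7; 9])
(Cite 0 [:: 0; 1; 2; 3; 4; 5; 6; 7; 8; 9]));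
(([:: (0, 1); (0, 2); (0, 3); (0, 4); (0, 5)], [:: (0, 6)]),
 Fork 0 7
(Cite 25 [:: 0; 1; 2; 3; 4; 5; 7; 6; 8; 9])
(Cite 0 [:: 0; 1; 2; 3; 4; 5; 6; 7; 8; 9]));

(* Certificate: degree 4 *)
(([:: (0, 1); (0, 2); (0, 3); (0, 4); (5, 6); (5, 7); (5, 8); (5, 9)], [:: ]),
 Play 9 5 [:: Trap 5 0 [:: 0; 1; 2; 3; 4]]);
(([:: (0, 1); (0, 2); (0, 3); (0, 4); (2, 9); (5, 6); (6, 7); (6, 8); (7, 8); (8, 9)], [:: (1, 5); (3, 9); (4, 9)]),
 Play 9 6 [:: Go 2 6 0 8; Go 2 6 0 6; Trap 6 2 [:: 0; 1; 2; 3; 4; 9]]);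
(([:: (0, 1); (0, 2); (0, 3); (0, 4); (1, 9); (2, 9); (5, 6); (5, 7); (5, 9); (6, 7); (6, 8); (7, 8); (8, 9)], [:: (0, 5); (3, 9); (4, 9); (5, 8)]),
 Fork 1 5
(Fork 2 5
(Cite 3 [:: 5; 1; 2; 6; 7; 9; 0; 8; 3; 4])
(Cite 0 [:: 0; 2; 1; 3; 4; 5; 6; 7; 8; 9]))
(Cite 0 [:: 0; 1; 2; 3; 4; 5; 6; 7; 8; 9]));
(([:: (0, 1); (0, 2); (0, 3); (0, 4); (1, 9); (2, 9); (5, 6); (5, 7); (5, 9); (6, 7); (6, 8); (7, 8); (8, 9)], [:: (0, 5); (0, 6); (0, 7); (3, 9); (5, 8)]),
 Fork 4 9
(Cite 16 [:: 9; 1; 2; 4; 5; 8; 0; 3; 6; 7])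
(Cite 0 [:: 0; 1; 2; 3; 4; 5; 6; 7; 8; 9]));
(([:: (0, 1); (0, 2); (0, 3); (0, 4); (1, 9); (5, 6); (5, 7); (5, 9); (6, 7); (6, 8); (7, 8); (8, 9)], [:: (0, 5); (2, 9); (3, 9); (5, 8)]),
 Fork 4 9
(Cite 1 [:: 0; 1; 4; 2; 3; 5; 6; 7; 8; 9])
(Cite 28 [:: 0; 5; 2; 3; 4; 1; 6; 7; 8; 9]));
(([:: (0, 1); (0, 2); (0, 3); (0, 4); (1, 9); (5, 6); (5, 7); (5, 9); (6, 7); (6, 8); (7, 8); (8, 9)], [:: (0, 5); (0, 6); (0, 7); (2, 9); (5, 8)]),
 Fork 3 9
(Cite 1 [:: 0; 1; 3; 2; 4; 5; 6; 7; 8; 9])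
(Cite 0 [:: 0; 1; 2; 3; 4; 5; 6; 7; 8; 9]));
(([:: (0, 1); (0, 2); (0, 3); (0, 4); (1, 8); (2, 5); (5, 7); (6, 7); (7, 8); (8, 9)], [:: (3, 5); (4, 5); (6, 9)]),
 Play 9 8 [:: Go 2 8 0 7; Go 0 8 0 7; Go 0 8 2 8; Trap 8 0 [:: 0; 2; 3; 4; 5; 6]]);
(([:: (0, 1); (0, 2); (0, 3); (0, 4); (1, 8); (2, 5); (5, 6); (5, 7); (5, 9); (6, 7); (7, 8); (8, 9)], [:: (0, 5); (3, 5); (5, 8); (6, 9)]),
 Fork 4 5
(Cite 9 [:: 5; 2; 4; 6; 7; 9; 0; 3; 8; 1])
(Cite 0 [:: 0; 1; 2; 3; 4; 5; 6; 7; 8; 9]));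
(([:: (0, 1); (0, 2); (0, 3); (0, 4); (1, 8); (5, 6); (5, 7); (5, 9); (6, 7); (7, 8); (8, 9)], [:: (0, 5); (0, 9); (5, 8); (6, 9)]),
 Fork 2 5
(Fork 3 5
(Cite 9 [:: 5; 2; 3; 6; 7; 9; 0; 8; 1; 4])
(Cite 0 [:: 0; 1; 2; 3; 4; 5; 6; 7; 8; 9]))
(Fork 3 5
(Cite 0 [:: 0; 1; 3; 2; 4; 5; 6; 7; 8; 9])
(Fork 4 5
(Cite 1 [:: 0; 1; 4; 2; 3; 5; 6; 7; 8; 9])
(Play 9 8 [:: Go 0 8 0 7; Go 1 8 0 7; Go 1 8 0 8; Go 1 7 0 8; Go 8 7 1 8; Go 8 7 1 7; Trap 8 7 [:: 0; 2; 3; 4; 5; 6]]))));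
(([:: (0, 1); (0, 2); (0, 3); (0, 4); (5, 6); (5, 7); (5, 9); (6, 7); (7, 8); (8, 9)], [:: (0, 5); (0, 8); (0, 9); (5, 8); (6, 9)]),
 Fork 1 8
(Cite 0 [:: 0; 1; 2; 3; 4; 5; 6; 7; 8; 9])
(Fork 2 8
(Cite 0 [:: 0; 2; 1; 3; 4; 5; 6; 7; 8; 9])
(Fork 3 8
(Cite 0 [:: 0; 3; 1; 2; 4; 5; 6; 7; 8; 9])
(Cite 31 [:: 0; 6; 1; 2; 3; 4; 5; 7; 9; 8]))));
(([:: (0, 1); (0, 2); (0, 3); (0, 4); (5, 6); (5, 7); (5, 9); (6, 7); (7, 8); (8, 9)], [:: (0, 5); (0, 6); (0, 7); (0, 8); (0, 9); (5, 8)]),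
 Fork 7 9
(Cite 9 [:: 0; 1; 2; 3; 4; 7; 5; 6; 8; 9])
(Fork 6 9
(Fork 1 8
(Fork 2 8
(Fork 3 8
(Cite 23 [:: 8; 1; 2; 3; 7; 9; 0; 4; 5; 6])
(Cite 6 [:: 0; 1; 2; 3; 4; 7; 5; 6; 9; 8]))
(Cite 4 [:: 0; 1; 2; 3; 4; 7; 5; 6; 9; 8]))
(Fork 2 8
(Cite 4 [:: 0; 2; 1; 3; 4; 7; 5; 6; 9; 8])
(Fork 3 8
(Cite 5 [:: 0; 3; 1; 2; 4; 7; 5; 6; 9; 8])
(Cite 32 [:: 0; 7; 1; 2; 3; 4; 5; 6; 9; 8]))))
(Cite 0 [:: 0; 1; 2; 3; 4; 5; 6; 7; 8; 9])));
(([:: (0, 1); (0, 2); (0, 3); (0, 4); (1, 2); (1, 5); (1, 7); (3, 4); (3, 6); (4, 8); (5, 9); (8, 9)], [:: (5, 7); (6, 8); (6, 9); (7, 9)]),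
 Play 9 9 [:: Go 1 4 1 3; Go 0 8 1 4; Go 5 0 1 4; Go 0 9 0 8; Go 0 9 0 5; Trap 9 0 [:: 0; 1; 2; 3; 4; 6; 7]]);
(([:: (0, 1); (0, 2); (0, 3); (0, 4); (1, 2); (1, 7); (5, 6); (5, 9); (6, 7); (8, 9)], [:: (3, 8); (4, 8); (6, 8); (7, 9)]),
 Play 9 6 [:: Go 0 5 1 9; Go 1 5 1 9; Go 0 6 1 5; Go 0 6 0 5; Trap 6 0 [:: 0; 1; 2; 3; 4; 8; 9]]);
(([:: (0, 1); (0, 2); (0, 3); (0, 4); (1, 2); (1, 5); (3, 4); (3, 6); (5, 6); (5, 9); (6, 7); (7, 8); (8, 9)], [:: (0, 9); (5, 7); (5, 8); (6, 8); (6, 9); (7, 9)]),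
 Fork 1 7
(Fork 3 8
(Play 9 9 [:: Go 5 0 1 3; Go 0 8 1 3; Go 0 9 0 8; Go 0 9 0 5; Trap 9 0 [:: 0; 1; 2; 3; 4; 6; 7]])
(Fork 4 8
(Cite 1 [:: 0; 1; 2; 3; 4; 5; 6; 7; 8; 9])
(Cite 0 [:: 0; 1; 2; 3; 4; 5; 6; 7; 8; 9])))
(Fork 2 7
(Fork 3 8
(Cite 1 [:: 0; 3; 4; 2; 1; 8; 7; 6; 5; 9])
(Fork 4 8
(Fork 2 9
(Cite 1 [:: 0; 2; 1; 4; 3; 9; 8; 7; 6; 5])
(Play 9 4 [:: Go 3 1 4 5; Go 4 1 4 5; Go 2 3 1 3; Go 2 4 1 4; Go 2 3 2 4; Go 1 4 2 3; Trap 4 1 [:: 0; 1; 2; 5; 6; 7; 9]]))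
(Cite 0 [:: 0; 2; 1; 3; 4; 5; 6; 7; 8; 9])))
(Cite 0 [:: 0; 3; 4; 1; 2; 9; 5; 6; 7; 8])));
(([:: (0, 1); (0, 2); (0, 3); (0, 4); (1, 2); (1, 5); (3, 4); (5, 6); (5, 9); (6, 7); (7, 8); (8, 9)], [:: (0, 9); (5, 7); (5, 8); (6, 8); (6, 9); (7, 9)]),
 Fork 3 6
(Cite 0 [:: 0; 1; 2; 3; 4; 5; 6; 7; 8; 9])
(Fork 4 6
(Cite 0 [:: 0; 1; 2; 4; 3; 5; 6; 7; 8; 9])
(Cite 1 [:: 0; 1; 2; 3; 4; 8; 9; 5; 6; 7])));
(([:: (0, 1); (0, 2); (0, 3); (0, 4); (5, 6); (7, 8); (8, 9)], [:: (0, 5); (0, 6); (1, 5); (1, 6); (2, 5); (2, 6); (3, 5); (3, 6); (4, 5); (4, 6)]),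
 Play 9 8 [:: Trap 8 0 [:: 0; 1; 2; 3; 4]; Trap 8 5 [:: 5; 6]]);
(([:: (0, 1); (0, 2); (0, 3); (0, 4); (3, 4); (5, 6); (5, 9); (6, 7); (7, 8); (8, 9)], [:: (0, 5); (0, 6); (1, 5); (1, 6); (1, 7); (1, 9); (2, 5); (2, 6); (2, 7); (2, 9); (5, 7); (5, 8); (6, 8); (6, 9)]),
 Fork 3 5
(Cite 3 [:: 0; 3; 4; 1; 2; 7; 6; 5; 9; 8])
(Fork 3 6
(Cite 3 [:: 0; 3; 4; 1; 2; 9; 5; 6; 7; 8])
(Fork 4 5
(Cite 3 [:: 0; 4; 3; 1; 2; 7; 6; 5; 9; 8])
(Fork 4 6
(Cite 3 [:: 0; 4; 3; 1; 2; 9; 5; 6; 7; 8])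
(Cite 0 [:: 0; 1; 2; 3; 4; 5; 6; 7; 8; 9])))));
(([:: (0, 1); (0, 2); (0, 3); (0, 4); (1, 2); (1, 8); (4, 6); (5, 6); (5, 9); (6, 7); (8, 9)], [:: (2, 6); (3, 8); (3, 9); (5, 7); (6, 8); (7, 9)]),
 Play 9 8 [:: Go 1 6 0 6; Go 0 5 1 6; Go 8 4 1 6; Go 1 4 1 6; Go 0 9 0 5; Go 8 0 1 4; Go 0 8 0 9; Go 4 8 0 9; Go 0 8 4 8; Trap 8 0 [:: 0; 2; 3; 4; 5; 6; 7]]);
(([:: (0, 1); (1, 2); (3, 6); (4, 6); (5, 6); (6, 7); (8, 9)], [:: (0, 8); (0, 9); (1, 8); (1, 9); (2, 8); (2, 9)]),
 Play 9 6 [:: Trap 6 1 [:: 0; 1; 2]]);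
(([:: (0, 1); (0, 2); (0, 4); (1, 2); (1, 5); (1, 9); (3, 7); (4, 6); (4, 8); (6, 7); (7, 8)], [:: (3, 4); (5, 8); (6, 9)]),
 Play 9 7 [:: Go 1 8 1 7; Go 1 6 1 7; Go 0 7 1 6; Go 0 7 1 8; Trap 7 0 [:: 0; 1; 2; 4; 5; 9]]);
(([:: (0, 1); (0, 2); (0, 3); (0, 4); (1, 2); (1, 3); (1, 9); (4, 6); (4, 8); (5, 6); (6, 7); (7, 8)], [:: (5, 7); (5, 8); (6, 9)]),
 Play 9 8 [:: Go 1 4 1 6; Go 0 7 1 6; Go 1 8 0 7; Go 1 8 1 4; Trap 8 1 [:: 0; 1; 2; 3; 5; 6; 9]]);
(([:: (0, 1); (0, 2); (0, 3); (0, 4); (3, 5); (3, 7); (4, 6); (4, 8); (5, 6); (5, 9); (7, 8); (8, 9)], [:: (1, 7); (1, 8); (2, 6); (5, 7); (6, 9)]),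
 Play 9 8 [:: Go 4 3 0 5; Go 4 5 0 5; Go 3 8 3 4; Go 0 8 3 4; Go 0 9 0 8; Go 3 8 0 9; Go 4 5 0 9; Go 8 3 4 5; Trap 8 3 [:: 0; 1; 2; 3; 5; 6]]);
(([:: (0, 1); (0, 2); (0, 3); (0, 4); (1, 2); (1, 9); (3, 5); (3, 7); (4, 6); (4, 8); (5, 6); (5, 9); (6, 7); (7, 8); (8, 9)], [:: (0, 5); (0, 8); (0, 9); (3, 4); (3, 6); (5, 7); (5, 8); (6, 8); (6, 9); (7, 9)]),
 Fork 1 5
(Cite 2 [:: 0; 1; 2; 3; 4; 5; 6; 7; 8; 9])
(Fork 1 8
(Cite 2 [:: 0; 1; 2; 4; 3; 9; 5; 6; 7; 8])
(Fork 1 3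
(Cite 1 [:: 0; 1; 2; 3; 4; 5; 6; 7; 8; 9])
(Fork 1 4
(Cite 1 [:: 0; 1; 2; 4; 3; 8; 7; 6; 5; 9])
(Fork 1 6
(Fork 1 7
(Cite 34 [:: 1; 0; 2; 6; 7; 9; 3; 5; 4; 8])
(Fork 2 6
(Cite 35 [:: 6; 1; 2; 4; 5; 7; 0; 3; 8; 9])
(Cite 0 [:: 0; 1; 2; 3; 4; 5; 6; 7; 8; 9])))
(Fork 2 7
(Play 9 9 [:: Go 7 8 2 8; Go 7 4 2 8; Go 8 7 4 7; Go 7 9 7 8; Go 2 8 7 9; Go 2 9 7 9; Go 6 1 7 9; Go 1 4 1 6; Go 0 9 2 9; Go 2 4 1 6; Go 2 8 2 4; Go 0 9 2 8; Go 1 4 2 8; Go 9 0 1 4; Trap 9 0 [:: 0; 2; 3; 4; 6; 7]])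
(Cite 0 [:: 0; 1; 2; 4; 3; 8; 7; 6; 5; 9])))))));
(([:: (0, 1); (0, 2); (0, 3); (0, 4); (3, 5); (4, 8); (5, 6); (6, 7); (7, 8); (8, 9)], [:: (1, 9); (2, 9); (5, 8); (6, 9); (7, 9)]),
 Play 9 6 [:: Go 5 4 3 8; Go 0 7 3 8; Go 0 6 0 7; Go 0 6 4 5; Trap 6 0 [:: 0; 1; 2; 3; 4; 8; 9]]);
(([:: (0, 1); (0, 2); (0, 3); (0, 4); (1, 2); (3, 5); (3, 7); (4, 6); (4, 8); (5, 6); (5, 9); (6, 7); (7, 8); (8, 9)], [:: (0, 5); (0, 8); (0, 9); (3, 4); (3, 6); (5, 7); (5, 8); (6, 8); (6, 9); (7, 9)]),
 Fork 1 9
(Cite 1 [:: 0; 1; 2; 3; 4; 5; 6; 7; 8; 9])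
(Fork 2 9
(Cite 1 [:: 0; 2; 1; 3; 4; 5; 6; 7; 8; 9])
(Cite 0 [:: 0; 1; 2; 3; 4; 5; 6; 7; 8; 9])));
(([:: (0, 1); (0, 2); (0, 3); (1, 2); (1, 5); (4, 6); (5, 9); (6, 7); (7, 8); (8, 9)], [:: (3, 4); (3, 6); (4, 8); (4, 9); (5, 7); (6, 9)]),
 Play 9 9 [:: Go 1 7 1 6; Go 0 8 1 7; Go 1 8 1 7; Go 0 9 0 8; Go 0 9 1 8; Trap 9 0 [:: 0; 1; 2; 3; 4; 6; 7]]);
(([:: (0, 1); (0, 2); (0, 3); (0, 4); (3, 7); (5, 6); (5, 9); (6, 7); (8, 9)], [:: (1, 8); (2, 8); (4, 8); (6, 8); (7, 9)]),
 Play 9 6 [:: Go 0 5 3 9; Go 3 5 3 9; Go 0 6 3 5; Go 0 6 0 5; Trap 6 0 [:: 0; 1; 2; 3; 4; 8; 9]]);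
(([:: (0, 1); (0, 2); (0, 3); (0, 4); (1, 2); (3, 7); (5, 6); (5, 9); (6, 7); (7, 8); (8, 9)], [:: (3, 9); (4, 8); (4, 9); (5, 8); (6, 8); (7, 9)]),
 Fork 1 8
(Cite 14 [:: 0; 1; 2; 3; 4; 6; 7; 8; 9; 5])
(Fork 2 8
(Cite 14 [:: 0; 2; 1; 3; 4; 6; 7; 8; 9; 5])
(Cite 0 [:: 0; 1; 2; 3; 4; 5; 6; 7; 8; 9])));
(([:: (0, 1); (0, 2); (0, 3); (0, 4); (1, 2); (3, 5); (3, 7); (4, 6); (5, 6); (5, 9); (6, 7); (7, 8); (8, 9)], [:: (0, 5); (0, 7); (0, 8); (0, 9); (3, 4); (5, 7); (5, 8); (6, 8); (6, 9); (7, 9)]),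
 Fork 3 6
(Fork 3 8
(Cite 28 [:: 3; 0; 5; 6; 7; 8; 4; 1; 2; 9])
(Fork 3 9
(Cite 29 [:: 3; 0; 5; 6; 7; 9; 4; 8; 1; 2])
(Fork 1 6
(Cite 41 [:: 6; 1; 3; 4; 5; 7; 0; 2; 8; 9])
(Fork 2 6
(Cite 41 [:: 6; 2; 3; 4; 5; 7; 0; 1; 8; 9])
(Fork 1 8
(Cite 10 [:: 0; 1; 2; 3; 4; 5; 6; 7; 8; 9])
(Fork 1 9
(Cite 10 [:: 0; 1; 2; 3; 4; 7; 6; 5; 9; 8])
(Fork 2 8
(Cite 10 [:: 0; 2; 1; 3; 4; 5; 6; 7; 8; 9])
(Fork 2 9
(Cite 10 [:: 0; 2; 1; 3; 4; 7; 6; 5; 9; 8])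
(Cite 9 [:: 0; 1; 2; 3; 4; 5; 6; 7; 8; 9])))))))))
(Fork 4 8
(Cite 3 [:: 0; 1; 2; 3; 4; 5; 6; 7; 8; 9])
(Fork 4 9
(Cite 3 [:: 0; 1; 2; 3; 4; 7; 6; 5; 9; 8])
(Fork 1 5
(Cite 2 [:: 0; 1; 2; 3; 4; 5; 6; 7; 8; 9])
(Fork 2 5
(Cite 2 [:: 0; 2; 1; 3; 4; 5; 6; 7; 8; 9])
(Fork 3 9
(Cite 4 [:: 0; 1; 2; 3; 4; 9; 8; 7; 6; 5])
(Cite 0 [:: 0; 1; 2; 3; 4; 5; 6; 7; 8; 9])))))));
(([:: (0, 1); (1, 2); (1, 8); (3, 5); (4, 6); (5, 6); (5, 9); (6, 7)], [:: (3, 4); (3, 7); (4, 9); (7, 9)]),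
 Play 9 9 [:: Go 1 5 1 6; Go 0 9 1 5; Trap 9 0 [:: 0; 1; 2; 3; 4; 6; 7; 8]]);
(([:: (0, 1); (0, 2); (0, 3); (0, 4); (3, 9); (4, 6); (5, 6); (5, 9); (6, 7); (8, 9)], [:: (0, 8); (1, 8); (2, 8); (7, 9)]),
 Play 9 6 [:: Go 6 3 6 9; Go 0 6 3 6; Go 0 5 3 6; Go 0 6 0 5; Trap 6 0 [:: 0; 1; 2; 3; 8; 9]]);
(([:: (0, 1); (0, 2); (0, 4); (3, 5); (4, 6); (5, 6); (5, 9); (6, 7); (7, 8); (8, 9)], [:: (0, 5); (1, 5); (2, 5); (3, 7); (3, 8); (3, 9); (5, 7); (6, 9)]),
 Play 9 7 [:: Go 4 6 0 5; Go 4 9 0 5; Go 0 6 0 5; Go 4 7 0 6; Go 4 8 4 9; Go 0 7 0 6; Go 0 8 4 9; Go 0 7 0 8; Go 4 7 0 8; Go 4 7 0 7; Go 4 8 0 7; Go 4 6 0 7; Go 6 7 4 7; Go 6 7 4 6; Go 6 7 4 8; Trap 7 6 [:: 0; 1; 2; 3; 4; 5; 9]]);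
(([:: (0, 1); (0, 2); (0, 3); (0, 4); (1, 2); (3, 5); (4, 6); (5, 6); (5, 9); (6, 7); (7, 8); (8, 9)], [:: (0, 5); (0, 6); (0, 7); (0, 8); (0, 9); (3, 4); (3, 7); (5, 7); (5, 8); (6, 8); (6, 9); (7, 9)]),
 Fork 4 9
(Cite 3 [:: 0; 1; 2; 4; 3; 6; 5; 9; 8; 7])
(Fork 1 8
(Cite 2 [:: 0; 1; 2; 3; 4; 5; 6; 7; 8; 9])
(Fork 2 8
(Cite 2 [:: 0; 2; 1; 3; 4; 5; 6; 7; 8; 9])
(Fork 3 9
(Cite 1 [:: 0; 1; 2; 3; 4; 5; 6; 7; 8; 9])
(Fork 1 5
(Cite 19 [:: 0; 1; 2; 3; 4; 7; 6; 5; 9; 8])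
(Fork 2 5
(Cite 19 [:: 0; 2; 1; 3; 4; 7; 6; 5; 9; 8])
(Fork 3 8
(Cite 1 [:: 0; 1; 2; 4; 3; 7; 8; 9; 5; 6])
(Cite 0 [:: 0; 1; 2; 3; 4; 5; 6; 7; 8; 9]))))))));
(([:: (0, 1); (0, 2); (0, 3); (0, 4); (1, 2); (1, 7); (3, 5); (5, 6); (5, 9); (7, 8); (8, 9)], [:: (0, 8); (3, 4); (4, 6); (5, 7); (6, 8); (6, 9)]),
 Fork 2 5
(Play 9 7 [:: Go 0 9 1 5; Go 0 8 0 9; Go 1 9 0 8; Go 7 5 1 9; Go 1 5 1 9; Go 7 5 1 5; Trap 7 5 [:: 0; 2; 3; 4; 5; 6; 9]])
(Play 9 7 [:: Go 1 3 1 5; Go 0 9 1 5; Go 7 3 1 5; Go 7 0 1 3; Go 0 8 0 9; Go 3 7 0 8; Go 0 7 0 8; Go 0 7 3 7; Trap 7 0 [:: 0; 2; 3; 4; 5; 6; 9]]));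
(([:: (0, 1); (0, 2); (0, 3); (0, 4); (1, 2); (3, 5); (5, 6); (5, 9); (6, 7); (7, 8); (8, 9)], [:: (0, 7); (0, 8); (0, 9); (3, 4); (4, 6); (4, 9); (5, 7); (5, 8); (6, 8); (6, 9); (7, 9)]),
 Fork 1 7
(Cite 0 [:: 0; 1; 2; 3; 4; 5; 6; 7; 8; 9])
(Fork 1 8
(Cite 0 [:: 0; 1; 2; 3; 4; 5; 9; 8; 7; 6])
(Fork 2 7
(Cite 0 [:: 0; 2; 1; 3; 4; 5; 6; 7; 8; 9])
(Fork 4 8
(Cite 3 [:: 0; 1; 2; 4; 3; 9; 5; 6; 7; 8])
(Fork 2 8
(Cite 0 [:: 0; 2; 1; 3; 4; 5; 9; 8; 7; 6])
(Play 9 6 [:: Go 3 6 0 5; Go 5 6 5 7; Go 3 5 0 5; Go 3 5 0 6; Go 3 6 0 6; Go 5 6 3 5; Go 5 6 3 6; Trap 6 5 [:: 0; 1; 2; 3; 4; 8; 9]]))))));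
(([:: (0, 1); (0, 2); (0, 3); (0, 4); (1, 2); (3, 5); (5, 6); (5, 9); (6, 7); (7, 8); (8, 9)], [:: (0, 5); (0, 6); (0, 7); (0, 8); (0, 9); (3, 4); (5, 7); (5, 8); (6, 8); (6, 9); (7, 9)]),
 Fork 4 6
(Fork 3 7
(Cite 6 [:: 0; 1; 2; 3; 4; 5; 6; 7; 8; 9])
(Cite 2 [:: 0; 1; 2; 3; 4; 5; 6; 7; 8; 9]))
(Fork 4 9
(Cite 2 [:: 0; 1; 2; 4; 3; 9; 5; 6; 7; 8])
(Cite 0 [:: 0; 1; 2; 3; 4; 5; 6; 7; 8; 9])));
(([:: (0, 1); (0, 2); (0, 3); (0, 4); (1, 2); (5, 6); (5, 9); (6, 7); (7, 8); (8, 9)], [:: (0, 5); (0, 6); (0, 7); (0, 8); (0, 9); (3, 4); (5, 7); (5, 8); (6, 8); (6, 9); (7, 9)]),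
 Fork 3 5
(Cite 0 [:: 0; 1; 2; 3; 4; 5; 6; 7; 8; 9])
(Fork 3 6
(Cite 0 [:: 0; 1; 2; 3; 4; 6; 5; 9; 8; 7])
(Fork 3 7
(Cite 0 [:: 0; 1; 2; 3; 4; 7; 6; 5; 9; 8])
(Fork 3 8
(Cite 0 [:: 0; 1; 2; 3; 4; 8; 7; 6; 5; 9])
(Fork 3 9
(Cite 0 [:: 0; 1; 2; 3; 4; 9; 5; 6; 7; 8])
(Fork 4 5
(Cite 1 [:: 0; 1; 2; 4; 3; 5; 9; 8; 7; 6])
(Fork 4 6
(Cite 1 [:: 0; 1; 2; 4; 3; 6; 7; 8; 9; 5])
(Fork 4 7
(Cite 8 [:: 0; 1; 2; 4; 3; 9; 8; 7; 6; 5])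
(Fork 4 8
(Cite 8 [:: 0; 1; 2; 4; 3; 5; 9; 8; 7; 6])
(Cite 19 [:: 0; 3; 4; 1; 2; 6; 7; 8; 9; 5]))))))))));
(([:: (0, 1); (0, 2); (0, 3); (0, 4); (1, 2); (5, 6); (5, 9); (6, 7); (7, 8); (8, 9)], [:: (0, 5); (0, 6); (0, 7); (0, 8); (0, 9); (5, 7); (5, 8); (6, 8); (6, 9); (7, 9)]),
 Fork 3 4
(Fork 1 5
(Cite 22 [:: 0; 1; 2; 3; 4; 5; 6; 7; 8; 9])
(Fork 1 6
(Cite 22 [:: 0; 1; 2; 3; 4; 6; 7; 8; 9; 5])
(Fork 1 7
(Cite 22 [:: 0; 1; 2; 3; 4; 7; 8; 9; 5; 6])
(Fork 1 9
(Cite 22 [:: 0; 1; 2; 3; 4; 9; 8; 7; 6; 5])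
(Fork 2 5
(Cite 22 [:: 0; 2; 1; 3; 4; 5; 9; 8; 7; 6])
(Fork 2 6
(Cite 22 [:: 0; 2; 1; 3; 4; 6; 7; 8; 9; 5])
(Fork 2 7
(Cite 22 [:: 0; 2; 1; 3; 4; 7; 8; 9; 5; 6])
(Fork 2 9
(Cite 22 [:: 0; 2; 1; 3; 4; 9; 8; 7; 6; 5])
(Cite 20 [:: 0; 1; 2; 3; 4; 5; 6; 7; 8; 9])))))))))
(Cite 0 [:: 0; 1; 2; 3; 4; 5; 6; 7; 8; 9]));
(([:: (0, 2); (0, 3); (0, 4); (1, 8); (2, 9); (3, 5); (3, 7); (5, 9); (6, 7); (7, 8); (8, 9)], [:: (0, 5); (1, 2); (1, 4); (1, 6); (4, 5); (6, 9)]),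
 Play 9 8 [:: Go 3 9 3 8; Go 7 9 3 8; Go 7 2 3 9; Go 7 2 7 9; Go 0 8 2 7; Go 0 7 2 7; Go 0 8 0 7; Trap 8 0 [:: 0; 2; 3; 4; 5; 6]]);
(([:: (0, 1); (0, 2); (0, 4); (1, 8); (2, 6); (2, 9); (3, 7); (5, 6); (5, 9); (6, 7); (7, 8); (8, 9)], [:: (0, 6); (0, 7); (0, 9); (1, 2); (1, 3); (1, 4); (3, 4); (3, 5); (5, 8)]),
 Fork 4 9
(Play 9 9 [:: Go 2 8 2 7; Go 9 8 2 7; Go 9 1 2 8; Go 8 9 1 9; Go 8 5 1 9; Go 9 7 5 8; Go 7 9 8 9; Trap 9 7 [:: 0; 1; 3; 6; 7; 8]])
(Cite 0 [:: 0; 3; 1; 2; 4; 9; 5; 6; 7; 8]));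
(([:: (0, 3); (1, 5); (2, 6); (3, 7); (4, 6); (5, 6); (5, 9); (7, 8); (8, 9)], [:: (0, 8); (0, 9); (1, 2); (1, 4); (1, 8); (3, 9)]),
 Play 9 8 [:: Go 7 6 3 5; Go 3 6 3 5; Go 7 5 3 6; Go 7 6 3 6; Go 6 8 6 7; Go 6 8 5 7; Trap 8 6 [:: 0; 1; 2; 3; 4; 5; 6]]);
(([:: (0, 1); (0, 2); (0, 4); (1, 5); (3, 7); (5, 9); (6, 7); (7, 8); (8, 9)], [:: (2, 5); (2, 9); (3, 4); (3, 9); (4, 6); (5, 7); (6, 9)]),
 Play 9 9 [:: Go 1 7 0 7; Go 1 8 0 7; Go 0 8 1 7; Go 1 8 1 7; Go 0 9 1 8; Go 0 9 0 8; Trap 9 0 [:: 0; 1; 2; 3; 4; 6; 7]]);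
(([:: (0, 1); (0, 2); (0, 3); (0, 4); (1, 5); (2, 6); (3, 7); (5, 6); (5, 9); (6, 7); (7, 8); (8, 9)], [:: (0, 5); (0, 6); (0, 7); (0, 8); (0, 9); (1, 2); (1, 3); (1, 4); (2, 3); (2, 4); (3, 4); (5, 7); (5, 8); (6, 8); (6, 9); (7, 9)]),
 Fork 1 8
(Fork 2 9
(Fork 3 5
(Fork 4 5
(Cite 55 [:: 5; 1; 3; 4; 6; 9; 0; 2; 7; 8])
(Fork 4 6
(Fork 1 6
(Cite 55 [:: 6; 1; 2; 4; 5; 7; 0; 3; 8; 9])
(Cite 3 [:: 0; 1; 2; 3; 4; 5; 6; 7; 8; 9]))
(Play 9 9 [:: Go 2 7 0 8; Go 3 9 0 8; Go 5 9 3 9; Go 5 2 3 9; Go 6 8 2 7; Go 9 5 2 5; Go 6 8 5 9; Go 5 8 5 9; Go 5 8 6 8; Go 3 9 5 8; Trap 9 3 [:: 0; 1; 3; 4; 5; 6; 7]])))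
(Cite 2 [:: 0; 1; 2; 3; 4; 5; 6; 7; 8; 9]))
(Cite 2 [:: 0; 3; 1; 2; 4; 9; 5; 6; 7; 8]))
(Fork 3 9
(Cite 2 [:: 0; 2; 3; 1; 4; 8; 9; 5; 6; 7])
(Fork 4 6
(Cite 1 [:: 0; 1; 2; 3; 4; 5; 6; 7; 8; 9])
(Fork 2 5
(Play 9 5 [:: Go 0 9 3 5; Go 0 8 0 9; Go 1 7 0 8; Go 2 7 0 8; Go 5 3 2 7; Go 5 3 1 7; Trap 5 3 [:: 0; 3; 4; 7; 8]])
(Fork 2 9
(Play 9 9 [:: Go 7 9 3 5; Go 3 9 3 5; Go 3 9 7 9; Go 0 8 3 9; Go 0 9 3 9; Go 0 9 0 8; Trap 9 0 [:: 0; 1; 3; 4; 6; 7]])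
(Cite 0 [:: 0; 1; 2; 3; 4; 5; 6; 7; 8; 9]))))));
(([:: (0, 1); (0, 2); (0, 3); (0, 4); (1, 5); (2, 6); (5, 6); (5, 9); (6, 7); (7, 8); (8, 9)], [:: (0, 5); (0, 6); (0, 7); (0, 8); (0, 9); (1, 2); (1, 3); (1, 4); (2, 3); (2, 4); (3, 4); (3, 7); (5, 7); (5, 8); (6, 8); (6, 9); (7, 9)]),
 Fork 4 7
(Cite 0 [:: 0; 1; 2; 4; 3; 5; 6; 7; 8; 9])
(Fork 1 7
(Fork 3 8
(Cite 0 [:: 0; 2; 1; 3; 4; 6; 7; 8; 9; 5])
(Fork 4 8
(Cite 0 [:: 0; 2; 1; 4; 3; 6; 7; 8; 9; 5])
(Play 9 9 [:: Go 2 1 0 5; Go 2 5 0 5; Go 5 6 1 2; Go 6 5 2 5; Go 9 7 5 6; Go 9 6 5 6; Go 6 9 7 9; Trap 9 6 [:: 0; 1; 2; 3; 4; 6; 7]])))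
(Cite 16 [:: 0; 1; 3; 2; 4; 9; 5; 6; 7; 8])));
(([:: (0, 1); (0, 2); (0, 3); (0, 4); (1, 5); (2, 6); (5, 6); (5, 9); (6, 7); (7, 8); (8, 9)], [:: (0, 5); (0, 6); (0, 7); (0, 8); (0, 9); (1, 2); (1, 3); (1, 4); (2, 3); (2, 4); (3, 4); (5, 7); (5, 8); (6, 8); (6, 9); (7, 9)]),
 Fork 3 7
(Cite 1 [:: 0; 1; 2; 3; 4; 5; 6; 7; 8; 9])
(Cite 0 [:: 0; 1; 2; 3; 4; 5; 6; 7; 8; 9]));
(([:: (0, 1); (0, 2); (0, 3); (0, 4); (1, 5); (5, 6); (5, 9); (6, 7); (7, 8); (8, 9)], [:: (0, 5); (0, 6); (0, 7); (0, 8); (0, 9); (1, 2); (1, 3); (1, 4); (2, 3); (2, 4); (2, 6); (2, 9); (3, 4); (3, 6); (5, 7); (5, 8); (6, 8); (6, 9); (7, 9)]),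
 Fork 4 6
(Cite 1 [:: 0; 4; 1; 2; 3; 6; 5; 9; 8; 7])
(Cite 18 [:: 0; 2; 3; 1; 4; 8; 9; 5; 6; 7]));
(([:: (0, 1); (0, 2); (0, 3); (0, 4); (1, 5); (5, 6); (5, 9); (6, 7); (7, 8); (8, 9)], [:: (0, 5); (0, 6); (0, 7); (0, 8); (0, 9); (1, 2); (1, 3); (1, 4); (2, 3); (2, 4); (2, 6); (2, 9); (3, 4); (5, 7); (5, 8); (6, 8); (6, 9); (7, 9)]),
 Fork 3 6
(Cite 2 [:: 0; 3; 1; 2; 4; 6; 5; 9; 8; 7])
(Cite 0 [:: 0; 1; 2; 3; 4; 5; 6; 7; 8; 9]));
(([:: (0, 1); (0, 2); (0, 3); (0, 4); (1, 5); (5, 6); (5, 9); (6, 7); (7, 8); (8, 9)], [:: (0, 5); (0, 6); (0, 7); (0, 8); (0, 9); (1, 2); (1, 3); (1, 4); (2, 3); (2, 4); (3, 4); (5, 7); (5, 8); (6, 8); (6, 9); (7, 9)]),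
 Fork 2 6
(Cite 2 [:: 0; 1; 2; 3; 4; 5; 6; 7; 8; 9])
(Fork 2 9
(Cite 2 [:: 0; 1; 2; 3; 4; 5; 9; 8; 7; 6])
(Cite 0 [:: 0; 1; 2; 3; 4; 5; 6; 7; 8; 9])));
(([:: (0, 1); (0, 2); (0, 3); (0, 4); (1, 5); (5, 6); (5, 9); (6, 7); (7, 8)], [:: (2, 5); (3, 5); (4, 5); (7, 9); (8, 9)]),
 Play 9 7 [:: Go 0 6 0 5; Go 1 7 0 6; Go 0 7 0 6; Go 0 7 1 7; Trap 7 0 [:: 0; 1; 2; 3; 4; 5; 9]]);
(([:: (0, 1); (0, 2); (0, 3); (0, 4); (1, 5); (5, 6); (5, 8); (5, 9); (6, 7); (7, 8)], [:: (0, 5); (2, 5); (3, 5); (5, 7); (7, 9); (8, 9)]),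
 Fork 4 5
(Cite 53 [:: 5; 1; 4; 6; 8; 9; 0; 2; 3; 7])
(Cite 0 [:: 0; 1; 2; 3; 4; 5; 6; 7; 8; 9]));
(([:: (0, 1); (0, 2); (0, 3); (0, 4); (1, 5); (5, 6); (5, 8); (5, 9); (6, 7); (7, 8)], [:: (0, 5); (2, 5); (5, 7); (7, 9); (8, 9)]),
 Fork 3 5
(Cite 52 [:: 5; 1; 3; 6; 8; 9; 0; 2; 7; 4])
(Cite 0 [:: 0; 1; 2; 3; 4; 5; 6; 7; 8; 9]));
(([:: (0, 1); (0, 2); (0, 3); (0, 4); (1, 7); (5, 8); (5, 9); (6, 7); (7, 8)], [:: (0, 6); (2, 5); (3, 5); (4, 5); (6, 9); (7, 9)]),
 Play 9 8 [:: Go 1 8 0 5; Go 0 8 0 5; Go 1 7 0 8; Go 0 7 0 8; Go 1 8 0 7; Go 1 7 0 7; Go 7 8 1 7; Go 7 8 1 8; Trap 8 7 [:: 0; 1; 2; 3; 4; 6; 9]]);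
(([:: (0, 1); (0, 2); (0, 3); (0, 4); (1, 5); (5, 6); (5, 8); (5, 9); (6, 7); (7, 8); (7, 9)], [:: (0, 5); (2, 5); (3, 5); (5, 7)]),
 Fork 4 5
(Cite 56 [:: 5; 1; 4; 6; 8; 9; 0; 2; 3; 7])
(Cite 76 [:: 0; 6; 2; 3; 4; 1; 7; 8; 9; 5]));
(([:: (0, 1); (0, 2); (0, 3); (0, 4); (1, 5); (5, 6); (5, 8); (5, 9); (6, 7); (7, 8); (7, 9)], [:: (0, 5); (2, 5); (5, 7)]),
 Fork 3 5
(Cite 55 [:: 5; 1; 3; 6; 8; 9; 0; 2; 7; 4])
(Cite 0 [:: 0; 1; 2; 3; 4; 5; 6; 7; 8; 9]));
(([:: (0, 1); (0, 2); (0, 3); (0, 4); (5, 6); (5, 8); (5, 9); (6, 7); (7, 8)], [:: (0, 5); (0, 6); (0, 7); (0, 8); (5, 7); (8, 9)]),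
 Fork 6 9
(Cite 44 [:: 0; 1; 2; 3; 4; 5; 9; 6; 7; 8])
(Fork 7 9
(Fork 1 5
(Fork 2 5
(Cite 55 [:: 5; 1; 2; 6; 8; 9; 0; 7; 3; 4])
(Cite 0 [:: 0; 1; 2; 3; 4; 5; 6; 7; 8; 9]))
(Fork 2 5
(Cite 0 [:: 0; 2; 1; 3; 4; 5; 6; 7; 8; 9])
(Fork 3 5
(Cite 1 [:: 0; 3; 1; 2; 4; 5; 6; 7; 8; 9])
(Cite 76 [:: 0; 6; 1; 2; 3; 4; 7; 8; 9; 5]))))
(Fork 1 5
(Fork 2 5
(Cite 55 [:: 5; 1; 2; 6; 8; 9; 0; 7; 3; 4])
(Cite 3 [:: 0; 1; 2; 3; 4; 5; 6; 7; 8; 9]))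
(Fork 2 5
(Cite 3 [:: 0; 2; 1; 3; 4; 5; 8; 7; 6; 9])
(Fork 3 5
(Cite 4 [:: 0; 3; 1; 2; 4; 5; 8; 7; 6; 9])
(Fork 4 5
(Cite 5 [:: 0; 4; 1; 2; 3; 5; 6; 7; 8; 9])
(Fork 1 7
(Cite 2 [:: 0; 1; 2; 3; 4; 5; 6; 7; 8; 9])
(Fork 2 7
(Cite 2 [:: 0; 2; 1; 3; 4; 5; 6; 7; 8; 9])
(Fork 3 7
(Cite 2 [:: 0; 3; 1; 2; 4; 5; 6; 7; 8; 9])
(Cite 76 [:: 0; 6; 1; 2; 3; 4; 5; 8; 9; 7]))))))))));
(([:: (0, 1); (0, 2); (0, 3); (0, 4); (5, 6); (5, 9); (6, 7); (7, 8)], [:: (0, 5); (0, 6); (0, 7); (0, 8); (0, 9); (8, 9)]),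
 Fork 5 7
(Play 9 7 [:: Go 0 7 0 5; Trap 7 0 [:: 0; 1; 2; 3; 4; 9]])
(Fork 5 8
(Cite 0 [:: 0; 1; 2; 3; 4; 5; 6; 7; 8; 9])
(Fork 7 9
(Cite 0 [:: 0; 1; 2; 3; 4; 7; 6; 5; 9; 8])
(Play 9 6 [:: Go 0 6 0 7; Go 0 6 0 5; Trap 6 0 [:: 0; 1; 2; 3; 4; 8; 9]]))));
(([:: (0, 1); (0, 2); (0, 3); (0, 4); (5, 6); (5, 9); (6, 7); (7, 8)], [:: (0, 5); (0, 6); (0, 7); (0, 8); (0, 9)]),
 (* The non-neighbours of 0 contain the path 9, 5, 6, 7, 8, which the pair 8 9 closes to a
    pentagon. *)
 Fork 8 9
(Fork 5 7
(Fork 5 8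
(Cite 55 [:: 0; 1; 2; 3; 4; 5; 6; 7; 8; 9])
(Cite 45 [:: 0; 1; 2; 3; 4; 5; 6; 7; 8; 9]))
(Fork 5 8
(Cite 45 [:: 0; 1; 2; 3; 4; 5; 9; 8; 7; 6])
(Fork 6 8
(Cite 45 [:: 0; 1; 2; 3; 4; 8; 7; 6; 5; 9])
(Fork 6 9
(Cite 46 [:: 0; 1; 2; 3; 4; 6; 5; 9; 8; 7])
(Fork 7 9
(Cite 46 [:: 0; 1; 2; 3; 4; 7; 8; 9; 5; 6])
(Fork 1 2
(Cite 18 [:: 0; 1; 2; 3; 4; 5; 6; 7; 8; 9])
(Fork 1 3
(Cite 18 [:: 0; 1; 3; 2; 4; 5; 6; 7; 8; 9])
(Fork 1 4
(Cite 18 [:: 0; 1; 4; 2; 3; 5; 6; 7; 8; 9])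
(Fork 2 3
(Cite 19 [:: 0; 2; 3; 1; 4; 5; 6; 7; 8; 9])
(Fork 2 4
(Cite 19 [:: 0; 2; 4; 1; 3; 5; 6; 7; 8; 9])
(Fork 3 4
(Cite 19 [:: 0; 3; 4; 1; 2; 5; 6; 7; 8; 9])
(Fork 1 5
(Cite 8 [:: 0; 1; 2; 3; 4; 5; 6; 7; 8; 9])
(Fork 1 6
(Cite 8 [:: 0; 1; 2; 3; 4; 6; 5; 9; 8; 7])
(Fork 1 7
(Cite 8 [:: 0; 1; 2; 3; 4; 7; 6; 5; 9; 8])
(Fork 1 8
(Cite 8 [:: 0; 1; 2; 3; 4; 8; 7; 6; 5; 9])
(Fork 1 9
(Cite 8 [:: 0; 1; 2; 3; 4; 9; 5; 6; 7; 8])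
(Fork 2 5
(Cite 9 [:: 0; 2; 1; 3; 4; 5; 6; 7; 8; 9])
(Fork 2 6
(Cite 9 [:: 0; 2; 1; 3; 4; 6; 5; 9; 8; 7])
(Fork 2 7
(Cite 9 [:: 0; 2; 1; 3; 4; 7; 6; 5; 9; 8])
(Fork 2 9
(Cite 9 [:: 0; 2; 1; 3; 4; 9; 5; 6; 7; 8])
(Fork 3 5
(Cite 10 [:: 0; 3; 1; 2; 4; 5; 6; 7; 8; 9])
(Fork 3 6
(Cite 10 [:: 0; 3; 1; 2; 4; 6; 5; 9; 8; 7])
(Fork 3 7
(Cite 10 [:: 0; 3; 1; 2; 4; 7; 6; 5; 9; 8])
(Fork 3 9
(Cite 10 [:: 0; 3; 1; 2; 4; 9; 5; 6; 7; 8])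
(Fork 4 5
(Cite 29 [:: 0; 1; 2; 4; 3; 7; 6; 5; 9; 8])
(Fork 4 6
(Cite 29 [:: 0; 1; 2; 4; 3; 9; 5; 6; 7; 8])
(Cite 40 [:: 0; 1; 2; 3; 4; 5; 6; 7; 8; 9])))))))))))))))))))))))))))
(Cite 0 [:: 0; 1; 2; 3; 4; 5; 6; 7; 8; 9]));
(([:: (0, 1); (0, 2); (0, 3); (0, 4); (5, 6); (5, 7); (5, 9); (7, 8)], [:: (6, 8); (8, 9)]),
 Play 9 9 [:: Go 0 5 0 7; Go 0 9 0 5; Trap 9 0 [:: 0; 1; 2; 3; 4; 6; 7; 8]]);
(([:: (0, 1); (0, 2); (0, 3); (0, 4); (5, 6); (5, 9); (7, 8)], [:: (0, 5); (0, 6); (0, 7); (0, 8); (0, 9); (6, 7); (6, 8); (7, 9)]),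
 Fork 8 9
(Cite 2 [:: 0; 1; 2; 3; 4; 5; 9; 8; 7; 6])
(Fork 5 7
(Cite 0 [:: 0; 1; 2; 3; 4; 5; 6; 7; 8; 9])
(Fork 5 8
(Cite 0 [:: 0; 1; 2; 3; 4; 5; 6; 8; 7; 9])
(Cite 39 [:: 6; 5; 9; 1; 2; 3; 0; 4; 7; 8]))));
(([:: (0, 1); (0, 2); (0, 3); (0, 4); (5, 6); (5, 9); (7, 8)], [:: (0, 5); (0, 6); (0, 7); (0, 8); (0, 9); (6, 7); (6, 8)]),
 Fork 7 9
(Cite 3 [:: 0; 1; 2; 3; 4; 5; 9; 7; 8; 6])
(Cite 0 [:: 0; 1; 2; 3; 4; 5; 6; 7; 8; 9]));
(([:: (0, 1); (0, 2); (0, 3); (0, 4); (5, 6); (5, 9); (7, 8)], [:: (0, 5); (0, 6); (0, 7); (0, 8); (0, 9); (6, 7)]),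
 Fork 6 8
(Cite 3 [:: 0; 1; 2; 3; 4; 5; 6; 8; 7; 9])
(Cite 0 [:: 0; 1; 2; 3; 4; 5; 6; 7; 8; 9]));
(([:: (0, 1); (0, 2); (0, 3); (0, 4); (5, 6); (5, 9); (7, 8)], [:: (0, 5); (0, 6); (0, 7); (0, 8); (0, 9)]),
 Fork 6 7
(Cite 4 [:: 0; 1; 2; 3; 4; 5; 6; 7; 8; 9])
(Cite 0 [:: 0; 1; 2; 3; 4; 5; 6; 7; 8; 9]));
(([:: (0, 1); (0, 2); (0, 3); (0, 4); (5, 6); (5, 7); (7, 8)], [:: (5, 9); (6, 8); (6, 9); (7, 9); (8, 9)]),
 Play 9 7 [:: Trap 0 9 [:: 9]; Go 0 7 0 5; Trap 7 0 [:: 0; 1; 2; 3; 4; 6; 9]]);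
(([:: (0, 1); (0, 2); (0, 3); (0, 4); (5, 8); (6, 8); (7, 8)], [:: (5, 9); (6, 9); (7, 9); (8, 9)]),
 Play 9 0 [:: Trap 0 8 [:: 5; 6; 7; 8]]);
(([:: (0, 1); (0, 2); (0, 3); (0, 4); (1, 5); (2, 8); (3, 5); (5, 6); (5, 7); (6, 8); (7, 8)], [:: (0, 5); (0, 6); (0, 7); (0, 8); (0, 9); (4, 5); (5, 8); (5, 9); (8, 9)]),
 Fork 2 5
(Cite 69 [:: 5; 1; 2; 3; 6; 7; 0; 4; 8; 9])
(Fork 4 9
(Cite 8 [:: 5; 1; 3; 6; 7; 2; 0; 4; 9; 8])
(Fork 2 9
(Cite 5 [:: 5; 1; 3; 6; 7; 2; 9; 0; 4; 8])
(Fork 4 8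
(Fork 1 8
(Cite 74 [:: 8; 1; 2; 4; 6; 7; 3; 0; 5; 9])
(Play 9 4 [:: Trap 5 9 [:: 9]; Go 3 4 5 8; Go 4 3 0 5; Go 3 4 0 8; Trap 4 3 [:: 1; 2; 3; 5; 6; 7; 9]]))
(Cite 1 [:: 5; 1; 3; 6; 7; 0; 4; 2; 8; 9])))));
(([:: (0, 1); (0, 2); (0, 3); (0, 4); (1, 5); (2, 8); (6, 8); (7, 8)], [:: (3, 5); (4, 5); (5, 9); (6, 9); (7, 9); (8, 9)]),
 Play 9 8 [:: Trap 0 9 [:: 9]; Go 0 8 1 8; Trap 8 0 [:: 0; 1; 3; 4; 5; 9]]);
(([:: (0, 1); (0, 2); (0, 3); (0, 4); (1, 5); (2, 8); (5, 6); (5, 7); (6, 8); (7, 8)], [:: (0, 5); (0, 6); (0, 7); (0, 8); (0, 9); (3, 5); (5, 8); (5, 9); (6, 9); (7, 9); (8, 9)]),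
 Fork 4 5
(Cite 1 [:: 0; 1; 2; 4; 3; 5; 6; 7; 8; 9])
(Cite 0 [:: 0; 1; 2; 3; 4; 5; 6; 7; 8; 9]));
(([:: (0, 1); (0, 2); (0, 3); (0, 4); (1, 5); (5, 6); (5, 7); (6, 8); (7, 8)], [:: (0, 5); (0, 6); (0, 7); (0, 8); (0, 9); (5, 8); (5, 9); (6, 9); (7, 9); (8, 9)]),
 Fork 2 8
(Fork 3 5
(Fork 4 5
(Cite 77 [:: 5; 1; 3; 4; 6; 7; 2; 0; 8; 9])
(Cite 2 [:: 0; 1; 2; 3; 4; 5; 6; 7; 8; 9]))
(Cite 0 [:: 0; 1; 2; 3; 4; 5; 6; 7; 8; 9]))
(Fork 3 8
(Cite 0 [:: 0; 3; 1; 2; 4; 8; 6; 7; 5; 9])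
(Fork 4 8
(Cite 1 [:: 0; 4; 1; 2; 3; 8; 6; 7; 5; 9])
(Play 5 0 [:: Trap 0 9 [:: 9]; Trap 5 8 [:: 8]]))));
(([:: (0, 1); (0, 2); (0, 3); (0, 4); (5, 6); (5, 7); (7, 8)], [:: (0, 5); (0, 6); (0, 7); (0, 8); (0, 9); (5, 9); (6, 9); (7, 9); (8, 9)]),
 (* The pair 6 8 closes the 4-cycle 5, 6, 8, 7, while 9 can be adjacent only to neighbours of 0. *)
 Fork 6 8
(Fork 5 8
(Cite 4 [:: 0; 1; 2; 3; 4; 5; 6; 7; 8; 9])
(Fork 1 5
(Cite 0 [:: 0; 1; 2; 3; 4; 5; 6; 7; 8; 9])
(Fork 2 5
(Cite 0 [:: 0; 2; 1; 3; 4; 5; 6; 7; 8; 9])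
(Fork 3 5
(Cite 0 [:: 0; 3; 1; 2; 4; 5; 6; 7; 8; 9])
(Fork 4 5
(Cite 0 [:: 0; 4; 1; 2; 3; 5; 6; 7; 8; 9])
(Play 8 0 [:: Trap 0 9 [:: 9]; Trap 8 5 [:: 5]]))))))
(Cite 5 [:: 0; 1; 2; 3; 4; 5; 6; 7; 8; 9]));
(([:: (0, 1); (0, 2); (0, 3); (0, 4); (5, 6); (7, 8)], [:: (0, 5); (0, 6); (0, 7); (0, 8); (0, 9); (5, 9); (6, 9); (7, 9)]),
 Fork 8 9
(Cite 9 [:: 0; 1; 2; 3; 4; 8; 9; 5; 6; 7])
(Fork 5 7
(Cite 0 [:: 0; 1; 2; 3; 4; 5; 6; 7; 8; 9])
(Fork 5 8
(Cite 0 [:: 0; 1; 2; 3; 4; 5; 6; 8; 7; 9])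
(Fork 6 7
(Cite 6 [:: 0; 1; 2; 3; 4; 6; 5; 7; 8; 9])
(Fork 6 8
(Cite 6 [:: 0; 1; 2; 3; 4; 6; 5; 8; 7; 9])
(Play 9 0 [:: Trap 0 5 [:: 5; 6]; Trap 0 7 [:: 7; 8]]))))));
(([:: (0, 1); (0, 2); (0, 3); (0, 4); (5, 6); (7, 8)], [:: (0, 5); (0, 6); (0, 7); (0, 8); (0, 9); (5, 9); (6, 9)]),
 Fork 7 9
(Cite 10 [:: 0; 1; 2; 3; 4; 7; 9; 5; 6; 8])
(Cite 0 [:: 0; 1; 2; 3; 4; 5; 6; 7; 8; 9]));
(([:: (0, 1); (0, 2); (0, 3); (0, 4); (5, 6); (7, 8)], [:: (0, 5); (0, 6); (0, 7); (0, 8); (0, 9); (5, 9)]),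
 Fork 6 9
(Cite 9 [:: 0; 1; 2; 3; 4; 6; 5; 7; 8; 9])
(Cite 0 [:: 0; 1; 2; 3; 4; 5; 6; 7; 8; 9]));
(([:: (0, 1); (0, 2); (0, 3); (0, 4); (5, 6); (5, 7)], [:: (5, 8); (5, 9); (6, 8); (6, 9); (7, 8); (7, 9); (8, 9)]),
 Play 9 0 [:: Trap 0 5 [:: 5; 6; 7]; Trap 0 8 [:: 8]]);
(([:: (0, 1); (0, 2); (0, 3); (0, 4); (5, 6); (5, 7)], [:: (0, 5); (0, 6); (0, 7); (0, 8); (0, 9); (6, 8); (7, 8); (7, 9); (8, 9)]),
 Fork 6 9
(Cite 3 [:: 0; 1; 2; 3; 4; 6; 9; 7; 5; 8])
(Fork 5 8
(Fork 5 9
(Cite 72 [:: 0; 1; 2; 3; 4; 5; 6; 7; 8; 9])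
(Cite 9 [:: 0; 1; 2; 3; 4; 6; 7; 8; 5; 9]))
(Fork 5 9
(Cite 9 [:: 0; 1; 2; 3; 4; 6; 7; 9; 5; 8])
(Cite 0 [:: 0; 1; 2; 3; 4; 5; 6; 7; 8; 9]))));
(([:: (0, 1); (0, 2); (0, 3); (0, 4); (5, 6); (5, 7)], [:: (0, 5); (0, 6); (0, 7); (0, 8); (0, 9); (7, 8); (7, 9); (8, 9)]),
 Fork 6 8
(Cite 2 [:: 0; 1; 2; 3; 4; 7; 5; 6; 8; 9])
(Cite 0 [:: 0; 1; 2; 3; 4; 5; 6; 7; 8; 9]));
(([:: (0, 1); (0, 2); (0, 3); (0, 4); (5, 6)], [:: (5, 7); (5, 8); (5, 9); (6, 7); (6, 8); (6, 9); (7, 8); (7, 9); (8, 9)]),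
 Play 9 0 [:: Trap 0 5 [:: 5; 6]; Trap 0 7 [:: 7]; Trap 0 8 [:: 8]]);
(([:: (0, 1); (0, 2); (0, 3); (0, 4); (5, 6)], [:: (5, 7); (5, 8); (5, 9); (6, 7); (6, 8); (7, 8); (7, 9); (8, 9)]),
 Fork 6 9
(Cite 3 [:: 0; 1; 2; 3; 4; 6; 5; 9; 7; 8])
(Cite 0 [:: 0; 1; 2; 3; 4; 5; 6; 7; 8; 9]));
(([:: (0, 1); (0, 2); (0, 3); (0, 4); (5, 6)], [:: (5, 7); (5, 8); (6, 7); (6, 8); (7, 8); (7, 9); (8, 9)]),
 Fork 5 9
(Cite 4 [:: 0; 1; 2; 3; 4; 5; 6; 9; 7; 8])
(Cite 0 [:: 0; 1; 2; 3; 4; 5; 6; 7; 8; 9]));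
(([:: (0, 1); (0, 2); (0, 3); (0, 4); (5, 6)], [:: (0, 5); (0, 6); (0, 7); (0, 8); (0, 9); (5, 7); (7, 8); (7, 9); (8, 9)]),
 Fork 6 7
(Cite 3 [:: 0; 1; 2; 3; 4; 6; 5; 7; 8; 9])
(Fork 5 8
(Cite 4 [:: 0; 1; 2; 3; 4; 5; 6; 8; 7; 9])
(Fork 6 8
(Cite 4 [:: 0; 1; 2; 3; 4; 6; 5; 8; 7; 9])
(Cite 0 [:: 0; 1; 2; 3; 4; 5; 6; 7; 8; 9]))));
(([:: (0, 1); (0, 2); (0, 3); (0, 4); (5, 6)], [:: (0, 5); (0, 6); (0, 7); (0, 8); (0, 9); (7, 8); (7, 9)]),
 Fork 8 9
(Cite 8 [:: 0; 1; 2; 3; 4; 8; 9; 5; 6; 7])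
(Fork 5 7
(Cite 4 [:: 0; 1; 2; 3; 4; 5; 6; 7; 8; 9])
(Cite 0 [:: 0; 1; 2; 3; 4; 5; 6; 7; 8; 9])));
(([:: (0, 1); (0, 2); (0, 3); (0, 4); (5, 6)], [:: (0, 5); (0, 6); (0, 7); (0, 8); (0, 9); (7, 8)]),
 Fork 7 9
(Cite 8 [:: 0; 1; 2; 3; 4; 7; 9; 5; 6; 8])
(Cite 0 [:: 0; 1; 2; 3; 4; 5; 6; 7; 8; 9]));
(([:: (0, 1); (0, 2); (0, 3); (0, 4); (5, 6)], [:: (0, 5); (0, 6); (0, 7); (0, 8); (0, 9)]),
 Fork 7 8
(Fork 5 9
(Cite 19 [:: 0; 1; 2; 3; 4; 5; 6; 7; 8; 9])
(Cite 9 [:: 0; 1; 2; 3; 4; 5; 6; 7; 8; 9]))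
(Cite 0 [:: 0; 1; 2; 3; 4; 5; 6; 7; 8; 9]));
(([:: (0, 1); (0, 2); (0, 3); (0, 4)], [:: (0, 5); (0, 6); (0, 7); (0, 8); (0, 9)]),
 Fork 5 6
(Cite 0 [:: 0; 1; 2; 3; 4; 5; 6; 7; 8; 9])
(Fork 5 7
(Cite 0 [:: 0; 1; 2; 3; 4; 5; 7; 6; 8; 9])
(Fork 5 8
(Cite 0 [:: 0; 1; 2; 3; 4; 5; 8; 6; 7; 9])
(Fork 5 9
(Cite 0 [:: 0; 1; 2; 3; 4; 5; 9; 6; 7; 8])
(Fork 6 7
(Cite 2 [:: 0; 1; 2; 3; 4; 6; 7; 5; 8; 9])
(Fork 6 8
(Cite 2 [:: 0; 1; 2; 3; 4; 6; 8; 5; 7; 9])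
(Fork 6 9
(Cite 2 [:: 0; 1; 2; 3; 4; 6; 9; 5; 7; 8])
(Fork 7 8
(Cite 4 [:: 0; 1; 2; 3; 4; 7; 8; 5; 6; 9])
(Fork 7 9
(Cite 5 [:: 0; 1; 2; 3; 4; 7; 9; 5; 6; 8])
(Fork 8 9
(Cite 6 [:: 0; 1; 2; 3; 4; 8; 9; 5; 6; 7])
(Play 9 0 [:: Trap 0 5 [:: 5]; Trap 0 6 [:: 6]; Trap 0 7 [:: 7]; Trap 0 8 [:: 8]])))))))))));
(([:: (0, 1); (0, 2); (0, 3); (0, 4)], [:: (0, 5); (0, 6); (0, 7); (0, 8)]),
 Fork 0 9
(Cite 86 [:: 0; 1; 2; 3; 4; 9; 5; 6; 7; 8])
(Cite 0 [:: 0; 1; 2; 3; 4; 5; 6; 7; 8; 9]));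
(([:: (0, 1); (0, 2); (0, 3); (0, 4)], [:: (0, 5); (0, 6); (0, 7)]),
 Fork 0 8
(Cite 86 [:: 0; 1; 2; 3; 4; 8; 5; 6; 7; 9])
(Cite 0 [:: 0; 1; 2; 3; 4; 5; 6; 7; 8; 9]));
(([:: (0, 1); (0, 2); (0, 3); (0, 4)], [:: (0, 5); (0, 6)]),
 Fork 0 7
(Cite 86 [:: 0; 1; 2; 3; 4; 7; 5; 6; 8; 9])
(Cite 0 [:: 0; 1; 2; 3; 4; 5; 6; 7; 8; 9]));
(([:: (0, 1); (0, 2); (0, 3); (0, 4)], [:: (0, 5)]),
 Fork 0 6
(Cite 86 [:: 0; 1; 2; 3; 4; 6; 5; 7; 8; 9])
(Cite 0 [:: 0; 1; 2; 3; 4; 5; 6; 7; 8; 9]));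

(* Certificate: degree 3 *)
(([:: (0, 1); (0, 2); (0, 3); (4, 5); (6, 9); (7, 9); (8, 9)], [:: (0, 4); (0, 5); (1, 4); (1, 5); (2, 4); (2, 5); (3, 4); (3, 5)]),
 Play 9 9 [:: Trap 9 0 [:: 0; 1; 2; 3]; Trap 9 4 [:: 4; 5]]);
(([:: (0, 1); (0, 2); (0, 3); (4, 5); (4, 6); (4, 8); (5, 7); (5, 8); (6, 7); (7, 9); (8, 9)], [:: (0, 4); (0, 7); (0, 8); (4, 7); (4, 9); (6, 8); (7, 8)]),
 Fork 1 4
(Cite 3 [:: 4; 1; 5; 6; 8; 0; 7; 9; 2; 3])
(Fork 1 8
(Cite 3 [:: 8; 1; 4; 5; 9; 0; 6; 7; 2; 3])
(Fork 1 7
(Cite 3 [:: 7; 1; 5; 6; 9; 0; 4; 8; 2; 3])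
(Fork 2 4
(Cite 4 [:: 4; 2; 5; 6; 8; 0; 1; 7; 9; 3])
(Fork 2 8
(Cite 4 [:: 8; 2; 4; 5; 9; 0; 1; 6; 7; 3])
(Fork 3 4
(Cite 27 [:: 4; 3; 5; 6; 8; 0; 1; 7; 9; 2])
(Fork 3 8
(Cite 27 [:: 8; 3; 4; 5; 9; 0; 1; 7; 6; 2])
(Cite 0 [:: 0; 1; 2; 3; 4; 8; 5; 6; 9; 7]))))))));
(([:: (0, 1); (0, 2); (0, 3); (1, 8); (4, 8); (5, 7); (6, 7); (7, 9); (8, 9)], [:: (0, 4); (2, 4); (3, 4); (5, 8); (6, 8)]),
 Play 9 9 [:: Go 7 1 7 8; Go 0 7 1 7; Go 0 9 1 7; Go 0 9 0 7; Trap 9 0 [:: 0; 1; 2; 3; 4; 5; 6]]);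
(([:: (0, 1); (0, 2); (0, 3); (4, 8); (5, 7); (6, 7); (7, 9); (8, 9)], [:: (0, 4); (0, 8); (1, 4); (2, 4); (3, 4); (5, 8); (6, 8)]),
 Fork 1 8
(Cite 0 [:: 0; 1; 2; 3; 4; 5; 6; 7; 8; 9])
(Fork 2 8
(Cite 0 [:: 0; 2; 1; 3; 4; 5; 6; 7; 8; 9])
(Fork 3 8
(Cite 0 [:: 0; 3; 1; 2; 4; 5; 6; 7; 8; 9])
(Cite 2 [:: 0; 1; 2; 3; 4; 8; 5; 6; 9; 7]))));
(([:: (0, 1); (0, 2); (0, 3); (4, 5); (4, 6); (4, 8); (5, 7); (6, 7); (7, 9); (8, 9)], [:: (0, 4); (0, 7); (0, 8); (4, 7); (4, 9)]),
 Fork 7 8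
(Cite 5 [:: 7; 5; 6; 8; 9; 0; 4; 1; 2; 3])
(Fork 5 8
(Fork 6 8
(Cite 5 [:: 8; 4; 5; 6; 9; 0; 7; 1; 2; 3])
(Cite 2 [:: 0; 1; 2; 3; 4; 5; 6; 7; 8; 9]))
(Fork 6 8
(Cite 2 [:: 0; 1; 2; 3; 4; 6; 5; 7; 8; 9])
(Fork 1 4
(Cite 6 [:: 4; 1; 5; 6; 8; 0; 7; 9; 2; 3])
(Fork 1 7
(Cite 6 [:: 7; 1; 5; 6; 9; 0; 4; 8; 2; 3])
(Fork 2 4
(Cite 7 [:: 4; 2; 5; 6; 8; 0; 1; 7; 9; 3])
(Fork 3 4
(Cite 30 [:: 4; 3; 5; 6; 8; 0; 1; 7; 9; 2])
(Cite 0 [:: 0; 1; 2; 3; 4; 5; 6; 7; 8; 9]))))))));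
(([:: (0, 1); (0, 2); (0, 3); (5, 9); (6, 9); (8, 9)], [:: (0, 4); (0, 7); (1, 4); (1, 7); (2, 4); (2, 7); (3, 4); (3, 7); (4, 7)]),
 Play 9 9 [:: Trap 9 0 [:: 0; 1; 2; 3]; Trap 9 4 [:: 4]; Trap 9 7 [:: 7]]);
(([:: (0, 1); (0, 2); (0, 3); (4, 5); (4, 6); (4, 8); (5, 7); (5, 9); (6, 7); (6, 9); (8, 9)], [:: (0, 4); (0, 5); (0, 6); (0, 9); (4, 7); (4, 9); (5, 6); (5, 8); (6, 8); (7, 8); (7, 9)]),
 Fork 1 4
(Cite 8 [:: 4; 1; 5; 6; 8; 0; 7; 9; 2; 3])
(Fork 1 5
(Cite 8 [:: 5; 1; 4; 7; 9; 0; 6; 8; 2; 3])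
(Fork 1 6
(Cite 8 [:: 6; 1; 4; 7; 9; 0; 5; 8; 2; 3])
(Fork 1 9
(Cite 8 [:: 9; 1; 5; 6; 8; 0; 4; 7; 2; 3])
(Fork 2 4
(Cite 9 [:: 4; 2; 5; 6; 8; 0; 1; 7; 9; 3])
(Fork 3 4
(Cite 13 [:: 4; 3; 5; 6; 8; 0; 2; 9; 1; 7])
(Fork 2 5
(Cite 9 [:: 5; 2; 4; 7; 9; 0; 1; 6; 8; 3])
(Fork 3 5
(Cite 13 [:: 5; 3; 4; 7; 9; 0; 2; 6; 1; 8])
(Play 9 9 [:: Trap 6 5 [:: 5]; Trap 9 4 [:: 4]; Go 0 9 0 6; Trap 9 0 [:: 0; 1; 2; 3; 7]])))))))));
(([:: (0, 1); (0, 2); (0, 3); (1, 6); (4, 6); (5, 7); (5, 9); (6, 7); (8, 9)], [:: (0, 4); (2, 4); (3, 4); (4, 7); (6, 8); (6, 9); (7, 8)]),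
 Play 9 7 [:: Go 1 5 6 9; Go 1 9 6 9; Go 0 5 1 9; Go 0 9 1 9; Go 0 5 0 9; Go 1 5 0 9; Go 0 7 0 5; Go 0 7 1 5; Trap 7 0 [:: 0; 1; 2; 3; 4; 8; 9]]);
(([:: (0, 1); (0, 2); (0, 3); (4, 6); (4, 8); (5, 7); (5, 9); (6, 7); (8, 9)], [:: (0, 4); (0, 6); (0, 8); (1, 4); (1, 6); (1, 8); (2, 4); (3, 4); (4, 7); (4, 9); (6, 8); (6, 9); (7, 8)]),
 Fork 2 6
(Cite 0 [:: 0; 2; 1; 3; 4; 5; 6; 7; 8; 9])
(Fork 3 6
(Cite 0 [:: 0; 3; 1; 2; 4; 5; 6; 7; 8; 9])
(Fork 2 8
(Cite 0 [:: 0; 2; 1; 3; 4; 5; 8; 9; 6; 7])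
(Fork 3 8
(Cite 0 [:: 0; 3; 1; 2; 4; 5; 8; 9; 6; 7])
(Play 5 5 [:: Trap 5 0 [:: 0; 1; 2; 3]; Trap 5 4 [:: 6; 8; 4]])))));
(([:: (0, 1); (0, 2); (0, 3); (4, 6); (4, 8); (5, 7); (5, 9); (6, 7); (8, 9)], [:: (0, 4); (0, 6); (0, 8); (1, 4); (1, 6); (2, 4); (3, 4); (4, 7); (4, 9); (6, 8); (6, 9); (7, 8)]),
 Fork 1 8
(Cite 1 [:: 0; 1; 2; 3; 4; 5; 8; 9; 6; 7])
(Cite 0 [:: 0; 1; 2; 3; 4; 5; 6; 7; 8; 9]));
(([:: (0, 1); (0, 2); (0, 3); (4, 5); (4, 6); (4, 8); (5, 7); (5, 9); (6, 7); (8, 9)], [:: (0, 4); (0, 5); (0, 6); (0, 7); (0, 8); (0, 9); (4, 7); (4, 9); (7, 9)]),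
 Fork 5 6
(Cite 10 [:: 5; 4; 6; 7; 9; 0; 1; 2; 3; 8])
(Fork 5 8
(Cite 11 [:: 5; 4; 7; 8; 9; 0; 6; 1; 2; 3])
(Fork 6 8
(Cite 5 [:: 0; 1; 2; 3; 5; 4; 9; 8; 7; 6])
(Fork 6 9
(Fork 7 8
(Fork 1 4
(Cite 12 [:: 4; 1; 5; 6; 8; 0; 7; 9; 2; 3])
(Fork 1 7
(Cite 12 [:: 7; 1; 5; 6; 8; 0; 4; 9; 2; 3])
(Fork 1 9
(Cite 12 [:: 9; 1; 5; 6; 8; 0; 4; 7; 2; 3])
(Fork 2 4
(Cite 13 [:: 4; 2; 5; 6; 8; 0; 1; 7; 9; 3])
(Fork 3 4
(Cite 22 [:: 4; 3; 5; 6; 8; 0; 2; 1; 7; 9])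
(Fork 2 7
(Cite 13 [:: 7; 2; 5; 6; 8; 0; 1; 4; 9; 3])
(Fork 3 7
(Cite 23 [:: 7; 3; 5; 6; 8; 0; 2; 1; 4; 9])
(Cite 4 [:: 0; 1; 2; 3; 4; 5; 6; 7; 8; 9]))))))))
(Cite 3 [:: 0; 1; 2; 3; 4; 5; 6; 7; 8; 9]))
(Fork 7 8
(Cite 3 [:: 0; 1; 2; 3; 4; 5; 8; 9; 6; 7])
(Fork 1 4
(Cite 12 [:: 4; 1; 5; 6; 8; 0; 7; 9; 2; 3])
(Fork 2 4
(Cite 13 [:: 4; 2; 5; 6; 8; 0; 1; 7; 9; 3])
(Fork 3 4
(Cite 16 [:: 4; 3; 5; 6; 8; 0; 1; 7; 9; 2])
(Fork 1 6
(Cite 2 [:: 0; 1; 2; 3; 4; 5; 6; 7; 8; 9])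
(Cite 0 [:: 0; 1; 2; 3; 4; 5; 6; 7; 8; 9]))))))))));
(([:: (0, 1); (0, 2); (0, 3); (5, 7); (6, 7); (7, 8); (8, 9)], [:: (0, 4); (1, 4); (2, 4); (3, 4); (4, 9); (5, 9); (6, 9)]),
 Play 9 8 [:: Trap 7 4 [:: 4]; Go 0 8 0 7; Trap 8 0 [:: 0; 1; 2; 3; 4; 5; 6]]);
(([:: (0, 1); (0, 2); (0, 3); (4, 5); (4, 6); (4, 8); (5, 7); (6, 7); (7, 8); (8, 9)], [:: (0, 4); (4, 7); (4, 9); (5, 9); (6, 9); (7, 9)]),
 Fork 1 4
(Cite 14 [:: 4; 1; 5; 6; 8; 0; 7; 9; 2; 3])
(Fork 2 4
(Cite 15 [:: 4; 2; 5; 6; 8; 0; 1; 7; 9; 3])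
(Fork 3 4
(Cite 18 [:: 4; 3; 5; 6; 8; 0; 1; 7; 9; 2])
(Cite 0 [:: 0; 1; 2; 3; 4; 5; 6; 7; 8; 9]))));
(([:: (0, 1); (0, 2); (0, 3); (4, 5); (4, 6); (4, 8); (5, 6); (5, 7); (8, 9)], [:: (5, 9); (6, 9); (7, 8); (7, 9)]),
 Play 9 4 [:: Go 0 4 0 8; Go 0 4 0 5; Trap 4 0 [:: 0; 1; 2; 3; 7; 9]]);
(([:: (0, 1); (0, 2); (0, 3); (4, 6); (4, 8); (5, 7); (5, 8); (6, 7); (8, 9)], [:: (0, 4); (0, 6); (0, 7); (1, 4); (2, 4); (3, 4); (3, 6); (4, 7); (6, 8); (6, 9); (7, 9)]),
 Fork 1 6
(Cite 6 [:: 0; 1; 2; 3; 4; 5; 6; 7; 9; 8])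
(Fork 2 6
(Cite 59 [:: 8; 5; 9; 1; 4; 7; 3; 0; 2; 6])
(Cite 10 [:: 0; 1; 2; 3; 6; 4; 9; 8; 7; 5])));
(([:: (0, 1); (0, 2); (0, 3); (4, 5); (4, 6); (4, 8); (5, 7); (5, 8); (6, 7); (8, 9)], [:: (0, 4); (0, 6); (0, 7); (4, 7); (4, 9); (6, 8); (6, 9); (7, 9)]),
 Fork 1 4
(Cite 17 [:: 4; 1; 5; 6; 8; 0; 7; 9; 2; 3])
(Fork 2 4
(Cite 18 [:: 4; 2; 5; 6; 8; 0; 1; 7; 9; 3])
(Fork 3 6
(Cite 7 [:: 0; 3; 1; 2; 4; 5; 6; 7; 9; 8])
(Fork 3 4
(Cite 21 [:: 4; 3; 5; 6; 8; 0; 1; 7; 9; 2])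
(Cite 0 [:: 0; 1; 2; 3; 4; 5; 6; 7; 8; 9])))));
(([:: (0, 1); (0, 2); (0, 3); (1, 7); (4, 5); (4, 8); (5, 7); (6, 7); (8, 9)], [:: (0, 4); (2, 4); (3, 4); (5, 9); (6, 8); (6, 9); (7, 8); (7, 9)]),
 Play 9 7 [:: Go 0 4 0 8; Go 0 5 0 4; Go 1 5 0 4; Go 1 7 0 5; Go 0 7 0 5; Go 1 5 0 7; Go 1 7 0 7; Go 7 5 1 7; Go 7 5 1 5; Trap 7 5 [:: 0; 2; 3; 4; 8; 9]]);
(([:: (0, 1); (0, 2); (0, 3); (4, 5); (4, 6); (4, 8); (5, 7); (6, 7); (8, 9)], [:: (0, 4); (0, 5); (0, 6); (0, 7); (0, 8); (0, 9); (4, 7)]),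
 Fork 4 9
(Cite 18 [:: 4; 5; 6; 8; 9; 0; 7; 1; 2; 3])
(Fork 7 9
(Cite 12 [:: 0; 1; 2; 3; 4; 5; 6; 7; 8; 9])
(Fork 5 9
(Cite 6 [:: 0; 1; 2; 3; 4; 5; 6; 7; 8; 9])
(Fork 6 9
(Cite 6 [:: 0; 1; 2; 3; 4; 6; 5; 7; 8; 9])
(Fork 7 8
(Cite 4 [:: 0; 1; 2; 3; 4; 5; 6; 7; 8; 9])
(Fork 5 8
(Fork 6 8
(Cite 18 [:: 8; 4; 5; 6; 9; 0; 7; 1; 2; 3])
(Cite 1 [:: 0; 1; 2; 3; 4; 5; 6; 7; 8; 9]))
(Fork 6 8
(Cite 1 [:: 0; 1; 2; 3; 4; 6; 5; 7; 8; 9])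
(Fork 1 4
(Cite 19 [:: 4; 1; 5; 6; 8; 0; 7; 9; 2; 3])
(Fork 2 4
(Cite 20 [:: 4; 2; 5; 6; 8; 0; 1; 7; 9; 3])
(Fork 3 4
(Cite 23 [:: 4; 3; 5; 6; 8; 0; 1; 7; 9; 2])
(Fork 1 7
(Cite 0 [:: 0; 1; 2; 3; 4; 5; 6; 7; 8; 9])
(Fork 2 7
(Cite 0 [:: 0; 2; 1; 3; 4; 5; 6; 7; 8; 9])
(Fork 3 7
(Cite 0 [:: 0; 3; 1; 2; 4; 5; 6; 7; 8; 9])
(Cite 5 [:: 0; 1; 2; 3; 7; 5; 6; 4; 8; 9]))))))))))))));
(([:: (0, 1); (0, 2); (0, 3); (4, 5); (4, 6); (4, 8); (5, 7); (6, 7); (8, 9)], [:: (0, 4); (0, 5); (0, 6); (0, 7); (0, 8); (0, 9)]),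
 Fork 4 7
(Cite 18 [:: 4; 5; 6; 7; 8; 0; 1; 2; 3; 9])
(Cite 0 [:: 0; 1; 2; 3; 4; 5; 6; 7; 8; 9]));
(([:: (0, 1); (0, 2); (0, 3); (1, 4); (5, 7); (6, 7); (8, 9)], [:: (2, 4); (3, 4); (4, 8); (4, 9); (5, 8); (5, 9); (6, 8); (6, 9); (7, 8); (7, 9)]),
 Play 9 7 [:: Trap 0 8 [:: 8; 9]; Go 0 7 1 7; Trap 7 0 [:: 0; 1; 2; 3; 4; 8; 9]]);
(([:: (0, 1); (0, 2); (0, 3); (1, 4); (4, 5); (4, 6); (5, 7); (6, 7); (8, 9)], [:: (0, 4); (0, 7); (2, 4); (4, 7); (4, 8); (4, 9); (5, 8); (5, 9); (6, 8); (6, 9); (7, 8); (7, 9)]),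
 Fork 3 4
(Cite 37 [:: 4; 1; 3; 5; 6; 8; 9; 0; 2; 7])
(Cite 0 [:: 0; 1; 2; 3; 4; 5; 6; 7; 8; 9]));
(([:: (0, 1); (0, 2); (0, 3); (5, 7); (6, 7); (8, 9)], [:: (0, 4); (1, 4); (2, 4); (4, 8); (4, 9); (5, 8); (5, 9); (6, 8); (6, 9); (7, 8); (7, 9)]),
 Fork 3 4
(Cite 1 [:: 0; 3; 1; 2; 4; 5; 6; 7; 8; 9])
(Play 7 0 [:: Trap 0 8 [:: 8; 9]; Trap 7 4 [:: 4]]));
(([:: (0, 1); (0, 2); (0, 3); (4, 5); (4, 6); (4, 7); (5, 9); (6, 7); (7, 9); (8, 9)], [:: (0, 4); (0, 6); (4, 8); (4, 9); (5, 6); (6, 8)]),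
 Fork 1 4
(Cite 24 [:: 4; 1; 5; 6; 7; 0; 8; 9; 2; 3])
(Fork 2 4
(Cite 25 [:: 4; 2; 5; 6; 7; 0; 1; 8; 9; 3])
(Fork 3 4
(Cite 47 [:: 4; 3; 5; 6; 7; 0; 1; 8; 9; 2])
(Cite 18 [:: 0; 1; 2; 3; 4; 5; 8; 9; 6; 7]))));
(([:: (0, 1); (0, 2); (0, 3); (4, 5); (4, 7); (5, 8); (6, 7); (7, 9); (8, 9)], [:: (0, 4); (0, 5); (0, 8); (1, 4); (2, 4); (3, 4); (4, 8); (5, 6); (5, 7); (6, 8)]),
 Fork 1 5
(Cite 15 [:: 0; 1; 2; 3; 4; 9; 5; 8; 6; 7])
(Cite 8 [:: 0; 2; 3; 1; 4; 9; 5; 8; 7; 6]));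
(([:: (0, 1); (0, 2); (0, 3); (4, 5); (4, 6); (4, 7); (5, 8); (6, 7); (7, 9); (8, 9)], [:: (0, 4); (0, 5); (0, 8); (4, 8); (4, 9); (5, 6); (5, 7); (6, 8)]),
 Fork 1 4
(Cite 26 [:: 4; 1; 5; 6; 7; 0; 8; 9; 2; 3])
(Fork 2 4
(Cite 27 [:: 4; 2; 5; 6; 7; 0; 1; 8; 9; 3])
(Fork 3 4
(Cite 49 [:: 4; 3; 5; 6; 7; 0; 1; 8; 9; 2])
(Cite 0 [:: 0; 1; 2; 3; 4; 5; 6; 7; 8; 9]))));
(([:: (0, 1); (0, 2); (0, 3); (4, 5); (4, 6); (4, 7); (5, 8); (6, 7); (7, 9); (8, 9)], [:: (0, 4); (0, 5); (0, 8); (4, 9); (5, 6); (5, 7); (6, 8)]),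
 Fork 4 8
(Cite 26 [:: 4; 5; 6; 7; 8; 0; 9; 1; 2; 3])
(Cite 0 [:: 0; 1; 2; 3; 4; 5; 6; 7; 8; 9]));
(([:: (0, 1); (0, 2); (0, 3); (4, 5); (4, 6); (4, 7); (5, 8); (6, 7); (7, 9); (8, 9)], [:: (0, 4); (0, 5); (0, 6); (0, 7); (0, 8); (0, 9); (4, 9); (5, 7); (6, 8)]),
 Fork 5 6
(Cite 8 [:: 0; 1; 2; 3; 5; 4; 6; 7; 8; 9])
(Cite 0 [:: 0; 1; 2; 3; 4; 5; 6; 7; 8; 9]));
(([:: (0, 1); (0, 2); (0, 3); (1, 2); (1, 7); (4, 5); (4, 6); (5, 8); (7, 9); (8, 9)], [:: (3, 6); (4, 7); (4, 9); (5, 7); (6, 8); (6, 9)]),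
 Play 9 9 [:: Go 0 5 1 4; Go 1 5 1 4; Go 1 8 0 5; Go 1 8 1 5; Go 0 8 0 5; Go 0 8 1 5; Go 0 9 0 8; Go 0 9 1 8; Trap 9 0 [:: 0; 1; 2; 3; 4; 5; 6]]);
(([:: (0, 1); (0, 2); (0, 3); (1, 2); (3, 4); (4, 5); (4, 6); (5, 8); (6, 7); (7, 9); (8, 9)], [:: (0, 5); (0, 6); (0, 7); (0, 9); (1, 4); (2, 4); (3, 5); (4, 7); (4, 8); (4, 9); (5, 6); (5, 7); (6, 8); (6, 9); (7, 8)]),
 Fork 3 6
(Cite 74 [:: 5; 4; 1; 8; 2; 3; 0; 9; 7; 6])
(Fork 1 7
(Cite 0 [:: 0; 1; 2; 3; 4; 5; 6; 7; 8; 9])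
(Fork 2 7
(Cite 0 [:: 0; 2; 1; 3; 4; 5; 6; 7; 8; 9])
(Fork 3 7
(Fork 3 8
(Cite 29 [:: 3; 0; 4; 7; 8; 5; 6; 1; 2; 9])
(Fork 3 9
(Cite 74 [:: 6; 7; 1; 4; 2; 3; 0; 5; 8; 9])
(Fork 1 5
(Cite 89 [:: 0; 1; 2; 3; 8; 5; 9; 7; 6; 4])
(Fork 2 5
(Cite 89 [:: 0; 2; 1; 3; 8; 5; 9; 7; 6; 4])
(Cite 20 [:: 0; 3; 1; 2; 5; 7; 4; 6; 8; 9])))))
(Cite 18 [:: 0; 3; 1; 2; 7; 5; 6; 4; 9; 8])))));
(([:: (0, 1); (0, 2); (0, 3); (1, 2); (4, 5); (4, 6); (5, 8); (6, 7); (7, 9); (8, 9)], [:: (0, 4); (0, 5); (0, 6); (0, 7); (0, 8); (0, 9); (4, 7); (4, 8); (4, 9); (5, 6); (5, 7); (5, 9); (6, 8); (6, 9); (7, 8)]),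
 Fork 3 4
(Fork 1 4
(Cite 32 [:: 4; 1; 3; 5; 6; 0; 7; 8; 9; 2])
(Fork 2 4
(Cite 55 [:: 4; 2; 3; 5; 6; 9; 7; 0; 1; 8])
(Fork 3 5
(Cite 75 [:: 6; 4; 1; 7; 2; 3; 0; 9; 8; 5])
(Cite 0 [:: 0; 1; 2; 3; 4; 5; 6; 7; 8; 9]))))
(Fork 1 5
(Cite 1 [:: 0; 1; 2; 3; 6; 7; 4; 5; 9; 8])
(Fork 2 5
(Cite 1 [:: 0; 2; 1; 3; 6; 7; 4; 5; 9; 8])
(Fork 3 5
(Cite 0 [:: 0; 1; 2; 3; 5; 4; 8; 9; 6; 7])
(Cite 19 [:: 0; 3; 1; 2; 5; 7; 4; 6; 8; 9])))));
(([:: (0, 1); (0, 2); (0, 3); (1, 7); (2, 5); (4, 5); (5, 8); (6, 7); (7, 9); (8, 9)], [:: (0, 4); (2, 4); (3, 4); (4, 8); (5, 6); (5, 7); (6, 8)]),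
 Play 9 8 [:: Go 8 1 5 7; Go 2 7 5 7; Go 0 7 2 7; Go 0 9 2 7; Go 0 9 0 7; Go 0 8 0 9; Go 1 8 0 9; Go 0 8 1 8; Trap 8 0 [:: 0; 1; 2; 3; 4; 6; 7]]);
(([:: (0, 1); (0, 2); (0, 3); (1, 4); (1, 7); (4, 5); (4, 6); (5, 8); (6, 7); (7, 9); (8, 9)], [:: (0, 4); (0, 5); (2, 4); (3, 4); (4, 8); (4, 9); (5, 6); (5, 7); (6, 8)]),
 Fork 2 5
(Cite 0 [:: 0; 1; 2; 3; 4; 5; 6; 7; 8; 9])
(Fork 3 5
(Cite 0 [:: 0; 1; 3; 2; 4; 5; 6; 7; 8; 9])
(Cite 23 [:: 0; 1; 2; 3; 5; 7; 4; 6; 8; 9])));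
(([:: (0, 1); (0, 2); (0, 3); (1, 4); (1, 9); (2, 5); (4, 5); (4, 6); (5, 8); (6, 7); (7, 9); (8, 9)], [:: (0, 4); (0, 5); (0, 6); (0, 7); (0, 8); (0, 9); (1, 2); (1, 3); (1, 5); (1, 6); (1, 7); (1, 8); (2, 3); (2, 4); (2, 9); (3, 4); (3, 9); (4, 7); (4, 8); (4, 9); (5, 6); (5, 7); (5, 9); (6, 8); (6, 9); (7, 8)]),
 Fork 3 8
(Fork 2 8
(Cite 87 [:: 8; 2; 3; 0; 5; 1; 4; 6; 7; 9])
(Fork 2 6
(Cite 78 [:: 3; 7; 0; 8; 5; 6; 2; 9; 1; 4])
(Fork 3 6
(Fork 2 7
(Fork 3 5
(Cite 87 [:: 3; 5; 6; 4; 8; 1; 9; 7; 2; 0])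
(Fork 3 7
(Cite 87 [:: 3; 7; 8; 9; 6; 1; 4; 5; 2; 0])
(* All 45 pairs are decided here and the graph is the Petersen graph: index 149 is the bottom of the
   library at this point, which is [petersen_clause]. *)
(Cite 149 [:: 0; 4; 7; 8; 9; 5; 6; 3; 2; 1])))
(Cite 24 [:: 6; 3; 4; 7; 2; 9; 0; 1; 5; 8]))
(Cite 24 [:: 0; 1; 2; 3; 6; 8; 4; 5; 7; 9]))))
(Cite 24 [:: 0; 2; 1; 3; 8; 6; 5; 4; 9; 7]));
(([:: (0, 1); (0, 2); (0, 3); (2, 5); (4, 6); (5, 8); (6, 7); (7, 9); (8, 9)], [:: (1, 5); (1, 8); (1, 9); (3, 4); (4, 8); (4, 9); (5, 6); (5, 7); (6, 8)]),
 Play 9 8 [:: Go 2 6 0 6; Go 2 7 0 6; Go 2 7 2 6; Go 0 7 2 6; Go 0 9 0 7; Go 2 9 0 7; Go 2 9 2 7; Go 0 9 2 7; Go 0 8 0 9; Go 0 8 2 9; Trap 8 0 [:: 0; 1; 2; 3; 4; 6; 7]]);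
(([:: (0, 1); (0, 2); (0, 3); (1, 4); (4, 5); (4, 6); (5, 8); (6, 7); (7, 9); (8, 9)], [:: (0, 4); (0, 5); (0, 6); (0, 7); (0, 8); (0, 9); (1, 2); (1, 3); (2, 3); (2, 4); (3, 4); (4, 7); (4, 8); (4, 9); (5, 6); (5, 7); (5, 9); (6, 8); (6, 9); (7, 8)]),
 Fork 1 5
(Cite 80 [:: 6; 4; 2; 7; 3; 1; 0; 9; 8; 5])
(Fork 1 6
(Cite 80 [:: 5; 4; 2; 8; 3; 1; 0; 9; 7; 6])
(Fork 1 7
(Cite 2 [:: 0; 1; 2; 3; 4; 5; 6; 7; 8; 9])
(Fork 1 8
(Cite 2 [:: 0; 1; 2; 3; 4; 6; 5; 8; 7; 9])
(* The labels 4 and 9 are opposite on the hexagon 4, 5, 8, 9, 7, 6. In the Petersen graph each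
   neighbour of 0 is joined to two opposite vertices of the hexagon, so this is the branch that
   leads there. *)
(Fork 1 9
(Fork 2 9
(Cite 37 [:: 9; 1; 2; 7; 8; 0; 4; 5; 6; 3])
(Fork 3 9
(Cite 60 [:: 9; 1; 3; 7; 8; 4; 5; 0; 2; 6])
(Fork 2 5
(Cite 1 [:: 0; 1; 2; 3; 4; 5; 6; 7; 8; 9])
(Fork 3 5
(Cite 1 [:: 0; 1; 3; 2; 4; 5; 6; 7; 8; 9])
(Cite 26 [:: 0; 1; 2; 3; 5; 7; 4; 6; 8; 9])))))
(Fork 2 5
(Cite 0 [:: 0; 1; 2; 3; 4; 5; 6; 7; 8; 9])
(Fork 3 5
(Cite 0 [:: 0; 1; 3; 2; 4; 5; 6; 7; 8; 9])
(Cite 26 [:: 0; 1; 2; 3; 5; 7; 4; 6; 8; 9]))))))));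
(([:: (0, 1); (0, 2); (0, 3); (1, 4); (4, 5); (4, 6); (5, 8); (6, 7); (7, 9); (8, 9)], [:: (0, 4); (0, 5); (0, 6); (0, 7); (0, 8); (0, 9); (1, 2); (1, 3); (2, 3); (2, 4); (4, 7); (4, 8); (4, 9); (5, 6); (5, 7); (5, 9); (6, 8); (6, 9); (7, 8)]),
 Fork 3 4
(Cite 61 [:: 4; 1; 3; 5; 6; 9; 7; 0; 2; 8])
(Cite 0 [:: 0; 1; 2; 3; 4; 5; 6; 7; 8; 9]));
(([:: (0, 1); (0, 2); (0, 3); (1, 4); (4, 5); (4, 6); (5, 8); (6, 7); (7, 9); (8, 9)], [:: (0, 4); (0, 5); (0, 6); (0, 7); (0, 8); (0, 9); (1, 2); (1, 3); (2, 3); (4, 7); (4, 8); (4, 9); (5, 6); (5, 7); (5, 9); (6, 8); (6, 9); (7, 8)]),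
 Fork 2 4
(Cite 39 [:: 4; 1; 2; 5; 6; 0; 7; 8; 9; 3])
(Cite 0 [:: 0; 1; 2; 3; 4; 5; 6; 7; 8; 9]));
(* The six non-neighbours of 0 contain the hexagon 4, 5, 8, 9, 7, 6, as they do in the Petersen
   graph. Once its chords and the edges among 1, 2, 3 are excluded, the question is how 1, 2, 3 are
   attached to it. *)
(([:: (0, 1); (0, 2); (0, 3); (4, 5); (4, 6); (5, 8); (6, 7); (7, 9); (8, 9)], [:: (0, 4); (0, 5); (0, 6); (0, 7); (0, 8); (0, 9); (4, 9); (5, 7)]),
 Fork 6 8
(Cite 18 [:: 0; 1; 2; 3; 6; 4; 8; 5; 7; 9])
(Fork 4 7
(Cite 10 [:: 0; 1; 2; 3; 4; 5; 6; 7; 8; 9])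
(Fork 4 8
(Cite 10 [:: 0; 1; 2; 3; 4; 6; 5; 8; 7; 9])
(Fork 7 8
(Cite 10 [:: 0; 1; 2; 3; 7; 6; 9; 8; 4; 5])
(Fork 5 6
(Cite 11 [:: 0; 1; 2; 3; 5; 8; 4; 6; 9; 7])
(Fork 5 9
(Cite 12 [:: 0; 1; 2; 3; 5; 4; 8; 9; 6; 7])
(Fork 6 9
(Cite 12 [:: 0; 1; 2; 3; 6; 4; 7; 9; 5; 8])
(Fork 1 2
(Cite 7 [:: 0; 1; 2; 3; 4; 5; 6; 7; 8; 9])
(Fork 1 3
(Cite 7 [:: 0; 1; 3; 2; 4; 5; 6; 7; 8; 9])
(Fork 2 3
(Cite 7 [:: 0; 2; 3; 1; 4; 5; 6; 7; 8; 9])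
(Fork 1 4
(Cite 0 [:: 0; 1; 2; 3; 4; 5; 6; 7; 8; 9])
(Fork 1 5
(Cite 0 [:: 0; 1; 2; 3; 5; 4; 8; 9; 6; 7])
(Fork 1 6
(Cite 0 [:: 0; 1; 2; 3; 6; 4; 7; 9; 5; 8])
(Fork 2 4
(Cite 1 [:: 0; 2; 1; 3; 4; 5; 6; 7; 8; 9])
(Fork 3 4
(Cite 2 [:: 0; 3; 1; 2; 4; 5; 6; 7; 8; 9])
(Cite 28 [:: 0; 1; 2; 3; 4; 9; 5; 8; 6; 7]))))))))))))))));
(([:: (0, 1); (0, 2); (0, 3); (4, 5); (4, 6); (5, 8); (6, 7); (6, 9); (8, 9)], [:: (0, 4); (0, 5); (0, 6); (0, 7); (0, 8); (0, 9); (4, 9); (5, 7); (7, 8); (7, 9)]),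
 Fork 4 7
(Cite 0 [:: 0; 1; 2; 3; 4; 7; 5; 8; 6; 9])
(Fork 5 6
(Cite 38 [:: 6; 4; 5; 7; 9; 0; 1; 2; 3; 8])
(Fork 6 8
(Cite 39 [:: 6; 4; 7; 8; 9; 0; 5; 1; 2; 3])
(Fork 4 8
(Fork 5 9
(Cite 25 [:: 0; 1; 2; 3; 4; 5; 8; 9; 6; 7])
(Cite 15 [:: 0; 1; 2; 3; 8; 9; 5; 4; 7; 6]))
(Fork 1 6
(Cite 40 [:: 6; 1; 4; 7; 9; 0; 5; 8; 2; 3])
(Fork 2 6
(Cite 41 [:: 6; 2; 4; 7; 9; 0; 1; 5; 8; 3])
(Fork 3 6
(Cite 63 [:: 6; 3; 4; 7; 9; 0; 1; 5; 8; 2])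
(Fork 1 4
(Cite 93 [:: 0; 2; 3; 7; 1; 6; 4; 5; 8; 9])
(Fork 2 4
(Cite 93 [:: 0; 1; 3; 7; 2; 6; 4; 5; 8; 9])
(Fork 3 4
(Cite 93 [:: 0; 1; 2; 7; 3; 6; 4; 5; 8; 9])
(Cite 14 [:: 0; 1; 2; 3; 4; 5; 7; 6; 8; 9])))))))))));
(([:: (0, 1); (0, 2); (0, 3); (1, 4); (4, 5); (5, 8); (6, 7); (6, 8); (8, 9)], [:: (2, 6); (3, 6); (4, 7); (4, 9); (5, 7); (7, 9)]),
 Play 9 5 [:: Go 1 8 0 6; Go 0 8 0 6; Go 0 5 0 8; Go 0 5 1 8; Trap 5 0 [:: 0; 1; 2; 3; 6; 7; 9]]);
(([:: (0, 1); (0, 2); (0, 3); (4, 5); (4, 6); (5, 8); (6, 7); (8, 9)], [:: (0, 4); (0, 5); (0, 6); (0, 7); (0, 8); (0, 9); (4, 9); (5, 7); (6, 9); (7, 9)]),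
 Fork 7 8
(Cite 1 [:: 0; 1; 2; 3; 5; 4; 8; 9; 6; 7])
(Fork 4 8
(Cite 26 [:: 0; 1; 2; 3; 4; 8; 5; 9; 6; 7])
(Fork 5 6
(Cite 26 [:: 0; 1; 2; 3; 5; 6; 4; 7; 8; 9])
(Fork 6 8
(Fork 4 7
(Cite 17 [:: 0; 1; 2; 3; 4; 5; 7; 6; 9; 8])
(Fork 5 9
(Cite 17 [:: 0; 1; 2; 3; 5; 4; 9; 8; 7; 6])
(Fork 1 6
(Cite 42 [:: 6; 1; 4; 7; 8; 0; 5; 9; 2; 3])
(Fork 2 6
(Cite 43 [:: 6; 2; 4; 7; 8; 0; 1; 5; 9; 3])
(Fork 3 6
(Cite 46 [:: 6; 3; 4; 7; 8; 0; 1; 5; 9; 2])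
(Fork 1 4
(Cite 0 [:: 0; 1; 2; 3; 4; 5; 6; 7; 8; 9])
(Fork 2 4
(Cite 0 [:: 0; 2; 1; 3; 4; 5; 6; 7; 8; 9])
(Fork 3 4
(Cite 0 [:: 0; 3; 1; 2; 4; 5; 6; 7; 8; 9])
(Cite 28 [:: 0; 1; 2; 3; 4; 5; 9; 8; 6; 7])))))))))
(Play 9 5 [:: Go 0 4 0 6; Go 0 5 0 8; Go 0 5 0 4; Trap 5 0 [:: 0; 1; 2; 3; 6; 7; 9]])))));
(([:: (0, 1); (0, 2); (0, 3); (4, 5); (4, 6); (5, 8); (6, 7); (8, 9)], [:: (0, 4); (0, 5); (0, 6); (0, 7); (0, 8); (0, 9); (4, 9); (5, 7); (7, 9)]),
 Fork 6 9
(Fork 7 8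
(Cite 22 [:: 0; 1; 2; 3; 6; 7; 9; 8; 4; 5])
(Cite 2 [:: 0; 1; 2; 3; 4; 5; 6; 7; 8; 9]))
(Cite 0 [:: 0; 1; 2; 3; 4; 5; 6; 7; 8; 9]));
(([:: (0, 1); (0, 2); (0, 3); (4, 5); (4, 6); (5, 8); (6, 7); (8, 9)], [:: (0, 4); (0, 5); (0, 6); (0, 7); (0, 8); (0, 9); (5, 7)]),
 Fork 4 9
(Cite 23 [:: 0; 1; 2; 3; 4; 5; 9; 8; 6; 7])
(Fork 7 9
(Cite 4 [:: 0; 1; 2; 3; 4; 5; 6; 7; 8; 9])
(Cite 0 [:: 0; 1; 2; 3; 4; 5; 6; 7; 8; 9])));
(([:: (0, 1); (0, 2); (0, 3); (4, 5); (4, 6); (4, 8); (6, 7); (8, 9)], [:: (5, 7); (5, 9); (6, 9); (7, 8); (7, 9)]),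
 Play 9 6 [:: Go 0 4 0 8; Go 0 6 0 4; Trap 6 0 [:: 0; 1; 2; 3; 5; 8; 9]]);
(([:: (0, 1); (0, 2); (0, 3); (4, 5); (4, 6); (4, 8); (6, 7); (8, 9)], [:: (0, 4); (0, 5); (0, 6); (0, 7); (0, 8); (0, 9); (5, 7); (5, 9); (7, 8); (7, 9)]),
 Fork 6 9
(Cite 2 [:: 0; 1; 2; 3; 8; 9; 4; 5; 6; 7])
(Cite 0 [:: 0; 1; 2; 3; 4; 5; 6; 7; 8; 9]));
(([:: (0, 1); (0, 2); (0, 3); (4, 5); (4, 6); (6, 7); (8, 9)], [:: (4, 8); (4, 9); (5, 7); (5, 8); (5, 9); (6, 8); (6, 9); (7, 8); (7, 9)]),
 Play 9 6 [:: Trap 0 8 [:: 8; 9]; Go 0 6 0 4; Trap 6 0 [:: 0; 1; 2; 3; 5; 8; 9]]);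
(([:: (0, 1); (0, 2); (0, 3); (4, 5); (4, 6); (6, 7); (8, 9)], [:: (4, 8); (4, 9); (5, 7); (5, 8); (5, 9); (7, 8); (7, 9)]),
 Fork 6 8
(Cite 2 [:: 0; 1; 2; 3; 6; 7; 4; 5; 8; 9])
(Fork 6 9
(Cite 2 [:: 0; 1; 2; 3; 6; 7; 4; 5; 9; 8])
(Cite 0 [:: 0; 1; 2; 3; 4; 5; 6; 7; 8; 9])));
(([:: (0, 1); (0, 2); (0, 3); (4, 5); (4, 6); (6, 7); (8, 9)], [:: (0, 4); (0, 5); (0, 6); (0, 7); (0, 8); (0, 9); (5, 7); (5, 8); (5, 9); (7, 8); (7, 9)]),
 Fork 4 8
(Cite 2 [:: 0; 1; 2; 3; 4; 5; 6; 7; 8; 9])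
(Fork 4 9
(Cite 2 [:: 0; 1; 2; 3; 4; 5; 6; 7; 9; 8])
(Cite 0 [:: 0; 1; 2; 3; 4; 5; 6; 7; 8; 9])));
(([:: (0, 1); (0, 2); (0, 3); (4, 5); (4, 6); (6, 7); (8, 9)], [:: (0, 4); (0, 5); (0, 6); (0, 7); (0, 8); (0, 9); (5, 7); (5, 8); (5, 9); (7, 8)]),
 Fork 7 9
(Cite 5 [:: 0; 1; 2; 3; 6; 7; 4; 5; 9; 8])
(Cite 0 [:: 0; 1; 2; 3; 4; 5; 6; 7; 8; 9]));
(([:: (0, 1); (0, 2); (0, 3); (4, 5); (4, 6); (6, 7); (8, 9)], [:: (0, 4); (0, 5); (0, 6); (0, 7); (0, 8); (0, 9); (5, 7); (5, 8); (5, 9)]),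
 Fork 7 8
(Cite 6 [:: 0; 1; 2; 3; 6; 7; 4; 5; 8; 9])
(Cite 0 [:: 0; 1; 2; 3; 4; 5; 6; 7; 8; 9]));
(([:: (0, 1); (0, 2); (0, 3); (4, 5); (4, 6); (6, 7); (8, 9)], [:: (0, 4); (0, 5); (0, 6); (0, 7); (0, 8); (0, 9); (5, 7); (5, 8)]),
 Fork 5 9
(Cite 7 [:: 0; 1; 2; 3; 4; 5; 6; 7; 9; 8])
(Cite 0 [:: 0; 1; 2; 3; 4; 5; 6; 7; 8; 9]));
(([:: (0, 1); (0, 2); (0, 3); (4, 5); (4, 6); (6, 7); (8, 9)], [:: (0, 4); (0, 5); (0, 6); (0, 7); (0, 8); (0, 9); (5, 7)]),
 Fork 5 8
(Cite 8 [:: 0; 1; 2; 3; 4; 5; 6; 7; 8; 9])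
(Cite 0 [:: 0; 1; 2; 3; 4; 5; 6; 7; 8; 9]));
(([:: (0, 1); (0, 2); (0, 3); (4, 5); (4, 6); (6, 7); (8, 9)], [:: (0, 4); (0, 5); (0, 6); (0, 7); (0, 8); (0, 9)]),
 (* The pair 5 7 closes the 4-cycle 4, 5, 7, 6, next to the edge 8 9. *)
 Fork 5 7
(Fork 4 8
(Cite 33 [:: 0; 1; 2; 3; 4; 5; 6; 7; 8; 9])
(Fork 4 9
(Cite 33 [:: 0; 1; 2; 3; 4; 5; 6; 7; 9; 8])
(Fork 5 8
(Cite 33 [:: 0; 1; 2; 3; 5; 4; 7; 6; 8; 9])
(Fork 5 9
(Cite 33 [:: 0; 1; 2; 3; 5; 4; 7; 6; 9; 8])
(Fork 6 8
(Cite 33 [:: 0; 1; 2; 3; 6; 4; 7; 5; 8; 9])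
(Fork 6 9
(Cite 33 [:: 0; 1; 2; 3; 6; 4; 7; 5; 9; 8])
(Fork 7 8
(Cite 33 [:: 0; 1; 2; 3; 7; 5; 6; 4; 8; 9])
(Fork 7 9
(Cite 33 [:: 0; 1; 2; 3; 7; 5; 6; 4; 9; 8])
(Fork 4 7
(Cite 51 [:: 4; 5; 6; 7; 8; 9; 1; 2; 3; 0])
(Fork 1 4
(Fork 2 4
(Cite 55 [:: 4; 1; 2; 5; 6; 0; 7; 8; 9; 3])
(Cite 31 [:: 0; 1; 2; 3; 4; 5; 6; 7; 8; 9]))
(Fork 2 4
(Cite 31 [:: 0; 2; 1; 3; 4; 5; 6; 7; 8; 9])
(Cite 30 [:: 0; 1; 2; 3; 4; 5; 6; 7; 8; 9]))))))))))))
(Cite 0 [:: 0; 1; 2; 3; 4; 5; 6; 7; 8; 9]));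
(([:: (0, 1); (0, 2); (0, 3); (4, 5); (6, 7); (8, 9)], [:: (0, 4); (0, 5); (0, 6); (0, 7); (0, 8); (0, 9); (4, 6); (4, 7); (4, 8); (4, 9); (6, 8); (6, 9)]),
 Fork 5 6
(Cite 3 [:: 0; 1; 2; 3; 5; 4; 6; 7; 8; 9])
(Fork 5 8
(Cite 4 [:: 0; 1; 2; 3; 5; 4; 8; 9; 6; 7])
(Fork 5 9
(Cite 4 [:: 0; 1; 2; 3; 5; 4; 9; 8; 6; 7])
(Fork 5 7
(Cite 6 [:: 0; 1; 2; 3; 5; 4; 7; 6; 8; 9])
(Fork 7 8
(Cite 7 [:: 0; 1; 2; 3; 7; 6; 8; 9; 4; 5])
(Fork 7 9
(Cite 7 [:: 0; 1; 2; 3; 7; 6; 9; 8; 4; 5])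
(Play 9 0 [:: Trap 0 4 [:: 4; 5]; Trap 0 6 [:: 6; 7]])))))));
(([:: (0, 1); (0, 2); (0, 3); (1, 5); (4, 5); (4, 7); (4, 8); (6, 7); (6, 9)], [:: (2, 6); (3, 6); (4, 9); (5, 9); (6, 8); (8, 9)]),
 Play 9 4 [:: Go 1 7 0 6; Go 0 7 0 6; Go 0 4 1 7; Go 0 4 0 7; Trap 4 0 [:: 0; 1; 2; 3; 6; 9]]);
(([:: (0, 1); (0, 2); (0, 3); (4, 5); (4, 7); (4, 8); (5, 6); (6, 7); (6, 9)], [:: (0, 4); (0, 5); (0, 6); (4, 6); (4, 9); (5, 8); (5, 9); (6, 8); (8, 9)]),
 Fork 1 4
(Cite 57 [:: 4; 1; 5; 7; 8; 0; 6; 9; 2; 3])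
(Fork 1 6
(Cite 57 [:: 6; 1; 5; 7; 9; 0; 4; 8; 2; 3])
(Fork 2 6
(Cite 58 [:: 6; 2; 5; 7; 9; 0; 1; 4; 8; 3])
(Fork 3 6
(Cite 81 [:: 6; 3; 5; 7; 9; 0; 1; 4; 8; 2])
(Fork 1 5
(Cite 0 [:: 0; 1; 2; 3; 4; 5; 6; 7; 8; 9])
(Fork 2 5
(Cite 0 [:: 0; 2; 1; 3; 4; 5; 6; 7; 8; 9])
(Fork 3 5
(Cite 0 [:: 0; 3; 1; 2; 4; 5; 6; 7; 8; 9])
(Play 9 7 [:: Trap 7 5 [:: 5]; Go 0 7 0 6; Go 0 7 0 4; Trap 7 0 [:: 0; 1; 2; 3; 8; 9]]))))))));
(([:: (0, 1); (0, 2); (0, 3); (4, 5); (4, 7); (4, 8); (6, 7); (6, 9)], [:: (4, 9); (5, 6); (5, 9); (6, 8); (8, 9)]),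
 Play 9 7 [:: Go 0 7 0 4; Go 0 7 0 6; Trap 7 0 [:: 0; 1; 2; 3; 5; 8; 9]]);
(([:: (0, 1); (0, 2); (0, 3); (4, 5); (4, 7); (4, 8); (6, 7); (6, 9)], [:: (0, 4); (0, 5); (0, 6); (0, 7); (0, 8); (0, 9); (4, 6); (4, 9); (5, 9); (7, 8); (8, 9)]),
 Fork 5 8
(Cite 16 [:: 0; 1; 2; 3; 4; 7; 5; 8; 6; 9])
(Fork 5 6
(Fork 6 8
(Cite 58 [:: 6; 5; 7; 8; 9; 0; 4; 1; 2; 3])
(Cite 1 [:: 0; 1; 2; 3; 4; 5; 6; 7; 8; 9]))
(Fork 6 8
(Cite 1 [:: 0; 1; 2; 3; 4; 8; 6; 7; 5; 9])
(Cite 0 [:: 0; 1; 2; 3; 4; 5; 6; 7; 8; 9]))));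
(([:: (0, 1); (0, 2); (0, 3); (4, 5); (4, 7); (4, 8); (6, 7); (6, 9)], [:: (0, 4); (0, 5); (0, 6); (0, 7); (0, 8); (0, 9); (4, 6); (5, 9); (7, 8); (8, 9)]),
 Fork 4 9
(Cite 59 [:: 4; 5; 7; 8; 9; 0; 6; 1; 2; 3])
(Cite 0 [:: 0; 1; 2; 3; 4; 5; 6; 7; 8; 9]));
(([:: (0, 1); (0, 2); (0, 3); (4, 5); (4, 8); (6, 7); (6, 9)], [:: (0, 4); (0, 5); (0, 6); (0, 7); (0, 8); (0, 9); (5, 9); (8, 9)]),
 Fork 5 7
(Cite 16 [:: 0; 1; 2; 3; 7; 5; 6; 9; 4; 8])
(Fork 7 8
(Cite 17 [:: 0; 1; 2; 3; 7; 8; 6; 9; 4; 5])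
(Fork 4 6
(Cite 116 [:: 1; 0; 2; 5; 7; 4; 6; 9; 3; 8])
(Fork 4 7
(Cite 0 [:: 0; 1; 2; 3; 4; 5; 6; 7; 8; 9])
(Fork 4 9
(Cite 1 [:: 0; 1; 2; 3; 4; 8; 6; 9; 5; 7])
(Fork 5 6
(Cite 0 [:: 0; 1; 2; 3; 6; 9; 4; 5; 7; 8])
(Fork 6 8
(Cite 2 [:: 0; 1; 2; 3; 6; 7; 4; 8; 9; 5])
(Play 9 0 [:: Trap 0 4 [:: 4; 5; 8]; Trap 0 6 [:: 6; 7; 9]]))))))));
(([:: (0, 1); (0, 2); (0, 3); (5, 7); (6, 7); (7, 8)], [:: (0, 4); (1, 4); (2, 4); (3, 4); (4, 9); (5, 9); (6, 9); (7, 9); (8, 9)]),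
 Play 7 0 [:: Trap 0 9 [:: 9]; Trap 7 4 [:: 4]]);
(([:: (0, 1); (0, 2); (0, 3); (4, 5); (4, 6); (4, 8); (5, 7); (6, 7); (7, 8)], [:: (0, 4); (4, 7); (4, 9); (5, 9); (6, 9); (7, 9); (8, 9)]),
 Fork 1 4
(Cite 63 [:: 4; 1; 5; 6; 8; 0; 7; 9; 2; 3])
(Fork 2 4
(Cite 64 [:: 4; 2; 5; 6; 8; 0; 1; 7; 9; 3])
(Fork 3 4
(Cite 67 [:: 4; 3; 5; 6; 8; 0; 1; 7; 9; 2])
(Cite 0 [:: 0; 1; 2; 3; 4; 5; 6; 7; 8; 9]))));
(([:: (0, 1); (0, 2); (0, 3); (1, 7); (4, 5); (4, 6); (4, 8); (7, 8)], [:: (2, 6); (3, 6); (4, 9); (5, 7); (5, 9); (6, 9); (7, 9); (8, 9)]),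
 Play 9 8 [:: Trap 0 9 [:: 9]; Go 0 8 0 4; Go 0 8 1 4; Trap 8 0 [:: 0; 1; 2; 3; 5; 6; 9]]);
(([:: (0, 1); (0, 2); (0, 3); (4, 5); (4, 6); (4, 8)], [:: (0, 7); (1, 7); (2, 7); (4, 9); (5, 9); (6, 9); (7, 9); (8, 9)]),
 Fork 3 7
(Cite 51 [:: 4; 5; 6; 8; 9; 1; 2; 0; 3; 7])
(Cite 2 [:: 0; 1; 2; 3; 7; 5; 6; 4; 8; 9]));
(([:: (0, 1); (0, 2); (0, 3); (4, 5); (4, 6); (4, 8); (7, 8)], [:: (0, 7); (1, 6); (1, 7); (3, 6); (4, 9); (5, 7); (5, 9); (6, 9); (7, 9); (8, 9)]),
 Fork 2 7
(Cite 1 [:: 0; 2; 1; 3; 4; 5; 6; 7; 8; 9])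
(Cite 0 [:: 0; 1; 2; 3; 4; 5; 6; 7; 8; 9]));
(([:: (0, 1); (0, 2); (0, 3); (4, 5); (4, 6); (4, 8); (5, 6); (6, 7); (7, 8)], [:: (0, 6); (0, 7); (4, 9); (5, 7); (5, 9); (6, 8); (6, 9); (7, 9); (8, 9)]),
 Fork 1 6
(Cite 67 [:: 6; 1; 4; 5; 7; 0; 8; 9; 2; 3])
(Fork 2 6
(Cite 68 [:: 6; 2; 4; 5; 7; 0; 1; 8; 9; 3])
(Fork 3 6
(Cite 71 [:: 6; 3; 4; 5; 7; 0; 1; 8; 9; 2])
(Fork 1 7
(Cite 2 [:: 0; 1; 2; 3; 4; 5; 6; 7; 8; 9])
(Cite 0 [:: 0; 1; 2; 3; 4; 5; 6; 7; 8; 9])))));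
(([:: (0, 1); (0, 2); (0, 3); (4, 5); (4, 6); (4, 8); (5, 6); (6, 7); (7, 8)], [:: (0, 4); (0, 6); (0, 7); (4, 7); (4, 9); (5, 9); (6, 9); (7, 9); (8, 9)]),
 Fork 6 8
(Cite 176 [:: 6; 1; 4; 5; 7; 8; 0; 2; 3; 9])
(Fork 5 7
(Cite 4 [:: 0; 1; 2; 3; 4; 5; 6; 7; 8; 9])
(Cite 0 [:: 0; 1; 2; 3; 4; 5; 6; 7; 8; 9])));
(([:: (0, 1); (0, 2); (0, 3); (1, 2); (1, 6); (3, 4); (4, 5); (4, 8); (6, 7); (7, 8)], [:: (2, 4); (4, 6); (4, 9); (5, 7); (5, 8); (5, 9); (6, 9); (7, 9); (8, 9)]),
 Play 9 6 [:: Trap 0 9 [:: 9]; Go 1 3 1 4; Go 0 8 1 4; Go 6 3 1 4; Go 6 0 1 3; Go 0 7 0 8; Go 3 6 0 7; Go 0 6 0 7; Go 0 6 3 6; Trap 6 0 [:: 0; 2; 3; 4; 5; 8; 9]]);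
(([:: (0, 1); (0, 2); (0, 3); (1, 2); (3, 4); (4, 5); (4, 8); (6, 7); (7, 8)], [:: (0, 4); (0, 5); (0, 6); (0, 7); (0, 8); (0, 9); (4, 6); (4, 7); (4, 9); (5, 7); (5, 8); (5, 9); (6, 8); (6, 9); (7, 9); (8, 9)]),
 Fork 1 4
(Cite 71 [:: 4; 1; 3; 5; 8; 0; 6; 7; 9; 2])
(Fork 2 4
(Cite 85 [:: 4; 2; 3; 5; 8; 6; 7; 0; 1; 9])
(Fork 1 9
(Cite 20 [:: 4; 3; 5; 8; 1; 9; 2; 0; 6; 7])
(Fork 2 9
(Cite 20 [:: 4; 3; 5; 8; 1; 0; 2; 9; 6; 7])
(Fork 1 6
(Cite 0 [:: 0; 1; 2; 3; 4; 5; 6; 7; 8; 9])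
(Fork 2 6
(Cite 0 [:: 0; 2; 1; 3; 4; 5; 6; 7; 8; 9])
(Fork 1 7
(Cite 3 [:: 4; 8; 3; 5; 1; 2; 0; 6; 7; 9])
(Fork 2 7
(Cite 3 [:: 4; 8; 3; 5; 2; 1; 0; 6; 7; 9])
(Cite 46 [:: 4; 5; 8; 3; 9; 1; 2; 0; 6; 7])))))))));
(([:: (0, 1); (0, 2); (0, 3); (1, 2); (1, 4); (5, 6); (6, 7); (7, 8)], [:: (3, 4); (3, 5); (4, 9); (5, 8); (5, 9); (6, 9); (7, 9); (8, 9)]),
 Play 9 7 [:: Trap 0 9 [:: 9]; Go 1 7 0 7; Go 1 7 1 6; Trap 7 1 [:: 0; 1; 2; 3; 4; 5; 9]]);
(([:: (0, 1); (0, 2); (0, 3); (4, 5); (6, 7); (7, 8)], [:: (0, 4); (0, 5); (1, 4); (1, 5); (2, 4); (2, 5); (3, 4); (3, 5); (4, 9); (5, 9); (6, 9); (7, 9); (8, 9)]),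
 Play 7 0 [:: Trap 0 9 [:: 9]; Trap 7 4 [:: 4; 5]]);
(([:: (0, 1); (0, 2); (0, 3); (1, 2); (4, 5); (4, 8); (5, 6); (6, 7); (7, 8)], [:: (0, 4); (0, 5); (0, 6); (0, 7); (0, 8); (0, 9); (4, 6); (4, 7); (4, 9); (5, 7); (5, 8); (5, 9); (6, 8); (6, 9); (7, 9); (8, 9)]),
 Fork 3 4
(Cite 2 [:: 0; 1; 2; 3; 4; 5; 6; 7; 8; 9])
(Fork 3 5
(Cite 2 [:: 0; 1; 2; 3; 5; 6; 7; 8; 4; 9])
(Fork 1 4
(Cite 1 [:: 0; 1; 2; 3; 4; 5; 6; 7; 8; 9])
(Fork 1 5
(Cite 1 [:: 0; 1; 2; 3; 5; 4; 8; 7; 6; 9])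
(Fork 2 4
(Cite 1 [:: 0; 2; 1; 3; 4; 5; 6; 7; 8; 9])
(Fork 2 5
(Cite 1 [:: 0; 2; 1; 3; 5; 4; 8; 7; 6; 9])
(Cite 0 [:: 0; 1; 2; 3; 4; 5; 6; 7; 8; 9])))))));
(([:: (0, 1); (0, 2); (0, 3); (1, 4); (1, 5); (5, 6); (6, 7); (7, 8)], [:: (2, 4); (3, 4); (4, 9); (5, 8); (5, 9); (6, 9); (7, 9); (8, 9)]),
 Play 9 7 [:: Trap 0 9 [:: 9]; Go 0 7 1 7; Go 0 6 1 7; Go 0 7 0 6; Trap 7 0 [:: 0; 1; 2; 3; 4; 5; 9]]);
(([:: (0, 1); (0, 3); (1, 4); (2, 5); (2, 8); (4, 5); (6, 7); (7, 8)], [:: (0, 5); (0, 6); (1, 2); (2, 3); (2, 9); (3, 4); (3, 5); (4, 9); (5, 9); (6, 9); (7, 9); (8, 9)]),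
 Play 9 7 [:: Trap 0 9 [:: 9]; Go 1 7 0 7; Go 1 8 0 7; Go 4 8 1 7; Go 4 8 1 8; Go 4 7 1 8; Go 4 7 1 7; Go 5 7 4 7; Go 5 7 4 8; Trap 7 5 [:: 0; 1; 2; 3; 4; 5; 9]]);
(([:: (0, 1); (0, 2); (0, 3); (1, 4); (4, 8); (5, 6); (6, 7); (7, 8)], [:: (0, 8); (2, 4); (2, 8); (3, 4); (3, 5); (4, 9); (5, 9); (6, 9); (7, 9); (8, 9)]),
 Play 9 6 [:: Trap 0 9 [:: 9]; Go 1 6 0 6; Go 1 6 0 7; Go 1 7 0 6; Go 1 7 0 7; Go 4 6 1 6; Go 4 6 1 7; Trap 6 4 [:: 0; 1; 2; 3; 4; 8; 9]]);
(([:: (0, 1); (0, 2); (0, 3); (1, 4); (2, 5); (4, 5); (4, 8); (5, 6); (6, 7); (7, 8)], [:: (0, 5); (0, 6); (0, 8); (0, 9); (1, 2); (1, 5); (2, 3); (2, 4); (2, 9); (3, 4); (4, 9); (5, 7); (5, 8); (5, 9); (6, 9); (7, 9); (8, 9)]),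
 Fork 3 5
(Cite 92 [:: 5; 2; 3; 4; 6; 7; 8; 0; 1; 9])
(Fork 2 8
(Cite 1 [:: 0; 1; 2; 3; 4; 5; 6; 7; 8; 9])
(Cite 0 [:: 0; 1; 2; 3; 4; 5; 6; 7; 8; 9])));
(([:: (0, 1); (0, 2); (0, 3); (1, 4); (4, 5); (4, 8); (5, 6); (6, 7); (7, 8)], [:: (0, 4); (0, 5); (0, 6); (0, 7); (0, 8); (0, 9); (1, 2); (1, 3); (2, 3); (2, 4); (4, 6); (4, 7); (4, 9); (5, 7); (5, 8); (5, 9); (6, 8); (6, 9); (7, 9); (8, 9)]),
 Fork 3 4
(Cite 93 [:: 4; 1; 3; 5; 8; 6; 7; 0; 2; 9])
(Fork 2 9
(Cite 23 [:: 4; 1; 5; 8; 0; 3; 2; 9; 6; 7])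
(Fork 3 9
(Cite 26 [:: 4; 1; 5; 8; 3; 9; 0; 2; 6; 7])
(Fork 1 5
(Cite 3 [:: 0; 1; 2; 3; 4; 5; 6; 7; 8; 9])
(Fork 1 8
(Cite 3 [:: 0; 1; 2; 3; 4; 8; 7; 6; 5; 9])
(Fork 2 5
(Cite 0 [:: 0; 1; 2; 3; 4; 5; 6; 7; 8; 9])
(Fork 3 8
(Cite 0 [:: 0; 1; 3; 2; 4; 8; 7; 6; 5; 9])
(Cite 1 [:: 0; 1; 2; 3; 4; 8; 7; 6; 5; 9]))))))));
(([:: (0, 1); (0, 2); (0, 3); (1, 4); (4, 5); (4, 8); (5, 6); (6, 7); (7, 8)], [:: (0, 4); (0, 5); (0, 6); (0, 7); (0, 8); (0, 9); (1, 2); (1, 3); (2, 3); (4, 6); (4, 7); (4, 9); (5, 7); (5, 8); (5, 9); (6, 8); (6, 9); (7, 9); (8, 9)]),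
 Fork 2 4
(Cite 80 [:: 4; 1; 2; 5; 8; 0; 6; 7; 9; 3])
(Cite 0 [:: 0; 1; 2; 3; 4; 5; 6; 7; 8; 9]));
(([:: (0, 1); (0, 2); (0, 3); (1, 6); (4, 5); (4, 8); (5, 6); (6, 7)], [:: (0, 4); (2, 4); (3, 4); (4, 9); (5, 9); (6, 8); (6, 9); (7, 8); (7, 9); (8, 9)]),
 Play 9 6 [:: Trap 0 9 [:: 9]; Go 1 5 0 4; Go 0 5 0 4; Go 1 6 0 5; Go 0 6 0 5; Go 1 6 0 6; Go 1 5 0 6; Go 6 5 1 6; Go 6 5 1 5; Trap 6 5 [:: 0; 2; 3; 4; 8; 9]]);
(([:: (0, 1); (0, 2); (0, 3); (4, 5); (4, 7); (4, 8); (5, 6); (6, 7)], [:: (0, 4); (0, 6); (4, 6); (4, 9); (5, 9); (6, 8); (6, 9); (7, 8); (7, 9); (8, 9)]),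
 Fork 1 4
(Cite 81 [:: 4; 1; 5; 7; 8; 0; 6; 9; 2; 3])
(Fork 2 4
(Cite 82 [:: 4; 2; 5; 7; 8; 0; 1; 6; 9; 3])
(Fork 3 4
(Cite 85 [:: 4; 3; 5; 7; 8; 0; 1; 6; 9; 2])
(Fork 1 6
(Cite 0 [:: 0; 1; 2; 3; 4; 5; 6; 7; 8; 9])
(Fork 2 6
(Cite 0 [:: 0; 2; 1; 3; 4; 5; 6; 7; 8; 9])
(Cite 15 [:: 0; 1; 2; 3; 4; 5; 7; 6; 8; 9]))))));
(([:: (0, 1); (0, 2); (0, 3); (4, 5); (4, 8); (5, 6); (6, 7)], [:: (0, 4); (0, 6); (4, 9); (5, 9); (6, 9); (7, 8); (7, 9); (8, 9)]),
 Fork 4 6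
(Play 9 6 [:: Trap 0 9 [:: 9]; Go 0 6 0 4; Trap 6 0 [:: 0; 1; 2; 3; 8; 9]])
(Fork 4 7
(Fork 6 8
(Cite 18 [:: 0; 1; 2; 3; 4; 5; 7; 6; 8; 9])
(Cite 0 [:: 0; 1; 2; 3; 4; 5; 6; 7; 8; 9]))
(Fork 6 8
(Cite 0 [:: 0; 1; 2; 3; 6; 5; 4; 8; 7; 9])
(Play 9 5 [:: Trap 0 9 [:: 9]; Go 0 5 0 4; Go 0 5 0 6; Trap 5 0 [:: 0; 1; 2; 3; 7; 8; 9]]))));
(([:: (0, 1); (0, 2); (0, 3); (4, 5); (4, 8); (5, 6); (6, 7)], [:: (0, 4); (0, 5); (0, 6); (0, 7); (0, 8); (0, 9); (4, 9); (5, 9); (6, 9); (7, 9); (8, 9)]),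
 (* The pair 7 8 closes the path 8, 4, 5, 6, 7 to a pentagon, while 9 can be adjacent only to 1, 2
    and 3. *)
 Fork 7 8
(Fork 4 6
(Fork 4 7
(Cite 191 [:: 4; 1; 5; 6; 7; 8; 0; 2; 3; 9])
(Cite 14 [:: 0; 1; 2; 3; 4; 5; 6; 7; 8; 9]))
(Fork 4 7
(Cite 14 [:: 0; 1; 2; 3; 4; 8; 7; 6; 5; 9])
(Fork 5 7
(Cite 14 [:: 0; 1; 2; 3; 7; 6; 5; 4; 8; 9])
(Fork 5 8
(Cite 15 [:: 0; 1; 2; 3; 8; 4; 5; 6; 7; 9])
(Fork 6 8
(Cite 15 [:: 0; 1; 2; 3; 8; 7; 6; 5; 4; 9])
(Fork 1 2
(Cite 9 [:: 0; 1; 2; 3; 4; 5; 6; 7; 8; 9])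
(Fork 1 3
(Cite 9 [:: 0; 1; 3; 2; 4; 5; 6; 7; 8; 9])
(Fork 2 3
(Cite 9 [:: 0; 2; 3; 1; 4; 5; 6; 7; 8; 9])
(Fork 1 4
(Cite 3 [:: 0; 1; 2; 3; 4; 5; 6; 7; 8; 9])
(Fork 1 5
(Cite 3 [:: 0; 1; 2; 3; 5; 4; 8; 7; 6; 9])
(Fork 1 6
(Cite 3 [:: 0; 1; 2; 3; 6; 5; 4; 8; 7; 9])
(Fork 1 7
(Cite 3 [:: 0; 1; 2; 3; 7; 6; 5; 4; 8; 9])
(Fork 1 8
(Cite 3 [:: 0; 1; 2; 3; 8; 4; 5; 6; 7; 9])
(Fork 2 4
(Cite 4 [:: 0; 2; 1; 3; 4; 5; 6; 7; 8; 9])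
(Fork 2 5
(Cite 4 [:: 0; 2; 1; 3; 5; 4; 8; 7; 6; 9])
(Fork 2 6
(Cite 4 [:: 0; 2; 1; 3; 6; 5; 4; 8; 7; 9])
(Fork 2 7
(Cite 4 [:: 0; 2; 1; 3; 7; 6; 5; 4; 8; 9])
(Fork 2 8
(Cite 4 [:: 0; 2; 1; 3; 8; 4; 5; 6; 7; 9])
(Fork 3 4
(Cite 59 [:: 4; 5; 8; 3; 9; 1; 2; 0; 6; 7])
(Fork 3 5
(Cite 59 [:: 5; 4; 6; 3; 9; 1; 2; 0; 7; 8])
(Cite 10 [:: 0; 1; 2; 3; 4; 5; 6; 7; 8; 9])))))))))))))))))))))
(Cite 0 [:: 0; 1; 2; 3; 4; 5; 6; 7; 8; 9]));
(([:: (0, 1); (0, 2); (0, 3); (4, 5); (4, 6); (4, 8); (6, 7)], [:: (4, 9); (5, 7); (5, 9); (6, 9); (7, 8); (7, 9); (8, 9)]),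
 Play 9 6 [:: Trap 0 9 [:: 9]; Go 0 6 0 4; Trap 6 0 [:: 0; 1; 2; 3; 5; 8; 9]]);
(([:: (0, 1); (0, 2); (0, 3); (4, 5); (4, 8); (6, 7)], [:: (0, 4); (0, 6); (0, 7); (4, 9); (5, 6); (5, 7); (5, 9); (6, 9); (7, 9); (8, 9)]),
 Fork 6 8
(Cite 2 [:: 0; 1; 2; 3; 4; 8; 6; 7; 5; 9])
(Fork 7 8
(Cite 2 [:: 0; 1; 2; 3; 4; 8; 7; 6; 5; 9])
(Fork 4 6
(Cite 0 [:: 0; 1; 2; 3; 4; 5; 6; 7; 8; 9])
(Fork 4 7
(Cite 0 [:: 0; 1; 2; 3; 4; 5; 7; 6; 8; 9])
(Play 9 0 [:: Trap 0 4 [:: 4; 5; 8]; Trap 0 6 [:: 6; 7]])))));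
(([:: (0, 1); (0, 2); (0, 3); (4, 5); (4, 8); (6, 7)], [:: (0, 4); (0, 5); (0, 6); (0, 7); (0, 8); (0, 9); (5, 9); (6, 9); (8, 9)]),
 Fork 7 9
(Cite 24 [:: 0; 1; 2; 3; 4; 5; 7; 6; 8; 9])
(Fork 4 9
(Fork 4 6
(Cite 84 [:: 4; 5; 6; 8; 9; 0; 1; 2; 3; 7])
(Fork 4 7
(Cite 85 [:: 4; 5; 7; 8; 9; 0; 6; 1; 2; 3])
(Fork 5 6
(Cite 24 [:: 0; 1; 2; 3; 6; 5; 4; 8; 7; 9])
(Fork 5 7
(Cite 24 [:: 0; 1; 2; 3; 7; 5; 4; 8; 6; 9])
(Fork 6 8
(Cite 27 [:: 0; 1; 2; 3; 4; 5; 6; 8; 9; 7])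
(Fork 7 8
(Cite 27 [:: 0; 1; 2; 3; 4; 5; 7; 8; 9; 6])
(Cite 83 [:: 4; 5; 8; 9; 6; 7; 1; 2; 3; 0])))))))
(Fork 5 6
(Cite 2 [:: 0; 1; 2; 3; 4; 5; 6; 7; 8; 9])
(Fork 5 7
(Cite 2 [:: 0; 1; 2; 3; 4; 5; 7; 6; 8; 9])
(Cite 0 [:: 0; 1; 2; 3; 4; 5; 6; 7; 8; 9])))));
(([:: (0, 1); (0, 2); (0, 3); (4, 5); (4, 8); (6, 7)], [:: (0, 4); (0, 5); (0, 6); (0, 7); (0, 8); (0, 9); (5, 9); (8, 9)]),
 Fork 6 9
(Cite 25 [:: 0; 1; 2; 3; 4; 5; 6; 7; 8; 9])
(Cite 0 [:: 0; 1; 2; 3; 4; 5; 6; 7; 8; 9]));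
(([:: (0, 1); (0, 2); (0, 3); (4, 5); (4, 8); (6, 7)], [:: (0, 4); (0, 5); (0, 6); (0, 7); (0, 8); (0, 9); (8, 9)]),
 Fork 5 9
(Cite 34 [:: 0; 1; 2; 3; 4; 8; 5; 9; 6; 7])
(Cite 0 [:: 0; 1; 2; 3; 4; 5; 6; 7; 8; 9]));
(([:: (0, 1); (0, 2); (0, 3); (4, 5); (4, 6); (6, 7)], [:: (4, 8); (4, 9); (5, 7); (5, 8); (5, 9); (6, 8); (6, 9); (7, 8); (7, 9); (8, 9)]),
 Play 9 6 [:: Trap 0 8 [:: 8]; Trap 0 9 [:: 9]; Go 0 6 0 4; Trap 6 0 [:: 0; 1; 2; 3; 5; 8; 9]]);
(([:: (0, 1); (0, 2); (0, 3); (1, 4); (5, 7); (6, 7)], [:: (2, 4); (3, 4); (4, 8); (4, 9); (5, 8); (5, 9); (6, 8); (6, 9); (7, 8); (7, 9); (8, 9)]),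
 Play 9 7 [:: Trap 0 8 [:: 8]; Trap 0 9 [:: 9]; Go 0 7 1 7; Trap 7 0 [:: 0; 1; 2; 3; 4; 8; 9]]);
(([:: (0, 1); (0, 2); (0, 3); (1, 4); (4, 5); (4, 6); (5, 7); (6, 7)], [:: (0, 4); (0, 7); (2, 4); (4, 7); (4, 8); (4, 9); (5, 8); (5, 9); (6, 8); (6, 9); (7, 8); (7, 9); (8, 9)]),
 Fork 3 4
(Cite 97 [:: 4; 1; 3; 5; 6; 0; 2; 7; 8; 9])
(Cite 0 [:: 0; 1; 2; 3; 4; 5; 6; 7; 8; 9]));
(([:: (0, 1); (0, 2); (0, 3); (4, 5); (4, 6); (6, 7)], [:: (0, 4); (0, 7); (4, 7); (4, 8); (4, 9); (5, 8); (5, 9); (6, 8); (6, 9); (7, 8); (7, 9); (8, 9)]),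
 Fork 5 7
(Fork 1 4
(Fork 2 4
(Cite 93 [:: 4; 1; 2; 5; 6; 0; 7; 8; 9; 3])
(Cite 0 [:: 0; 1; 2; 3; 4; 5; 6; 7; 8; 9]))
(Fork 2 4
(Cite 0 [:: 0; 2; 1; 3; 4; 5; 6; 7; 8; 9])
(Fork 3 4
(Cite 1 [:: 0; 3; 1; 2; 4; 5; 6; 7; 8; 9])
(Play 7 0 [:: Trap 0 8 [:: 8]; Trap 0 9 [:: 9]; Trap 7 4 [:: 4]]))))
(Cite 2 [:: 0; 1; 2; 3; 4; 5; 6; 7; 8; 9]));
(([:: (0, 1); (0, 2); (0, 3); (4, 5); (6, 7)], [:: (0, 4); (0, 5); (0, 6); (0, 7); (0, 8); (0, 9); (4, 8); (4, 9); (5, 8); (5, 9); (6, 8); (8, 9)]),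
 Fork 7 8
(Cite 4 [:: 0; 1; 2; 3; 7; 6; 4; 5; 8; 9])
(Fork 6 9
(Cite 7 [:: 0; 1; 2; 3; 6; 9; 4; 5; 7; 8])
(Fork 7 9
(Cite 7 [:: 0; 1; 2; 3; 7; 9; 4; 5; 6; 8])
(Fork 4 6
(Fork 4 7
(Cite 85 [:: 4; 5; 6; 7; 8; 1; 2; 9; 3; 0])
(Cite 0 [:: 0; 1; 2; 3; 4; 5; 6; 7; 8; 9]))
(Fork 4 7
(Cite 0 [:: 0; 1; 2; 3; 4; 5; 7; 6; 8; 9])
(Fork 5 6
(Cite 3 [:: 0; 1; 2; 3; 5; 4; 6; 7; 8; 9])
(Fork 5 7
(Cite 3 [:: 0; 1; 2; 3; 5; 4; 7; 6; 8; 9])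
(Play 9 0 [:: Trap 0 4 [:: 4; 5]; Trap 0 6 [:: 6; 7]; Trap 0 8 [:: 8]]))))))));
(([:: (0, 1); (0, 2); (0, 3); (4, 5); (6, 7)], [:: (0, 4); (0, 5); (0, 6); (0, 7); (0, 8); (0, 9); (4, 8); (4, 9); (5, 8); (5, 9); (8, 9)]),
 Fork 6 8
(Cite 5 [:: 0; 1; 2; 3; 6; 7; 4; 5; 8; 9])
(Cite 0 [:: 0; 1; 2; 3; 4; 5; 6; 7; 8; 9]));
(([:: (0, 1); (0, 2); (0, 3); (4, 5); (6, 7)], [:: (0, 4); (0, 5); (0, 6); (0, 7); (0, 8); (0, 9); (4, 8); (4, 9); (5, 8); (8, 9)]),
 Fork 5 9
(Cite 7 [:: 0; 1; 2; 3; 5; 4; 6; 7; 9; 8])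
(Cite 0 [:: 0; 1; 2; 3; 4; 5; 6; 7; 8; 9]));
(([:: (0, 1); (0, 2); (0, 3); (4, 5); (6, 7)], [:: (0, 4); (0, 5); (0, 6); (0, 7); (0, 8); (0, 9); (4, 8); (4, 9); (8, 9)]),
 Fork 5 8
(Cite 8 [:: 0; 1; 2; 3; 5; 4; 6; 7; 8; 9])
(Cite 0 [:: 0; 1; 2; 3; 4; 5; 6; 7; 8; 9]));
(([:: (0, 1); (0, 2); (0, 3); (4, 5); (6, 7)], [:: (0, 4); (0, 5); (0, 6); (0, 7); (0, 8); (0, 9); (4, 8); (8, 9)]),
 Fork 4 9
(Cite 8 [:: 0; 1; 2; 3; 4; 5; 6; 7; 9; 8])
(Cite 0 [:: 0; 1; 2; 3; 4; 5; 6; 7; 8; 9]));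
(([:: (0, 1); (0, 2); (0, 3); (4, 5); (6, 7)], [:: (0, 4); (0, 5); (0, 6); (0, 7); (0, 8); (0, 9)]),
 Fork 8 9
(Fork 4 6
(Cite 43 [:: 0; 1; 2; 3; 4; 5; 6; 7; 8; 9])
(Fork 4 7
(Cite 43 [:: 0; 1; 2; 3; 4; 5; 7; 6; 8; 9])
(Fork 4 8
(Cite 43 [:: 0; 1; 2; 3; 4; 5; 8; 9; 6; 7])
(Fork 4 9
(Cite 43 [:: 0; 1; 2; 3; 4; 5; 9; 8; 6; 7])
(Fork 6 8
(Cite 43 [:: 0; 1; 2; 3; 6; 7; 8; 9; 4; 5])
(Fork 6 9
(Cite 43 [:: 0; 1; 2; 3; 6; 7; 9; 8; 4; 5])
(Cite 42 [:: 0; 1; 2; 3; 4; 5; 6; 7; 8; 9])))))))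
(Fork 4 8
(Cite 9 [:: 0; 1; 2; 3; 4; 5; 6; 7; 8; 9])
(Cite 0 [:: 0; 1; 2; 3; 4; 5; 6; 7; 8; 9])));
(([:: (0, 1); (0, 2); (0, 3); (4, 5); (4, 6); (4, 7)], [:: (4, 8); (5, 8); (5, 9); (6, 8); (6, 9); (7, 8); (7, 9); (8, 9)]),
 Fork 4 9
(Cite 207 [:: 4; 1; 5; 6; 7; 9; 0; 2; 3; 8])
(Cite 91 [:: 4; 5; 6; 7; 8; 1; 2; 9; 3; 0]));
(([:: (0, 1); (0, 2); (0, 3); (4, 5); (4, 6)], [:: (4, 7); (4, 8); (4, 9); (5, 7); (5, 8); (5, 9); (6, 7); (6, 8); (6, 9); (7, 8); (7, 9); (8, 9)]),
 Play 9 0 [:: Trap 0 4 [:: 4; 5; 6]; Trap 0 7 [:: 7]; Trap 0 8 [:: 8]]);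
(([:: (0, 1); (0, 2); (0, 3); (4, 5); (4, 6)], [:: (0, 4); (0, 5); (0, 6); (0, 7); (0, 8); (0, 9); (5, 7); (5, 8); (6, 7); (6, 8); (6, 9); (7, 8); (7, 9); (8, 9)]),
 Fork 5 9
(Cite 7 [:: 0; 1; 2; 3; 5; 9; 6; 4; 7; 8])
(Fork 4 7
(Fork 4 8
(Cite 99 [:: 4; 5; 6; 7; 8; 0; 1; 2; 3; 9])
(Cite 1 [:: 0; 1; 2; 3; 4; 5; 6; 7; 8; 9]))
(Fork 4 8
(Cite 1 [:: 0; 1; 2; 3; 4; 5; 6; 8; 7; 9])
(Fork 4 9
(Cite 93 [:: 4; 5; 6; 9; 7; 1; 2; 8; 3; 0])
(Cite 0 [:: 0; 1; 2; 3; 4; 5; 6; 7; 8; 9])))));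
(([:: (0, 1); (0, 2); (0, 3); (4, 5); (4, 6)], [:: (0, 4); (0, 5); (0, 6); (0, 7); (0, 8); (0, 9); (5, 7); (6, 7); (6, 8); (6, 9); (7, 8); (7, 9); (8, 9)]),
 Fork 5 8
(Cite 6 [:: 0; 1; 2; 3; 8; 5; 4; 6; 7; 9])
(Cite 0 [:: 0; 1; 2; 3; 4; 5; 6; 7; 8; 9]));
(([:: (0, 1); (0, 2); (0, 3); (4, 5); (4, 6)], [:: (0, 4); (0, 5); (0, 6); (0, 7); (0, 8); (0, 9); (6, 7); (6, 8); (6, 9); (7, 8); (7, 9); (8, 9)]),
 Fork 5 7
(Cite 6 [:: 0; 1; 2; 3; 6; 4; 5; 7; 8; 9])
(Cite 0 [:: 0; 1; 2; 3; 4; 5; 6; 7; 8; 9]));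
(([:: (0, 1); (0, 2); (0, 3); (4, 5)], [:: (4, 6); (4, 7); (4, 8); (4, 9); (5, 6); (5, 7); (5, 8); (5, 9); (6, 7); (6, 8); (6, 9); (7, 8); (7, 9); (8, 9)]),
 Play 9 0 [:: Trap 0 4 [:: 4; 5]; Trap 0 6 [:: 6]; Trap 0 7 [:: 7]; Trap 0 8 [:: 8]]);
(([:: (0, 1); (0, 2); (0, 3); (4, 5)], [:: (4, 6); (4, 7); (4, 8); (4, 9); (5, 6); (5, 7); (5, 8); (6, 7); (6, 8); (6, 9); (7, 8); (7, 9); (8, 9)]),
 Fork 5 9
(Cite 4 [:: 0; 1; 2; 3; 5; 4; 9; 6; 7; 8])
(Cite 0 [:: 0; 1; 2; 3; 4; 5; 6; 7; 8; 9]));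
(([:: (0, 1); (0, 2); (0, 3); (4, 5)], [:: (4, 6); (4, 7); (4, 8); (5, 6); (5, 7); (5, 8); (6, 7); (6, 8); (6, 9); (7, 8); (7, 9); (8, 9)]),
 Fork 4 9
(Cite 5 [:: 0; 1; 2; 3; 4; 5; 9; 6; 7; 8])
(Cite 0 [:: 0; 1; 2; 3; 4; 5; 6; 7; 8; 9]));
(([:: (0, 1); (0, 2); (0, 3); (4, 5)], [:: (0, 4); (0, 5); (0, 6); (0, 7); (0, 8); (0, 9); (4, 6); (6, 7); (6, 8); (6, 9); (7, 8); (7, 9); (8, 9)]),
 Fork 5 6
(Cite 3 [:: 0; 1; 2; 3; 5; 4; 6; 7; 8; 9])
(Fork 4 7
(Cite 4 [:: 0; 1; 2; 3; 4; 5; 7; 6; 8; 9])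
(Fork 5 7
(Cite 4 [:: 0; 1; 2; 3; 5; 4; 7; 6; 8; 9])
(Fork 4 8
(Cite 5 [:: 0; 1; 2; 3; 4; 5; 8; 6; 7; 9])
(Fork 5 8
(Cite 5 [:: 0; 1; 2; 3; 5; 4; 8; 6; 7; 9])
(Cite 0 [:: 0; 1; 2; 3; 4; 5; 6; 7; 8; 9]))))));
(([:: (0, 1); (0, 2); (0, 3); (4, 5)], [:: (0, 4); (0, 5); (0, 6); (0, 7); (0, 8); (0, 9); (6, 7); (6, 8); (6, 9); (7, 8); (7, 9)]),
 Fork 8 9
(Cite 13 [:: 0; 1; 2; 3; 8; 9; 4; 5; 6; 7])
(Fork 4 6
(Cite 4 [:: 0; 1; 2; 3; 4; 5; 6; 7; 8; 9])
(Cite 0 [:: 0; 1; 2; 3; 4; 5; 6; 7; 8; 9])));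
(([:: (0, 1); (0, 2); (0, 3); (4, 5)], [:: (0, 4); (0, 5); (0, 6); (0, 7); (0, 8); (0, 9); (6, 7); (6, 8); (6, 9)]),
 Fork 7 8
(Cite 11 [:: 0; 1; 2; 3; 7; 8; 4; 5; 6; 9])
(Fork 7 9
(Cite 13 [:: 0; 1; 2; 3; 7; 9; 4; 5; 6; 8])
(Cite 0 [:: 0; 1; 2; 3; 4; 5; 6; 7; 8; 9])));
(([:: (0, 1); (0, 2); (0, 3); (4, 5)], [:: (0, 4); (0, 5); (0, 6); (0, 7); (0, 8); (0, 9)]),
 Fork 6 7
(Cite 11 [:: 0; 1; 2; 3; 4; 5; 6; 7; 8; 9])
(Fork 6 8
(Cite 11 [:: 0; 1; 2; 3; 4; 5; 6; 8; 7; 9])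
(Fork 6 9
(Cite 11 [:: 0; 1; 2; 3; 4; 5; 6; 9; 7; 8])
(Cite 0 [:: 0; 1; 2; 3; 4; 5; 6; 7; 8; 9]))));
(([:: (0, 1); (0, 2); (0, 3)], [:: (0, 4); (0, 5); (0, 6); (0, 7); (0, 8); (0, 9)]),
 Fork 4 5
(Cite 0 [:: 0; 1; 2; 3; 4; 5; 6; 7; 8; 9])
(Fork 4 6
(Cite 0 [:: 0; 1; 2; 3; 4; 6; 5; 7; 8; 9])
(Fork 4 7
(Cite 0 [:: 0; 1; 2; 3; 4; 7; 5; 6; 8; 9])
(Fork 4 8
(Cite 0 [:: 0; 1; 2; 3; 4; 8; 5; 6; 7; 9])
(Fork 4 9
(Cite 0 [:: 0; 1; 2; 3; 4; 9; 5; 6; 7; 8])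
(Fork 5 6
(Cite 1 [:: 0; 1; 2; 3; 5; 6; 4; 7; 8; 9])
(Fork 5 7
(Cite 1 [:: 0; 1; 2; 3; 5; 7; 4; 6; 8; 9])
(Fork 5 8
(Cite 1 [:: 0; 1; 2; 3; 5; 8; 4; 6; 7; 9])
(Fork 5 9
(Cite 1 [:: 0; 1; 2; 3; 5; 9; 4; 6; 7; 8])
(Fork 6 7
(Cite 2 [:: 0; 1; 2; 3; 6; 7; 4; 5; 8; 9])
(Fork 6 8
(Cite 2 [:: 0; 1; 2; 3; 6; 8; 4; 5; 7; 9])
(Fork 6 9
(Cite 2 [:: 0; 1; 2; 3; 6; 9; 4; 5; 7; 8])
(Fork 7 8
(Cite 4 [:: 0; 1; 2; 3; 7; 8; 4; 5; 6; 9])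
(Fork 7 9
(Cite 5 [:: 0; 1; 2; 3; 7; 9; 4; 5; 6; 8])
(Fork 8 9
(Cite 6 [:: 0; 1; 2; 3; 8; 9; 4; 5; 6; 7])
(Play 9 0 [:: Trap 0 4 [:: 4]; Trap 0 5 [:: 5]; Trap 0 6 [:: 6]; Trap 0 7 [:: 7]; Trap 0 8 [:: 8]]))))))))))))))));
(([:: (0, 1); (0, 2); (0, 3)], [:: (0, 4); (0, 5); (0, 6); (0, 7); (0, 8)]),
 Fork 0 9
(Cite 114 [:: 0; 1; 2; 3; 9; 4; 5; 6; 7; 8])
(Cite 0 [:: 0; 1; 2; 3; 4; 5; 6; 7; 8; 9]));
(([:: (0, 1); (0, 2); (0, 3)], [:: (0, 4); (0, 5); (0, 6); (0, 7)]),
 Fork 0 8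
(Cite 114 [:: 0; 1; 2; 3; 8; 4; 5; 6; 7; 9])
(Cite 0 [:: 0; 1; 2; 3; 4; 5; 6; 7; 8; 9]));
(([:: (0, 1); (0, 2); (0, 3)], [:: (0, 4); (0, 5); (0, 6)]),
 Fork 0 7
(Cite 114 [:: 0; 1; 2; 3; 7; 4; 5; 6; 8; 9])
(Cite 0 [:: 0; 1; 2; 3; 4; 5; 6; 7; 8; 9]));
(([:: (0, 1); (0, 2); (0, 3)], [:: (0, 4); (0, 5)]),
 Fork 0 6
(Cite 114 [:: 0; 1; 2; 3; 6; 4; 5; 7; 8; 9])
(Cite 0 [:: 0; 1; 2; 3; 4; 5; 6; 7; 8; 9]));
(([:: (0, 1); (0, 2); (0, 3)], [:: (0, 4)]),
 Fork 0 5
(Cite 114 [:: 0; 1; 2; 3; 5; 4; 6; 7; 8; 9])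
(Cite 0 [:: 0; 1; 2; 3; 4; 5; 6; 7; 8; 9]));

(* Certificate: degree 2 *)
(([:: (0, 1); (0, 2); (3, 4); (3, 9); (4, 6); (5, 6); (5, 7); (7, 8)], [:: (0, 3); (0, 4); (0, 5); (0, 6); (0, 7); (0, 8); (3, 5); (3, 6); (3, 7); (3, 8); (4, 5); (4, 7); (4, 8); (5, 8); (5, 9); (6, 7); (7, 9)]),
 Fork 4 9
(* Label 4 would have the third neighbour 9, which is excluded by a clause of degree 3. With third
   neighbours closed off in this way, essentially paths and cycles remain. *)
(Cite 3 [:: 4; 3; 6; 9; 0; 5; 7; 8; 1; 2])
(Fork 6 8
(Cite 2 [:: 6; 4; 5; 8; 0; 3; 7; 1; 2; 9])
(Fork 6 9
(Cite 3 [:: 6; 4; 5; 9; 0; 3; 7; 8; 1; 2])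
(Fork 8 9
(Fork 1 3
(Cite 4 [:: 3; 1; 4; 9; 0; 5; 6; 7; 8; 2])
(Fork 2 3
(Cite 64 [:: 3; 2; 4; 9; 5; 6; 7; 8; 0; 1])
(Fork 1 4
(Cite 4 [:: 4; 1; 3; 6; 0; 5; 7; 8; 9; 2])
(Fork 2 4
(Cite 64 [:: 4; 2; 3; 6; 7; 5; 8; 9; 0; 1])
(Fork 1 5
(Cite 4 [:: 5; 1; 6; 7; 0; 3; 4; 8; 9; 2])
(Fork 2 5
(Cite 66 [:: 5; 2; 6; 7; 3; 4; 9; 8; 0; 1])
(Fork 1 6
(Cite 4 [:: 6; 1; 4; 5; 0; 3; 7; 8; 9; 2])
(Fork 2 6
(Cite 66 [:: 6; 2; 4; 5; 9; 3; 8; 7; 0; 1])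
(Play 9 9 [:: Trap 8 0 [:: 0; 1; 2]; Go 6 9 6 8; Trap 9 6 [:: 0; 1; 2; 4; 5; 6; 7]])))))))))
(Play 9 6 [:: Go 0 5 0 7; Go 0 4 0 3; Go 0 6 0 5; Go 0 6 0 4; Trap 6 0 [:: 0; 1; 2; 3; 7; 8; 9]])))));
(([:: (0, 1); (0, 2); (3, 4); (3, 9); (4, 6); (5, 6); (5, 7); (7, 8)], [:: (0, 3); (0, 4); (0, 5); (0, 6); (0, 7); (0, 8); (3, 5); (3, 6); (3, 7); (3, 8); (4, 5); (4, 7); (5, 8); (5, 9); (6, 7); (7, 9)]),
 Fork 4 8
(Cite 3 [:: 4; 3; 6; 8; 0; 5; 7; 1; 2; 9])
(Cite 0 [:: 0; 1; 2; 3; 4; 5; 6; 7; 8; 9]));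
(([:: (0, 1); (0, 2); (3, 9); (4, 9); (6, 8); (7, 8)], [:: (0, 5); (1, 5); (2, 5); (3, 5); (3, 6); (3, 7); (3, 8); (4, 5); (4, 6); (4, 7); (4, 8); (5, 9); (6, 9); (7, 9); (8, 9)]),
 Play 8 0 [:: Trap 0 9 [:: 3; 4; 9]; Trap 8 5 [:: 5]]);
(([:: (0, 1); (0, 2); (3, 4); (3, 9); (5, 6); (5, 7); (7, 8)], [:: (0, 3); (0, 4); (0, 5); (0, 6); (0, 7); (0, 8); (0, 9); (3, 5); (3, 6); (3, 7); (3, 8); (5, 8)]),
 Fork 4 5
(Cite 5 [:: 5; 4; 6; 7; 0; 3; 8; 1; 2; 9])
(Fork 5 9
(Cite 6 [:: 5; 6; 7; 9; 0; 3; 4; 8; 1; 2])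
(Fork 4 7
(Cite 4 [:: 7; 4; 5; 8; 0; 3; 1; 2; 6; 9])
(Fork 6 7
(Cite 5 [:: 7; 5; 6; 8; 0; 3; 4; 1; 2; 9])
(Fork 7 9
(Cite 6 [:: 7; 5; 8; 9; 0; 3; 4; 6; 1; 2])
(Fork 4 6
(Cite 1 [:: 0; 1; 2; 3; 4; 5; 6; 7; 8; 9])
(Fork 4 8
(Cite 2 [:: 0; 1; 2; 3; 4; 7; 8; 5; 6; 9])
(Fork 6 9
(Cite 1 [:: 0; 1; 2; 3; 9; 5; 6; 7; 8; 4])
(Fork 8 9
(Cite 2 [:: 0; 1; 2; 3; 9; 7; 8; 5; 6; 4])
(Fork 6 8
(Fork 1 5
(Cite 7 [:: 5; 1; 6; 7; 0; 3; 4; 8; 9; 2])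
(Fork 2 5
(Cite 33 [:: 5; 2; 6; 7; 3; 4; 0; 1; 9; 8])
(Cite 0 [:: 0; 1; 2; 4; 9; 5; 6; 7; 8; 3])))
(Play 9 7 [:: Trap 0 3 [:: 3; 4; 9]; Go 0 7 0 5; Trap 7 0 [:: 0; 1; 2; 3; 4; 6; 9]])))))))))));
(([:: (0, 1); (0, 2); (3, 4); (3, 9); (4, 5); (5, 6); (7, 8)], [:: (3, 6); (3, 7); (3, 8); (4, 7); (4, 8); (5, 7); (5, 8); (5, 9); (6, 7); (6, 8); (6, 9); (7, 9); (8, 9)]),
 Play 9 4 [:: Trap 0 7 [:: 7; 8]; Go 0 4 0 3; Go 0 4 0 5; Trap 4 0 [:: 0; 1; 2; 6; 7; 8; 9]]);
(([:: (0, 1); (0, 2); (3, 4); (3, 9); (4, 5); (5, 6); (7, 8)], [:: (0, 3); (0, 4); (0, 5); (0, 6); (0, 7); (0, 8); (0, 9); (3, 5); (3, 6); (3, 7); (3, 8); (4, 6); (4, 7); (4, 8); (5, 7); (5, 8); (6, 7); (6, 8)]),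
 Fork 4 9
(Cite 8 [:: 4; 3; 5; 9; 0; 6; 7; 8; 1; 2])
(Fork 5 9
(Cite 8 [:: 5; 4; 6; 9; 0; 3; 7; 8; 1; 2])
(Fork 7 9
(Cite 3 [:: 0; 1; 2; 7; 9; 4; 3; 5; 6; 8])
(Fork 8 9
(Cite 3 [:: 0; 1; 2; 8; 9; 4; 3; 5; 6; 7])
(Fork 6 9
(Fork 1 3
(Cite 9 [:: 3; 1; 4; 9; 0; 5; 6; 7; 8; 2])
(Fork 1 4
(Cite 9 [:: 4; 1; 3; 5; 0; 6; 7; 8; 9; 2])
(Fork 2 3
(Cite 66 [:: 3; 2; 4; 9; 0; 1; 5; 6; 7; 8])
(Fork 2 4
(Cite 66 [:: 4; 2; 3; 5; 0; 1; 6; 9; 7; 8])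
(Play 6 0 [:: Trap 0 7 [:: 7; 8]; Trap 6 3 [:: 3; 4]])))))
(Cite 0 [:: 0; 1; 2; 3; 4; 5; 6; 7; 8; 9]))))));
(([:: (0, 1); (0, 2); (3, 4); (3, 9); (4, 5); (5, 6); (7, 8)], [:: (0, 3); (0, 4); (0, 5); (0, 6); (0, 7); (0, 8); (0, 9); (3, 5); (3, 6); (3, 7); (3, 8); (4, 6); (5, 7); (5, 8); (6, 7); (6, 8)]),
 Fork 4 7
(Cite 7 [:: 4; 3; 5; 7; 0; 6; 1; 2; 8; 9])
(Fork 4 8
(Cite 8 [:: 4; 3; 5; 8; 0; 6; 7; 1; 2; 9])
(Cite 0 [:: 0; 1; 2; 3; 4; 5; 6; 7; 8; 9])));
(([:: (0, 1); (0, 2); (3, 4); (3, 9); (4, 5); (5, 6); (7, 8)], [:: (0, 3); (0, 4); (0, 5); (0, 6); (0, 7); (0, 8); (0, 9); (3, 5); (3, 6); (3, 7); (3, 8); (5, 7); (5, 8); (6, 7); (6, 8)]),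
 Fork 4 6
(Cite 7 [:: 4; 3; 5; 6; 0; 1; 2; 7; 8; 9])
(Cite 0 [:: 0; 1; 2; 3; 4; 5; 6; 7; 8; 9]));
(([:: (0, 1); (0, 2); (3, 4); (3, 9); (5, 6); (7, 8)], [:: (0, 3); (0, 4); (0, 5); (0, 6); (0, 7); (0, 8); (0, 9)]),
 Fork 3 5
(Cite 8 [:: 3; 4; 5; 9; 0; 1; 2; 6; 7; 8])
(Fork 3 6
(Cite 9 [:: 3; 4; 6; 9; 0; 5; 1; 2; 7; 8])
(Fork 3 7
(Cite 10 [:: 3; 4; 7; 9; 0; 5; 6; 1; 2; 8])
(Fork 3 8
(Cite 11 [:: 3; 4; 8; 9; 0; 5; 6; 7; 1; 2])
(Fork 5 7
(Fork 5 8
(Cite 9 [:: 5; 6; 7; 8; 0; 3; 1; 2; 4; 9])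
(Cite 4 [:: 0; 1; 2; 3; 4; 5; 6; 7; 8; 9]))
(Fork 5 8
(Cite 4 [:: 0; 1; 2; 3; 4; 5; 6; 8; 7; 9])
(Fork 6 7
(Cite 4 [:: 0; 1; 2; 3; 4; 7; 8; 6; 5; 9])
(Fork 6 8
(Cite 4 [:: 0; 1; 2; 3; 4; 6; 5; 8; 7; 9])
(Fork 4 5
(Cite 0 [:: 0; 1; 2; 3; 4; 5; 6; 7; 8; 9])
(Fork 4 6
(Cite 1 [:: 0; 1; 2; 3; 4; 6; 5; 7; 8; 9])
(Fork 4 7
(Cite 0 [:: 0; 1; 2; 3; 4; 7; 8; 5; 6; 9])
(Fork 4 8
(Cite 2 [:: 0; 1; 2; 3; 4; 8; 7; 5; 6; 9])
(Fork 5 9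
(Cite 0 [:: 0; 1; 2; 3; 9; 5; 6; 7; 8; 4])
(Fork 6 9
(Cite 1 [:: 0; 1; 2; 3; 9; 6; 5; 7; 8; 4])
(Fork 7 9
(Cite 3 [:: 0; 1; 2; 3; 9; 7; 8; 5; 6; 4])
(Fork 8 9
(Cite 3 [:: 0; 1; 2; 3; 9; 8; 7; 5; 6; 4])
(Play 9 0 [:: Trap 0 3 [:: 3; 4; 9]; Trap 0 5 [:: 5; 6]; Trap 0 7 [:: 7; 8]])))))))))))))))));
(([:: (0, 1); (0, 2); (3, 4); (3, 5); (4, 7); (5, 6); (7, 8)], [:: (3, 8); (3, 9); (4, 6); (4, 9); (5, 7); (5, 8); (5, 9); (6, 7); (6, 8); (6, 9); (7, 9); (8, 9)]),
 Play 9 4 [:: Trap 0 9 [:: 9]; Go 0 3 0 5; Go 0 4 0 7; Go 0 4 0 3; Trap 4 0 [:: 0; 1; 2; 5; 6; 8; 9]]);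
(([:: (0, 1); (0, 2); (3, 4); (3, 5); (4, 7); (5, 6); (7, 8)], [:: (0, 3); (0, 4); (0, 5); (0, 6); (0, 7); (0, 9); (3, 6); (3, 7); (3, 8); (3, 9); (4, 5); (4, 8); (4, 9); (5, 7); (5, 8); (5, 9); (6, 9); (7, 9); (8, 9)]),
 Fork 4 6
(Cite 13 [:: 4; 3; 6; 7; 0; 5; 8; 9; 1; 2])
(Fork 6 7
(Cite 13 [:: 7; 4; 6; 8; 0; 3; 5; 9; 1; 2])
(Fork 6 8
(Fork 1 3
(Cite 14 [:: 3; 1; 4; 5; 0; 6; 7; 8; 9; 2])
(Fork 2 3
(Cite 40 [:: 3; 2; 4; 5; 8; 6; 0; 1; 7; 9])
(Fork 1 4
(Cite 14 [:: 4; 1; 3; 7; 0; 5; 6; 8; 9; 2])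
(Fork 2 4
(Cite 40 [:: 4; 2; 3; 7; 6; 5; 0; 1; 8; 9])
(Fork 1 5
(Cite 14 [:: 5; 1; 3; 6; 0; 4; 7; 8; 9; 2])
(Fork 2 5
(Cite 51 [:: 0; 2; 4; 1; 5; 3; 6; 8; 7; 9])
(Cite 7 [:: 8; 6; 7; 4; 5; 9; 1; 2; 0; 3])))))))
(Cite 0 [:: 0; 1; 2; 3; 4; 5; 6; 7; 8; 9]))));
(([:: (0, 1); (0, 2); (3, 4); (3, 5); (4, 7); (5, 6); (7, 8)], [:: (0, 3); (0, 4); (0, 5); (0, 6); (0, 7); (0, 9); (3, 6); (3, 7); (3, 8); (3, 9); (4, 5); (4, 9); (5, 7); (5, 8); (5, 9); (6, 9); (7, 9); (8, 9)]),
 Fork 4 8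
(Cite 13 [:: 4; 3; 7; 8; 0; 5; 9; 1; 2; 6])
(Cite 0 [:: 0; 1; 2; 3; 4; 5; 6; 7; 8; 9]));
(([:: (0, 1); (0, 2); (3, 4); (3, 5); (5, 6); (7, 8)], [:: (3, 7); (3, 8); (3, 9); (4, 6); (4, 7); (4, 8); (4, 9); (5, 7); (5, 8); (5, 9); (6, 7); (6, 8); (6, 9); (7, 9); (8, 9)]),
 Play 9 5 [:: Trap 0 7 [:: 7; 8]; Trap 0 9 [:: 9]; Go 0 5 0 3; Trap 5 0 [:: 0; 1; 2; 4; 7; 8; 9]]);
(([:: (0, 1); (0, 2); (3, 4); (3, 5); (5, 6); (7, 8)], [:: (0, 3); (0, 4); (0, 5); (0, 6); (0, 7); (0, 8); (0, 9); (3, 6); (3, 7); (3, 8); (3, 9); (4, 9); (5, 7); (5, 8); (5, 9); (6, 9); (7, 9); (8, 9)]),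
 Fork 4 5
(Cite 16 [:: 5; 3; 4; 6; 0; 7; 8; 9; 1; 2])
(Fork 4 7
(Cite 1 [:: 0; 1; 2; 3; 4; 5; 6; 7; 8; 9])
(Fork 4 8
(Cite 2 [:: 0; 1; 2; 3; 4; 5; 6; 8; 7; 9])
(Fork 6 7
(Cite 1 [:: 0; 1; 2; 5; 6; 3; 4; 7; 8; 9])
(Fork 6 8
(Cite 2 [:: 0; 1; 2; 5; 6; 3; 4; 8; 7; 9])
(Fork 4 6
(Fork 1 3
(Cite 17 [:: 3; 1; 4; 5; 0; 6; 7; 8; 9; 2])
(Fork 2 3
(Cite 36 [:: 3; 2; 4; 5; 7; 8; 0; 1; 6; 9])
(Play 6 0 [:: Trap 0 7 [:: 7; 8]; Trap 0 9 [:: 9]; Trap 6 3 [:: 3]])))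
(Cite 0 [:: 0; 1; 2; 3; 4; 5; 6; 7; 8; 9])))))));
(([:: (0, 1); (0, 2); (3, 4); (3, 5); (5, 6); (7, 8)], [:: (0, 3); (0, 4); (0, 5); (0, 6); (0, 7); (0, 8); (0, 9); (3, 6); (3, 7); (3, 8); (3, 9); (4, 9); (5, 9); (6, 9); (7, 9); (8, 9)]),
 Fork 5 7
(Cite 15 [:: 5; 3; 6; 7; 0; 9; 1; 2; 4; 8])
(Fork 5 8
(Cite 16 [:: 5; 3; 6; 8; 0; 7; 9; 1; 2; 4])
(Cite 0 [:: 0; 1; 2; 3; 4; 5; 6; 7; 8; 9])));
(([:: (0, 1); (0, 2); (3, 4); (3, 5); (5, 6); (7, 8)], [:: (0, 3); (0, 4); (0, 5); (0, 6); (0, 7); (0, 8); (0, 9); (3, 6); (3, 7); (3, 9); (4, 9); (5, 9); (6, 9); (7, 9); (8, 9)]),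
 Fork 3 8
(Cite 18 [:: 3; 4; 5; 8; 0; 6; 7; 9; 1; 2])
(Cite 0 [:: 0; 1; 2; 3; 4; 5; 6; 7; 8; 9]));
(([:: (0, 1); (0, 2); (3, 4); (3, 5); (5, 6); (7, 8)], [:: (0, 3); (0, 4); (0, 5); (0, 6); (0, 7); (0, 8); (0, 9); (3, 6); (3, 9); (4, 9); (5, 9); (6, 9); (7, 9); (8, 9)]),
 Fork 3 7
(Cite 18 [:: 3; 4; 5; 7; 0; 6; 9; 1; 2; 8])
(Cite 0 [:: 0; 1; 2; 3; 4; 5; 6; 7; 8; 9]));
(([:: (0, 1); (0, 2); (3, 4); (3, 5); (5, 6); (7, 8)], [:: (0, 3); (0, 4); (0, 5); (0, 6); (0, 7); (0, 8); (0, 9); (3, 9); (4, 9); (5, 9); (6, 9); (7, 9); (8, 9)]),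
 Fork 3 6
(Cite 18 [:: 3; 4; 5; 6; 0; 9; 1; 2; 7; 8])
(Cite 0 [:: 0; 1; 2; 3; 4; 5; 6; 7; 8; 9]));
(([:: (0, 1); (0, 2); (3, 4); (5, 6); (7, 8)], [:: (0, 3); (0, 4); (0, 5); (0, 6); (0, 7); (0, 8); (0, 9); (3, 9); (4, 9); (5, 9); (6, 9)]),
 Fork 7 9
(Cite 9 [:: 0; 1; 2; 7; 8; 3; 4; 5; 6; 9])
(Fork 8 9
(Cite 9 [:: 0; 1; 2; 8; 7; 3; 4; 5; 6; 9])
(Fork 3 5
(Cite 0 [:: 0; 1; 2; 3; 4; 5; 6; 7; 8; 9])
(Fork 3 6
(Cite 1 [:: 0; 1; 2; 3; 4; 6; 5; 7; 8; 9])
(Fork 3 7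
(Cite 0 [:: 0; 1; 2; 3; 4; 7; 8; 5; 6; 9])
(Fork 3 8
(Cite 3 [:: 0; 1; 2; 3; 4; 8; 7; 5; 6; 9])
(Fork 5 7
(Cite 0 [:: 0; 1; 2; 5; 6; 7; 8; 3; 4; 9])
(Fork 5 8
(Cite 2 [:: 0; 1; 2; 5; 6; 8; 7; 3; 4; 9])
(Fork 4 5
(Cite 3 [:: 0; 1; 2; 5; 6; 4; 3; 7; 8; 9])
(Fork 4 7
(Cite 2 [:: 0; 1; 2; 7; 8; 4; 3; 5; 6; 9])
(Fork 4 8
(Cite 2 [:: 0; 1; 2; 4; 3; 8; 7; 5; 6; 9])
(Fork 4 6
(Cite 3 [:: 0; 1; 2; 4; 3; 6; 5; 7; 8; 9])
(Fork 6 7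
(Cite 5 [:: 0; 1; 2; 6; 5; 7; 8; 3; 4; 9])
(Fork 6 8
(Cite 5 [:: 0; 1; 2; 6; 5; 8; 7; 3; 4; 9])
(Play 9 0 [:: Trap 0 3 [:: 3; 4]; Trap 0 5 [:: 5; 6]; Trap 0 7 [:: 7; 8]])))))))))))))));
(([:: (0, 1); (0, 2); (3, 4); (5, 6); (7, 8)], [:: (0, 3); (0, 4); (0, 5); (0, 6); (0, 7); (0, 8); (0, 9); (3, 9); (4, 9); (5, 9)]),
 Fork 6 9
(Cite 10 [:: 0; 1; 2; 6; 5; 3; 4; 7; 8; 9])
(Cite 0 [:: 0; 1; 2; 3; 4; 5; 6; 7; 8; 9]));
(([:: (0, 1); (0, 2); (3, 4); (5, 6); (7, 8)], [:: (0, 3); (0, 4); (0, 5); (0, 6); (0, 7); (0, 8); (0, 9); (3, 9); (4, 9)]),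
 Fork 5 9
(Cite 11 [:: 0; 1; 2; 5; 6; 3; 4; 7; 8; 9])
(Cite 0 [:: 0; 1; 2; 3; 4; 5; 6; 7; 8; 9]));
(([:: (0, 1); (0, 2); (3, 4); (5, 6); (7, 8)], [:: (0, 3); (0, 4); (0, 5); (0, 6); (0, 7); (0, 8); (0, 9); (3, 9)]),
 Fork 4 9
(Cite 12 [:: 0; 1; 2; 4; 3; 5; 6; 7; 8; 9])
(Cite 0 [:: 0; 1; 2; 3; 4; 5; 6; 7; 8; 9]));
(([:: (0, 1); (0, 2); (3, 4); (3, 7); (5, 6); (5, 8)], [:: (0, 3); (0, 4); (0, 5); (0, 6); (0, 7); (0, 8); (0, 9); (3, 5); (3, 6); (3, 8); (3, 9); (4, 8); (4, 9); (5, 9); (6, 9); (7, 8); (7, 9); (8, 9)]),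
 Fork 4 5
(Cite 24 [:: 5; 4; 6; 8; 0; 3; 9; 1; 2; 7])
(Fork 4 6
(Cite 8 [:: 0; 1; 2; 3; 7; 4; 6; 5; 8; 9])
(Fork 6 7
(Cite 12 [:: 0; 1; 2; 7; 6; 3; 4; 5; 8; 9])
(Fork 5 7
(Cite 25 [:: 5; 6; 7; 8; 0; 3; 4; 9; 1; 2])
(Play 9 0 [:: Trap 0 3 [:: 3; 4; 7]; Trap 0 5 [:: 5; 6; 8]])))));
(([:: (0, 1); (0, 2); (3, 4); (3, 7); (5, 6); (5, 8)], [:: (0, 3); (0, 4); (0, 5); (0, 6); (0, 7); (0, 8); (0, 9); (3, 5); (3, 6); (3, 8); (3, 9); (4, 8); (4, 9); (7, 8); (7, 9); (8, 9)]),
 Fork 5 9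
(Cite 24 [:: 5; 6; 8; 9; 0; 3; 1; 2; 4; 7])
(Fork 6 9
(Cite 19 [:: 0; 1; 2; 3; 4; 5; 8; 6; 9; 7])
(Cite 0 [:: 0; 1; 2; 3; 4; 5; 6; 7; 8; 9])));
(([:: (0, 1); (0, 2); (3, 4); (3, 7); (4, 5); (5, 6)], [:: (3, 6); (3, 8); (3, 9); (4, 8); (4, 9); (5, 7); (5, 8); (5, 9); (6, 7); (6, 8); (6, 9); (7, 8); (7, 9); (8, 9)]),
 Play 9 4 [:: Trap 0 8 [:: 8]; Trap 0 9 [:: 9]; Go 0 4 0 5; Go 0 4 0 3; Trap 4 0 [:: 0; 1; 2; 6; 7; 8; 9]]);
(([:: (0, 1); (0, 2); (3, 4); (3, 7); (4, 5); (5, 6)], [:: (0, 3); (0, 4); (0, 5); (0, 8); (3, 5); (3, 6); (3, 8); (3, 9); (4, 6); (4, 8); (4, 9); (5, 8); (5, 9); (6, 8); (6, 9); (7, 8); (7, 9); (8, 9)]),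
 Fork 4 7
(Cite 28 [:: 4; 3; 5; 7; 0; 6; 8; 9; 1; 2])
(Fork 5 7
(Cite 28 [:: 5; 4; 6; 7; 0; 3; 8; 9; 1; 2])
(Fork 6 7
(Fork 1 3
(Cite 29 [:: 3; 1; 4; 7; 0; 5; 6; 8; 9; 2])
(Fork 1 4
(Cite 29 [:: 4; 1; 3; 5; 0; 6; 7; 8; 9; 2])
(Fork 2 3
(Cite 48 [:: 3; 2; 4; 7; 5; 6; 0; 1; 8; 9])
(Fork 2 4
(Cite 48 [:: 4; 2; 3; 5; 6; 7; 0; 1; 8; 9])
(Play 6 0 [:: Trap 0 8 [:: 8]; Trap 0 9 [:: 9]; Trap 6 3 [:: 3; 4]])))))
(Cite 0 [:: 0; 1; 2; 3; 4; 5; 6; 7; 8; 9]))));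
(([:: (0, 1); (0, 2); (3, 4); (3, 7); (5, 6)], [:: (0, 3); (0, 4); (0, 5); (0, 6); (0, 7); (0, 8); (0, 9); (3, 8); (3, 9); (7, 8); (7, 9); (8, 9)]),
 Fork 3 5
(Cite 28 [:: 3; 4; 5; 7; 0; 8; 9; 1; 2; 6])
(Fork 3 6
(Cite 29 [:: 3; 4; 6; 7; 0; 5; 8; 9; 1; 2])
(Fork 4 8
(Cite 6 [:: 0; 1; 2; 3; 7; 8; 4; 5; 6; 9])
(Fork 4 9
(Cite 7 [:: 0; 1; 2; 3; 7; 4; 9; 5; 6; 8])
(Fork 5 8
(Cite 2 [:: 0; 1; 2; 3; 4; 5; 6; 7; 8; 9])
(Fork 6 8
(Cite 2 [:: 0; 1; 2; 3; 4; 6; 5; 7; 8; 9])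
(Fork 5 9
(Cite 3 [:: 0; 1; 2; 3; 4; 5; 6; 7; 9; 8])
(Fork 6 9
(Cite 3 [:: 0; 1; 2; 3; 4; 6; 5; 7; 9; 8])
(Fork 4 5
(Fork 4 6
(Cite 28 [:: 4; 3; 5; 6; 0; 8; 9; 1; 2; 7])
(Cite 0 [:: 0; 1; 2; 3; 4; 5; 6; 7; 8; 9]))
(Fork 4 6
(Cite 0 [:: 0; 1; 2; 3; 4; 6; 5; 7; 8; 9])
(Fork 5 7
(Cite 1 [:: 0; 1; 2; 3; 7; 5; 6; 4; 8; 9])
(Fork 6 7
(Cite 1 [:: 0; 1; 2; 3; 7; 6; 5; 4; 8; 9])
(Play 9 0 [:: Trap 0 3 [:: 3; 4; 7]; Trap 0 5 [:: 5; 6]; Trap 0 8 [:: 8]])))))))))))));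
(([:: (0, 1); (0, 2); (3, 4); (3, 7); (5, 6)], [:: (0, 3); (0, 4); (0, 5); (0, 6); (0, 7); (0, 8); (0, 9); (3, 8); (7, 8); (7, 9); (8, 9)]),
 Fork 3 9
(Cite 28 [:: 3; 4; 7; 9; 0; 8; 1; 2; 5; 6])
(Cite 0 [:: 0; 1; 2; 3; 4; 5; 6; 7; 8; 9]));
(([:: (0, 1); (0, 2); (3, 4); (3, 7); (5, 6)], [:: (0, 3); (0, 4); (0, 5); (0, 6); (0, 7); (0, 8); (0, 9); (7, 8); (7, 9); (8, 9)]),
 Fork 3 8
(Cite 28 [:: 3; 4; 7; 8; 0; 1; 2; 5; 6; 9])
(Cite 0 [:: 0; 1; 2; 3; 4; 5; 6; 7; 8; 9]));
(([:: (0, 1); (0, 2); (3, 4); (3, 5); (5, 6)], [:: (3, 7); (3, 8); (3, 9); (4, 6); (4, 7); (4, 8); (4, 9); (5, 7); (5, 8); (5, 9); (6, 7); (6, 8); (6, 9); (7, 8); (7, 9); (8, 9)]),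
 Play 9 5 [:: Trap 0 7 [:: 7]; Trap 0 8 [:: 8]; Trap 0 9 [:: 9]; Go 0 5 0 3; Trap 5 0 [:: 0; 1; 2; 4; 7; 8; 9]]);
(([:: (0, 1); (0, 2); (3, 4); (3, 5); (5, 6)], [:: (0, 3); (0, 6); (3, 6); (3, 7); (3, 8); (3, 9); (4, 7); (4, 8); (4, 9); (5, 7); (5, 8); (5, 9); (6, 7); (6, 8); (6, 9); (7, 8); (7, 9); (8, 9)]),
 Fork 4 6
(Fork 1 3
(Cite 34 [:: 3; 1; 4; 5; 0; 6; 7; 8; 9; 2])
(Fork 2 3
(Cite 39 [:: 3; 2; 4; 5; 0; 1; 6; 7; 8; 9])
(Play 6 0 [:: Trap 0 7 [:: 7]; Trap 0 8 [:: 8]; Trap 0 9 [:: 9]; Trap 6 3 [:: 3]])))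
(Cite 0 [:: 0; 1; 2; 3; 4; 5; 6; 7; 8; 9]));
(([:: (0, 1); (0, 2); (3, 4); (5, 6)], [:: (0, 3); (0, 4); (0, 5); (0, 6); (0, 7); (0, 8); (0, 9); (3, 7); (3, 8); (3, 9); (4, 7); (4, 8); (4, 9); (7, 8); (7, 9); (8, 9)]),
 Fork 5 7
(Cite 2 [:: 0; 1; 2; 5; 6; 3; 4; 7; 8; 9])
(Fork 6 7
(Cite 2 [:: 0; 1; 2; 6; 5; 3; 4; 7; 8; 9])
(Fork 5 8
(Cite 3 [:: 0; 1; 2; 5; 6; 3; 4; 8; 7; 9])
(Fork 6 8
(Cite 3 [:: 0; 1; 2; 6; 5; 3; 4; 8; 7; 9])
(Fork 5 9
(Cite 4 [:: 0; 1; 2; 5; 9; 3; 4; 6; 7; 8])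
(Fork 6 9
(Cite 4 [:: 0; 1; 2; 6; 9; 3; 4; 5; 7; 8])
(Fork 3 5
(Fork 3 6
(Cite 34 [:: 3; 4; 5; 6; 0; 7; 8; 9; 1; 2])
(Cite 0 [:: 0; 1; 2; 3; 4; 5; 6; 7; 8; 9]))
(Fork 3 6
(Cite 0 [:: 0; 1; 2; 3; 4; 6; 5; 7; 8; 9])
(Fork 4 5
(Cite 1 [:: 0; 1; 2; 4; 3; 5; 6; 7; 8; 9])
(Fork 4 6
(Cite 1 [:: 0; 1; 2; 4; 3; 6; 5; 7; 8; 9])
(Play 9 0 [:: Trap 0 3 [:: 3; 4]; Trap 0 5 [:: 5; 6]; Trap 0 7 [:: 7]; Trap 0 8 [:: 8]])))))))))));
(([:: (0, 1); (0, 2); (3, 4); (5, 6)], [:: (0, 3); (0, 4); (0, 5); (0, 6); (0, 7); (0, 8); (0, 9); (3, 7); (3, 8); (3, 9); (4, 7); (4, 8); (7, 8); (7, 9); (8, 9)]),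
 Fork 4 9
(Cite 5 [:: 0; 1; 2; 4; 9; 5; 6; 3; 7; 8])
(Cite 0 [:: 0; 1; 2; 3; 4; 5; 6; 7; 8; 9]));
(([:: (0, 1); (0, 2); (3, 4); (5, 6)], [:: (0, 3); (0, 4); (0, 5); (0, 6); (0, 7); (0, 8); (0, 9); (3, 7); (3, 8); (3, 9); (4, 7); (7, 8); (7, 9); (8, 9)]),
 Fork 4 8
(Cite 5 [:: 0; 1; 2; 4; 8; 5; 6; 3; 7; 9])
(Cite 0 [:: 0; 1; 2; 3; 4; 5; 6; 7; 8; 9]));
(([:: (0, 1); (0, 2); (3, 4); (5, 6)], [:: (0, 3); (0, 4); (0, 5); (0, 6); (0, 7); (0, 8); (0, 9); (3, 7); (3, 8); (3, 9); (7, 8); (7, 9); (8, 9)]),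
 Fork 4 7
(Cite 5 [:: 0; 1; 2; 4; 7; 5; 6; 3; 8; 9])
(Cite 0 [:: 0; 1; 2; 3; 4; 5; 6; 7; 8; 9]));
(([:: (0, 1); (0, 2); (3, 4); (5, 6)], [:: (0, 3); (0, 4); (0, 5); (0, 6); (0, 7); (0, 8); (0, 9); (3, 7); (3, 8); (7, 8); (7, 9); (8, 9)]),
 Fork 3 9
(Cite 8 [:: 0; 1; 2; 3; 4; 5; 6; 9; 7; 8])
(Cite 0 [:: 0; 1; 2; 3; 4; 5; 6; 7; 8; 9]));
(([:: (0, 1); (0, 2); (3, 4); (5, 6)], [:: (0, 3); (0, 4); (0, 5); (0, 6); (0, 7); (0, 8); (0, 9); (7, 8); (7, 9)]),
 Fork 8 9
(Cite 15 [:: 0; 1; 2; 8; 9; 3; 4; 5; 6; 7])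
(Fork 3 7
(Cite 7 [:: 0; 1; 2; 3; 4; 5; 6; 7; 8; 9])
(Fork 3 8
(Cite 8 [:: 0; 1; 2; 3; 4; 5; 6; 8; 7; 9])
(Cite 0 [:: 0; 1; 2; 3; 4; 5; 6; 7; 8; 9]))));
(([:: (0, 1); (0, 2); (3, 4); (5, 6)], [:: (0, 3); (0, 4); (0, 5); (0, 6); (0, 7); (0, 8); (0, 9)]),
 Fork 7 8
(Fork 3 9
(Cite 28 [:: 0; 1; 2; 3; 4; 5; 6; 7; 8; 9])
(Cite 15 [:: 0; 1; 2; 3; 4; 5; 6; 7; 8; 9]))
(Fork 7 9
(Cite 15 [:: 0; 1; 2; 7; 9; 3; 4; 5; 6; 8])
(Cite 0 [:: 0; 1; 2; 3; 4; 5; 6; 7; 8; 9])));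
(([:: (0, 1); (0, 2); (3, 4); (3, 5)], [:: (3, 6); (3, 7); (3, 8); (3, 9); (4, 6); (4, 7); (4, 8); (4, 9); (5, 6); (5, 7); (5, 8); (5, 9); (6, 7); (6, 8); (6, 9); (7, 8); (7, 9); (8, 9)]),
 Play 9 0 [:: Trap 0 3 [:: 3; 4; 5]; Trap 0 6 [:: 6]; Trap 0 7 [:: 7]; Trap 0 8 [:: 8]]);
(([:: (0, 1); (0, 2); (3, 4); (3, 5)], [:: (0, 3); (3, 6); (3, 7); (3, 8); (4, 6); (4, 7); (4, 8); (5, 6); (5, 7); (5, 8); (5, 9); (6, 7); (6, 8); (6, 9); (7, 8); (7, 9); (8, 9)]),
 Fork 4 9
(Cite 9 [:: 0; 1; 2; 3; 5; 4; 9; 6; 7; 8])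
(Fork 3 9
(Cite 42 [:: 3; 4; 5; 9; 0; 6; 7; 8; 1; 2])
(Cite 0 [:: 0; 1; 2; 3; 4; 5; 6; 7; 8; 9])));
(([:: (0, 1); (0, 2); (3, 4); (3, 5)], [:: (0, 3); (0, 4); (0, 5); (0, 6); (0, 7); (0, 8); (0, 9); (3, 6); (3, 7); (4, 6); (4, 7); (5, 6); (5, 7); (5, 8); (5, 9); (6, 7); (6, 8); (6, 9); (7, 8); (7, 9); (8, 9)]),
 Fork 3 8
(Cite 42 [:: 3; 4; 5; 8; 0; 6; 7; 1; 2; 9])
(Fork 4 8
(Cite 7 [:: 0; 1; 2; 5; 3; 4; 8; 6; 7; 9])
(Cite 0 [:: 0; 1; 2; 3; 4; 5; 6; 7; 8; 9])));
(([:: (0, 1); (0, 2); (3, 4); (3, 5)], [:: (0, 3); (0, 4); (0, 5); (0, 6); (0, 7); (0, 8); (0, 9); (3, 6); (4, 6); (5, 6); (5, 7); (5, 8); (5, 9); (6, 7); (6, 8); (6, 9); (7, 8); (7, 9); (8, 9)]),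
 Fork 3 7
(Cite 42 [:: 3; 4; 5; 7; 0; 6; 1; 2; 8; 9])
(Fork 4 7
(Cite 7 [:: 0; 1; 2; 5; 3; 4; 7; 6; 8; 9])
(Cite 0 [:: 0; 1; 2; 3; 4; 5; 6; 7; 8; 9])));
(([:: (0, 1); (0, 2); (3, 4); (3, 5)], [:: (0, 3); (0, 4); (0, 5); (0, 6); (0, 7); (0, 8); (0, 9); (5, 6); (5, 7); (5, 8); (5, 9); (6, 7); (6, 8); (6, 9); (7, 8); (7, 9); (8, 9)]),
 Fork 3 6
(Cite 42 [:: 3; 4; 5; 6; 0; 1; 2; 7; 8; 9])
(Fork 4 6
(Cite 7 [:: 0; 1; 2; 5; 3; 4; 6; 7; 8; 9])
(Cite 0 [:: 0; 1; 2; 3; 4; 5; 6; 7; 8; 9])));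
(([:: (0, 1); (0, 2); (3, 4)], [:: (3, 5); (3, 6); (3, 7); (3, 8); (3, 9); (4, 5); (4, 6); (4, 7); (4, 8); (4, 9); (5, 6); (5, 7); (5, 8); (5, 9); (6, 7); (6, 8); (6, 9); (7, 8); (7, 9); (8, 9)]),
 Play 9 0 [:: Trap 0 3 [:: 3; 4]; Trap 0 5 [:: 5]; Trap 0 6 [:: 6]; Trap 0 7 [:: 7]; Trap 0 8 [:: 8]]);
(([:: (0, 1); (0, 2); (3, 4)], [:: (3, 5); (3, 6); (3, 7); (3, 8); (3, 9); (4, 5); (4, 6); (4, 7); (4, 8); (5, 6); (5, 7); (5, 8); (5, 9); (6, 7); (6, 8); (6, 9); (7, 8); (7, 9); (8, 9)]),
 Fork 4 9
(Cite 5 [:: 0; 1; 2; 4; 3; 9; 5; 6; 7; 8])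
(Cite 0 [:: 0; 1; 2; 3; 4; 5; 6; 7; 8; 9]));
(([:: (0, 1); (0, 2); (3, 4)], [:: (3, 5); (3, 6); (3, 7); (3, 8); (4, 5); (4, 6); (4, 7); (4, 8); (5, 6); (5, 7); (5, 8); (5, 9); (6, 7); (6, 8); (6, 9); (7, 8); (7, 9); (8, 9)]),
 Fork 3 9
(Cite 6 [:: 0; 1; 2; 3; 4; 9; 5; 6; 7; 8])
(Cite 0 [:: 0; 1; 2; 3; 4; 5; 6; 7; 8; 9]));
(([:: (0, 1); (0, 2); (3, 4)], [:: (0, 3); (0, 4); (0, 5); (0, 6); (0, 7); (0, 8); (0, 9); (5, 6); (5, 7); (5, 8); (5, 9); (6, 7); (6, 8); (6, 9); (7, 8); (7, 9)]),
 Fork 8 9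
(Cite 14 [:: 0; 1; 2; 8; 9; 3; 4; 5; 6; 7])
(Fork 3 5
(Cite 3 [:: 0; 1; 2; 3; 4; 5; 6; 7; 8; 9])
(Fork 4 5
(Cite 3 [:: 0; 1; 2; 4; 3; 5; 6; 7; 8; 9])
(Fork 3 6
(Cite 4 [:: 0; 1; 2; 3; 4; 6; 5; 7; 8; 9])
(Fork 4 6
(Cite 4 [:: 0; 1; 2; 4; 3; 6; 5; 7; 8; 9])
(Fork 3 7
(Cite 5 [:: 0; 1; 2; 3; 4; 7; 5; 6; 8; 9])
(Fork 4 7
(Cite 5 [:: 0; 1; 2; 4; 3; 7; 5; 6; 8; 9])
(Fork 3 8
(Cite 6 [:: 0; 1; 2; 3; 4; 8; 5; 6; 7; 9])
(Fork 4 8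
(Cite 6 [:: 0; 1; 2; 4; 3; 8; 5; 6; 7; 9])
(Cite 0 [:: 0; 1; 2; 3; 4; 5; 6; 7; 8; 9]))))))))));
(([:: (0, 1); (0, 2); (3, 4)], [:: (0, 3); (0, 4); (0, 5); (0, 6); (0, 7); (0, 8); (0, 9); (5, 6); (5, 7); (5, 8); (5, 9); (6, 7); (6, 8); (6, 9)]),
 Fork 7 8
(Cite 11 [:: 0; 1; 2; 7; 8; 3; 4; 5; 6; 9])
(Fork 7 9
(Cite 14 [:: 0; 1; 2; 7; 9; 3; 4; 5; 6; 8])
(Cite 0 [:: 0; 1; 2; 3; 4; 5; 6; 7; 8; 9])));
(([:: (0, 1); (0, 2); (3, 4)], [:: (0, 3); (0, 4); (0, 5); (0, 6); (0, 7); (0, 8); (0, 9); (5, 6); (5, 7); (5, 8); (5, 9)]),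
 Fork 6 7
(Cite 11 [:: 0; 1; 2; 3; 4; 6; 7; 5; 8; 9])
(Fork 6 8
(Cite 11 [:: 0; 1; 2; 3; 4; 6; 8; 5; 7; 9])
(Fork 6 9
(Cite 11 [:: 0; 1; 2; 3; 4; 6; 9; 5; 7; 8])
(Cite 0 [:: 0; 1; 2; 3; 4; 5; 6; 7; 8; 9]))));
(([:: (0, 1); (0, 2); (3, 4)], [:: (0, 3); (0, 4); (0, 5); (0, 6); (0, 7); (0, 8); (0, 9)]),
 Fork 5 6
(Cite 11 [:: 0; 1; 2; 3; 4; 5; 6; 7; 8; 9])
(Fork 5 7
(Cite 11 [:: 0; 1; 2; 3; 4; 5; 7; 6; 8; 9])
(Fork 5 8
(Cite 11 [:: 0; 1; 2; 3; 4; 5; 8; 6; 7; 9])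
(Fork 5 9
(Cite 11 [:: 0; 1; 2; 3; 4; 5; 9; 6; 7; 8])
(Cite 0 [:: 0; 1; 2; 3; 4; 5; 6; 7; 8; 9])))));
(([:: (0, 1); (0, 2)], [:: (0, 3); (0, 4); (0, 5); (0, 6); (0, 7); (0, 8); (0, 9)]),
 Fork 3 4
(Cite 0 [:: 0; 1; 2; 3; 4; 5; 6; 7; 8; 9])
(Fork 3 5
(Cite 0 [:: 0; 1; 2; 3; 5; 4; 6; 7; 8; 9])
(Fork 3 6
(Cite 0 [:: 0; 1; 2; 3; 6; 4; 5; 7; 8; 9])
(Fork 3 7
(Cite 0 [:: 0; 1; 2; 3; 7; 4; 5; 6; 8; 9])
(Fork 3 8
(Cite 0 [:: 0; 1; 2; 3; 8; 4; 5; 6; 7; 9])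
(Fork 3 9
(Cite 0 [:: 0; 1; 2; 3; 9; 4; 5; 6; 7; 8])
(Fork 4 5
(Cite 1 [:: 0; 1; 2; 4; 5; 3; 6; 7; 8; 9])
(Fork 4 6
(Cite 1 [:: 0; 1; 2; 4; 6; 3; 5; 7; 8; 9])
(Fork 4 7
(Cite 1 [:: 0; 1; 2; 4; 7; 3; 5; 6; 8; 9])
(Fork 4 8
(Cite 1 [:: 0; 1; 2; 4; 8; 3; 5; 6; 7; 9])
(Fork 4 9
(Cite 1 [:: 0; 1; 2; 4; 9; 3; 5; 6; 7; 8])
(Fork 5 6
(Cite 2 [:: 0; 1; 2; 5; 6; 3; 4; 7; 8; 9])
(Fork 5 7
(Cite 2 [:: 0; 1; 2; 5; 7; 3; 4; 6; 8; 9])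
(Fork 5 8
(Cite 2 [:: 0; 1; 2; 5; 8; 3; 4; 6; 7; 9])
(Fork 5 9
(Cite 2 [:: 0; 1; 2; 5; 9; 3; 4; 6; 7; 8])
(Fork 6 7
(Cite 3 [:: 0; 1; 2; 6; 7; 3; 4; 5; 8; 9])
(Fork 6 8
(Cite 3 [:: 0; 1; 2; 6; 8; 3; 4; 5; 7; 9])
(Fork 6 9
(Cite 3 [:: 0; 1; 2; 6; 9; 3; 4; 5; 7; 8])
(Fork 7 8
(Cite 4 [:: 0; 1; 2; 7; 8; 3; 4; 5; 6; 9])
(Fork 7 9
(Cite 5 [:: 0; 1; 2; 7; 9; 3; 4; 5; 6; 8])
(Fork 8 9
(Cite 6 [:: 0; 1; 2; 8; 9; 3; 4; 5; 6; 7])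
(Play 9 0 [:: Trap 0 3 [:: 3]; Trap 0 4 [:: 4]; Trap 0 5 [:: 5]; Trap 0 6 [:: 6]; Trap 0 7 [:: 7]; Trap 0 8 [:: 8]]))))))))))))))))))))));
(([:: (0, 1); (0, 2)], [:: (0, 3); (0, 4); (0, 5); (0, 6); (0, 7); (0, 8)]),
 Fork 0 9
(Cite 56 [:: 0; 1; 2; 9; 3; 4; 5; 6; 7; 8])
(Cite 0 [:: 0; 1; 2; 3; 4; 5; 6; 7; 8; 9]));
(([:: (0, 1); (0, 2)], [:: (0, 3); (0, 4); (0, 5); (0, 6); (0, 7)]),
 Fork 0 8
(Cite 56 [:: 0; 1; 2; 8; 3; 4; 5; 6; 7; 9])
(Cite 0 [:: 0; 1; 2; 3; 4; 5; 6; 7; 8; 9]));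
(([:: (0, 1); (0, 2)], [:: (0, 3); (0, 4); (0, 5); (0, 6)]),
 Fork 0 7
(Cite 56 [:: 0; 1; 2; 7; 3; 4; 5; 6; 8; 9])
(Cite 0 [:: 0; 1; 2; 3; 4; 5; 6; 7; 8; 9]));
(([:: (0, 1); (0, 2)], [:: (0, 3); (0, 4); (0, 5)]),
 Fork 0 6
(Cite 56 [:: 0; 1; 2; 6; 3; 4; 5; 7; 8; 9])
(Cite 0 [:: 0; 1; 2; 3; 4; 5; 6; 7; 8; 9]));
(([:: (0, 1); (0, 2)], [:: (0, 3); (0, 4)]),
 Fork 0 5
(Cite 56 [:: 0; 1; 2; 5; 3; 4; 6; 7; 8; 9])
(Cite 0 [:: 0; 1; 2; 3; 4; 5; 6; 7; 8; 9]));
(([:: (0, 1); (0, 2)], [:: (0, 3)]),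
 Fork 0 4
(Cite 56 [:: 0; 1; 2; 4; 3; 5; 6; 7; 8; 9])
(Cite 0 [:: 0; 1; 2; 3; 4; 5; 6; 7; 8; 9]));

(* Certificate: degree 1 *)
(([:: (0, 1); (2, 3); (4, 5); (6, 7)], [:: (2, 4); (2, 5); (2, 6); (2, 7); (2, 8); (2, 9); (3, 4); (3, 5); (3, 6); (3, 7); (3, 8); (3, 9); (4, 6); (4, 7); (4, 8); (4, 9); (5, 6); (5, 7); (5, 8); (5, 9); (6, 8); (6, 9); (7, 8); (7, 9); (8, 9)]),
 (* The pieces {2, 3}, {4, 5}, {6, 7} and {8} can be linked only through 0 and 1, which the cop on 1
    watches; the other cop walks to the piece that holds the robber. *)
 Play 9 1 [:: Trap 1 2 [:: 2; 3]; Trap 1 4 [:: 4; 5]; Trap 1 6 [:: 6; 7]; Trap 1 8 [:: 8]]);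
(([:: (0, 1); (2, 3); (4, 5); (6, 7)], [:: (0, 7); (2, 4); (2, 5); (2, 6); (2, 7); (2, 8); (2, 9); (3, 4); (3, 5); (3, 6); (3, 7); (3, 8); (3, 9); (4, 6); (4, 7); (4, 8); (4, 9); (5, 6); (5, 7); (5, 8); (5, 9); (6, 8); (6, 9); (7, 8)]),
 Fork 7 9
(Cite 6 [:: 7; 6; 9; 0; 2; 3; 4; 5; 8; 1])
(Fork 8 9
(Play 9 1 [:: Trap 1 2 [:: 2; 3]; Trap 1 4 [:: 4; 5]; Trap 1 6 [:: 6; 7]])
(Cite 0 [:: 0; 1; 2; 3; 4; 5; 6; 7; 8; 9])));
(([:: (0, 1); (2, 3); (4, 5); (6, 7)], [:: (0, 7); (2, 4); (2, 5); (2, 6); (2, 7); (2, 8); (2, 9); (3, 4); (3, 5); (3, 6); (3, 7); (3, 8); (3, 9); (4, 6); (4, 7); (4, 8); (4, 9); (5, 6); (5, 7); (5, 8); (5, 9); (6, 8); (6, 9)]),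
 Fork 7 8
(Cite 6 [:: 7; 6; 8; 0; 2; 3; 4; 5; 1; 9])
(Cite 0 [:: 0; 1; 2; 3; 4; 5; 6; 7; 8; 9]));
(([:: (0, 1); (2, 3); (4, 5); (6, 7)], [:: (0, 6); (0, 7); (2, 4); (2, 5); (2, 6); (2, 7); (2, 8); (2, 9); (3, 4); (3, 5); (3, 6); (3, 7); (3, 8); (3, 9); (4, 6); (4, 7); (4, 8); (4, 9); (5, 6); (5, 7); (5, 8); (5, 9); (6, 8)]),
 Fork 6 9
(Cite 8 [:: 6; 7; 9; 0; 2; 3; 4; 5; 8; 1])
(Cite 0 [:: 0; 1; 2; 3; 4; 5; 6; 7; 8; 9]));
(([:: (0, 1); (2, 3); (4, 5)], [:: (2, 4); (2, 5); (2, 6); (2, 7); (2, 8); (2, 9); (3, 4); (3, 5); (3, 6); (3, 7); (3, 8); (3, 9); (4, 6); (4, 7); (4, 8); (4, 9); (5, 6); (5, 7); (5, 8); (5, 9); (6, 7); (6, 8); (6, 9); (7, 8); (7, 9); (8, 9)]),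
 Play 9 1 [:: Trap 1 2 [:: 2; 3]; Trap 1 4 [:: 4; 5]; Trap 1 6 [:: 6]; Trap 1 7 [:: 7]; Trap 1 8 [:: 8]]);
(([:: (0, 1); (2, 3); (4, 5)], [:: (0, 5); (0, 6); (0, 7); (0, 8); (0, 9); (2, 4); (2, 5); (2, 6); (2, 7); (2, 8); (2, 9); (3, 4); (3, 5); (3, 6); (3, 7); (3, 8); (3, 9); (4, 6); (4, 7); (4, 8); (4, 9); (5, 6); (5, 7); (5, 8)]),
 Fork 5 9
(Cite 10 [:: 5; 4; 9; 0; 2; 3; 6; 7; 8; 1])
(Fork 6 7
(Fork 6 8
(Cite 9 [:: 6; 7; 8; 0; 2; 3; 4; 5; 1; 9])
(Cite 1 [:: 0; 1; 2; 3; 4; 5; 6; 7; 8; 9]))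
(Fork 6 8
(Cite 1 [:: 0; 1; 2; 3; 4; 5; 6; 8; 7; 9])
(Fork 6 9
(Cite 2 [:: 0; 1; 2; 3; 4; 5; 6; 9; 7; 8])
(Fork 7 8
(Cite 1 [:: 0; 1; 2; 3; 4; 5; 7; 8; 6; 9])
(Fork 7 9
(Cite 3 [:: 0; 1; 2; 3; 4; 5; 7; 9; 6; 8])
(Fork 8 9
(Cite 4 [:: 0; 1; 2; 3; 4; 5; 8; 9; 6; 7])
(Cite 0 [:: 0; 1; 2; 3; 4; 5; 6; 7; 8; 9]))))))));
(([:: (0, 1); (2, 3); (4, 5)], [:: (0, 5); (0, 6); (0, 7); (0, 8); (0, 9); (2, 4); (2, 5); (2, 6); (2, 7); (2, 8); (2, 9); (3, 4); (3, 5); (3, 6); (3, 7); (3, 8); (3, 9); (4, 6); (4, 7); (4, 8); (4, 9); (5, 6); (5, 7)]),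
 Fork 5 8
(Cite 10 [:: 5; 4; 8; 0; 2; 3; 6; 7; 1; 9])
(Cite 0 [:: 0; 1; 2; 3; 4; 5; 6; 7; 8; 9]));
(([:: (0, 1); (2, 3); (4, 5)], [:: (0, 5); (0, 6); (0, 7); (0, 8); (0, 9); (2, 4); (2, 5); (2, 6); (2, 7); (2, 8); (2, 9); (3, 4); (3, 5); (3, 6); (3, 7); (3, 8); (3, 9); (4, 6); (4, 7); (4, 8); (4, 9); (5, 6)]),
 Fork 5 7
(Cite 10 [:: 5; 4; 7; 0; 2; 3; 6; 1; 8; 9])
(Cite 0 [:: 0; 1; 2; 3; 4; 5; 6; 7; 8; 9]));
(([:: (0, 1); (2, 3); (4, 5)], [:: (0, 5); (0, 6); (0, 7); (0, 8); (0, 9); (2, 4); (2, 5); (2, 6); (2, 7); (2, 8); (2, 9); (3, 4); (3, 5); (3, 6); (3, 7); (3, 8); (3, 9); (4, 6); (4, 7); (4, 8); (4, 9)]),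
 Fork 5 6
(Cite 10 [:: 5; 4; 6; 0; 2; 3; 1; 7; 8; 9])
(Cite 0 [:: 0; 1; 2; 3; 4; 5; 6; 7; 8; 9]));
(([:: (0, 1); (2, 3); (4, 5)], [:: (0, 4); (0, 5); (0, 6); (0, 7); (0, 8); (0, 9); (2, 4); (2, 5); (2, 6); (2, 7); (2, 8); (2, 9); (3, 4); (3, 5); (3, 6); (3, 7); (3, 8); (3, 9); (4, 6); (4, 7); (4, 8)]),
 Fork 4 9
(Cite 14 [:: 4; 5; 9; 0; 2; 3; 6; 7; 8; 1])
(Cite 0 [:: 0; 1; 2; 3; 4; 5; 6; 7; 8; 9]));
(([:: (0, 1); (2, 3); (4, 5)], [:: (0, 4); (0, 5); (0, 6); (0, 7); (0, 8); (0, 9); (2, 4); (2, 5); (2, 6); (2, 7); (2, 8); (2, 9); (3, 4); (3, 5); (3, 6); (3, 7); (3, 8); (3, 9); (4, 6); (4, 7)]),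
 Fork 4 8
(Cite 14 [:: 4; 5; 8; 0; 2; 3; 6; 7; 1; 9])
(Cite 0 [:: 0; 1; 2; 3; 4; 5; 6; 7; 8; 9]));
(([:: (0, 1); (2, 3); (4, 5)], [:: (0, 4); (0, 5); (0, 6); (0, 7); (0, 8); (0, 9); (2, 4); (2, 5); (2, 6); (2, 7); (2, 8); (2, 9); (3, 4); (3, 5); (3, 6); (3, 7); (3, 8); (3, 9); (4, 6)]),
 Fork 4 7
(Cite 14 [:: 4; 5; 7; 0; 2; 3; 6; 1; 8; 9])
(Cite 0 [:: 0; 1; 2; 3; 4; 5; 6; 7; 8; 9]));
(([:: (0, 1); (2, 3)], [:: (2, 4); (2, 5); (2, 6); (2, 7); (2, 8); (2, 9); (3, 4); (3, 5); (3, 6); (3, 7); (3, 8); (3, 9); (4, 5); (4, 6); (4, 7); (4, 8); (4, 9); (5, 6); (5, 7); (5, 8); (5, 9); (6, 7); (6, 8); (6, 9); (7, 8); (7, 9); (8, 9)]),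
 Play 9 1 [:: Trap 1 2 [:: 2; 3]; Trap 1 4 [:: 4]; Trap 1 5 [:: 5]; Trap 1 6 [:: 6]; Trap 1 7 [:: 7]; Trap 1 8 [:: 8]]);
(([:: (0, 1); (2, 3)], [:: (0, 3); (0, 4); (0, 5); (0, 6); (0, 7); (0, 8); (0, 9); (2, 4); (2, 5); (2, 6); (2, 7); (2, 8); (2, 9); (3, 4); (3, 5); (3, 6); (3, 7); (3, 8)]),
 Fork 3 9
(Cite 18 [:: 3; 2; 9; 0; 4; 5; 6; 7; 8; 1])
(Fork 4 5
(Fork 4 6
(Cite 15 [:: 4; 5; 6; 0; 2; 3; 1; 7; 8; 9])
(Cite 1 [:: 0; 1; 2; 3; 4; 5; 6; 7; 8; 9]))
(Fork 4 6
(Cite 1 [:: 0; 1; 2; 3; 4; 6; 5; 7; 8; 9])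
(Fork 4 7
(Cite 2 [:: 0; 1; 2; 3; 4; 7; 5; 6; 8; 9])
(Fork 4 8
(Cite 3 [:: 0; 1; 2; 3; 4; 8; 5; 6; 7; 9])
(Fork 4 9
(Cite 4 [:: 0; 1; 2; 3; 4; 9; 5; 6; 7; 8])
(Fork 5 6
(Cite 1 [:: 0; 1; 2; 3; 5; 6; 4; 7; 8; 9])
(Fork 5 7
(Cite 2 [:: 0; 1; 2; 3; 5; 7; 4; 6; 8; 9])
(Fork 5 8
(Cite 3 [:: 0; 1; 2; 3; 5; 8; 4; 6; 7; 9])
(Fork 5 9
(Cite 5 [:: 0; 1; 2; 3; 5; 9; 4; 6; 7; 8])
(Fork 6 7
(Cite 2 [:: 0; 1; 2; 3; 6; 7; 4; 5; 8; 9])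
(Fork 6 8
(Cite 3 [:: 0; 1; 2; 3; 6; 8; 4; 5; 7; 9])
(Fork 6 9
(Cite 6 [:: 0; 1; 2; 3; 6; 9; 4; 5; 7; 8])
(Fork 7 8
(Cite 3 [:: 0; 1; 2; 3; 7; 8; 4; 5; 6; 9])
(Fork 7 9
(Cite 7 [:: 0; 1; 2; 3; 7; 9; 4; 5; 6; 8])
(Fork 8 9
(Cite 8 [:: 0; 1; 2; 3; 8; 9; 4; 5; 6; 7])
(Cite 0 [:: 0; 1; 2; 3; 4; 5; 6; 7; 8; 9])))))))))))))))));
(([:: (0, 1); (2, 3)], [:: (0, 3); (0, 4); (0, 5); (0, 6); (0, 7); (0, 8); (0, 9); (2, 4); (2, 5); (2, 6); (2, 7); (2, 8); (2, 9); (3, 4); (3, 5); (3, 6); (3, 7)]),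
 Fork 3 8
(Cite 18 [:: 3; 2; 8; 0; 4; 5; 6; 7; 1; 9])
(Cite 0 [:: 0; 1; 2; 3; 4; 5; 6; 7; 8; 9]));
(([:: (0, 1); (2, 3)], [:: (0, 3); (0, 4); (0, 5); (0, 6); (0, 7); (0, 8); (0, 9); (2, 4); (2, 5); (2, 6); (2, 7); (2, 8); (2, 9); (3, 4); (3, 5); (3, 6)]),
 Fork 3 7
(Cite 18 [:: 3; 2; 7; 0; 4; 5; 6; 1; 8; 9])
(Cite 0 [:: 0; 1; 2; 3; 4; 5; 6; 7; 8; 9]));
(([:: (0, 1); (2, 3)], [:: (0, 3); (0, 4); (0, 5); (0, 6); (0, 7); (0, 8); (0, 9); (2, 4); (2, 5); (2, 6); (2, 7); (2, 8); (2, 9); (3, 4); (3, 5)]),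
 Fork 3 6
(Cite 18 [:: 3; 2; 6; 0; 4; 5; 1; 7; 8; 9])
(Cite 0 [:: 0; 1; 2; 3; 4; 5; 6; 7; 8; 9]));
(([:: (0, 1); (2, 3)], [:: (0, 3); (0, 4); (0, 5); (0, 6); (0, 7); (0, 8); (0, 9); (2, 4); (2, 5); (2, 6); (2, 7); (2, 8); (2, 9); (3, 4)]),
 Fork 3 5
(Cite 18 [:: 3; 2; 5; 0; 4; 1; 6; 7; 8; 9])
(Cite 0 [:: 0; 1; 2; 3; 4; 5; 6; 7; 8; 9]));
(([:: (0, 1); (2, 3)], [:: (0, 3); (0, 4); (0, 5); (0, 6); (0, 7); (0, 8); (0, 9); (2, 4); (2, 5); (2, 6); (2, 7); (2, 8); (2, 9)]),
 Fork 3 4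
(Cite 18 [:: 3; 2; 4; 0; 1; 5; 6; 7; 8; 9])
(Cite 0 [:: 0; 1; 2; 3; 4; 5; 6; 7; 8; 9]));
(([:: (0, 1); (2, 3)], [:: (0, 2); (0, 3); (0, 4); (0, 5); (0, 6); (0, 7); (0, 8); (0, 9); (2, 4); (2, 5); (2, 6); (2, 7); (2, 8)]),
 Fork 2 9
(Cite 24 [:: 2; 3; 9; 0; 4; 5; 6; 7; 8; 1])
(Cite 0 [:: 0; 1; 2; 3; 4; 5; 6; 7; 8; 9]));
(([:: (0, 1); (2, 3)], [:: (0, 2); (0, 3); (0, 4); (0, 5); (0, 6); (0, 7); (0, 8); (0, 9); (2, 4); (2, 5); (2, 6); (2, 7)]),
 Fork 2 8
(Cite 24 [:: 2; 3; 8; 0; 4; 5; 6; 7; 1; 9])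
(Cite 0 [:: 0; 1; 2; 3; 4; 5; 6; 7; 8; 9]));
(([:: (0, 1); (2, 3)], [:: (0, 2); (0, 3); (0, 4); (0, 5); (0, 6); (0, 7); (0, 8); (0, 9); (2, 4); (2, 5); (2, 6)]),
 Fork 2 7
(Cite 24 [:: 2; 3; 7; 0; 4; 5; 6; 1; 8; 9])
(Cite 0 [:: 0; 1; 2; 3; 4; 5; 6; 7; 8; 9]));
(([:: (0, 1); (2, 3)], [:: (0, 2); (0, 3); (0, 4); (0, 5); (0, 6); (0, 7); (0, 8); (0, 9); (2, 4); (2, 5)]),
 Fork 2 6
(Cite 24 [:: 2; 3; 6; 0; 4; 5; 1; 7; 8; 9])
(Cite 0 [:: 0; 1; 2; 3; 4; 5; 6; 7; 8; 9]));
(([:: (0, 1); (2, 3)], [:: (0, 2); (0, 3); (0, 4); (0, 5); (0, 6); (0, 7); (0, 8); (0, 9); (2, 4)]),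
 Fork 2 5
(Cite 24 [:: 2; 3; 5; 0; 4; 1; 6; 7; 8; 9])
(Cite 0 [:: 0; 1; 2; 3; 4; 5; 6; 7; 8; 9]));
(([:: (0, 1)], [:: (2, 3); (2, 4); (2, 5); (2, 6); (2, 7); (2, 8); (2, 9); (3, 4); (3, 5); (3, 6); (3, 7); (3, 8); (3, 9); (4, 5); (4, 6); (4, 7); (4, 8); (4, 9); (5, 6); (5, 7); (5, 8); (5, 9); (6, 7); (6, 8); (6, 9); (7, 8); (7, 9)]),
 Fork 8 9
(Cite 11 [:: 0; 1; 8; 9; 2; 3; 4; 5; 6; 7])
(Play 9 1 [:: Trap 1 2 [:: 2]; Trap 1 3 [:: 3]; Trap 1 4 [:: 4]; Trap 1 5 [:: 5]; Trap 1 6 [:: 6]; Trap 1 7 [:: 7]; Trap 1 8 [:: 8]]));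
(([:: (0, 1)], [:: (0, 2); (0, 3); (0, 4); (0, 5); (0, 6); (0, 7); (0, 8); (0, 9); (2, 3); (2, 4); (2, 5); (2, 6); (2, 7); (2, 8); (2, 9); (3, 4); (3, 5); (3, 6); (3, 7); (3, 8); (3, 9); (4, 5); (4, 6); (4, 7); (4, 8); (4, 9); (5, 6); (5, 7); (5, 8); (5, 9); (6, 7); (6, 8); (6, 9)]),
 Fork 7 8
(Cite 5 [:: 0; 1; 7; 8; 2; 3; 4; 5; 6; 9])
(Fork 7 9
(Cite 11 [:: 0; 1; 7; 9; 2; 3; 4; 5; 6; 8])
(Cite 0 [:: 0; 1; 2; 3; 4; 5; 6; 7; 8; 9])));
(([:: (0, 1)], [:: (0, 2); (0, 3); (0, 4); (0, 5); (0, 6); (0, 7); (0, 8); (0, 9); (2, 3); (2, 4); (2, 5); (2, 6); (2, 7); (2, 8); (2, 9); (3, 4); (3, 5); (3, 6); (3, 7); (3, 8); (3, 9); (4, 5); (4, 6); (4, 7); (4, 8); (4, 9); (5, 6); (5, 7); (5, 8); (5, 9)]),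
 Fork 6 7
(Cite 5 [:: 0; 1; 6; 7; 2; 3; 4; 5; 8; 9])
(Fork 6 8
(Cite 6 [:: 0; 1; 6; 8; 2; 3; 4; 5; 7; 9])
(Fork 6 9
(Cite 11 [:: 0; 1; 6; 9; 2; 3; 4; 5; 7; 8])
(Cite 0 [:: 0; 1; 2; 3; 4; 5; 6; 7; 8; 9]))));
(([:: (0, 1)], [:: (0, 2); (0, 3); (0, 4); (0, 5); (0, 6); (0, 7); (0, 8); (0, 9); (2, 3); (2, 4); (2, 5); (2, 6); (2, 7); (2, 8); (2, 9); (3, 4); (3, 5); (3, 6); (3, 7); (3, 8); (3, 9); (4, 5); (4, 6); (4, 7); (4, 8); (4, 9)]),
 Fork 5 6
(Cite 5 [:: 0; 1; 5; 6; 2; 3; 4; 7; 8; 9])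
(Fork 5 7
(Cite 6 [:: 0; 1; 5; 7; 2; 3; 4; 6; 8; 9])
(Fork 5 8
(Cite 7 [:: 0; 1; 5; 8; 2; 3; 4; 6; 7; 9])
(Fork 5 9
(Cite 11 [:: 0; 1; 5; 9; 2; 3; 4; 6; 7; 8])
(Cite 0 [:: 0; 1; 2; 3; 4; 5; 6; 7; 8; 9])))));
(([:: (0, 1)], [:: (0, 2); (0, 3); (0, 4); (0, 5); (0, 6); (0, 7); (0, 8); (0, 9); (2, 3); (2, 4); (2, 5); (2, 6); (2, 7); (2, 8); (2, 9); (3, 4); (3, 5); (3, 6); (3, 7); (3, 8); (3, 9)]),
 Fork 4 5
(Cite 5 [:: 0; 1; 4; 5; 2; 3; 6; 7; 8; 9])
(Fork 4 6
(Cite 6 [:: 0; 1; 4; 6; 2; 3; 5; 7; 8; 9])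
(Fork 4 7
(Cite 7 [:: 0; 1; 4; 7; 2; 3; 5; 6; 8; 9])
(Fork 4 8
(Cite 8 [:: 0; 1; 4; 8; 2; 3; 5; 6; 7; 9])
(Fork 4 9
(Cite 11 [:: 0; 1; 4; 9; 2; 3; 5; 6; 7; 8])
(Cite 0 [:: 0; 1; 2; 3; 4; 5; 6; 7; 8; 9]))))));
(([:: (0, 1)], [:: (0, 2); (0, 3); (0, 4); (0, 5); (0, 6); (0, 7); (0, 8); (0, 9); (2, 3); (2, 4); (2, 5); (2, 6); (2, 7); (2, 8); (2, 9)]),
 Fork 3 4
(Cite 5 [:: 0; 1; 3; 4; 2; 5; 6; 7; 8; 9])
(Fork 3 5
(Cite 6 [:: 0; 1; 3; 5; 2; 4; 6; 7; 8; 9])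
(Fork 3 6
(Cite 7 [:: 0; 1; 3; 6; 2; 4; 5; 7; 8; 9])
(Fork 3 7
(Cite 8 [:: 0; 1; 3; 7; 2; 4; 5; 6; 8; 9])
(Fork 3 8
(Cite 9 [:: 0; 1; 3; 8; 2; 4; 5; 6; 7; 9])
(Fork 3 9
(Cite 11 [:: 0; 1; 3; 9; 2; 4; 5; 6; 7; 8])
(Cite 0 [:: 0; 1; 2; 3; 4; 5; 6; 7; 8; 9])))))));
(([:: (0, 1)], [:: (0, 2); (0, 3); (0, 4); (0, 5); (0, 6); (0, 7); (0, 8); (0, 9)]),
 Fork 2 3
(Fork 2 4
(Cite 30 [:: 2; 3; 4; 0; 1; 5; 6; 7; 8; 9])
(Cite 6 [:: 0; 1; 2; 3; 4; 5; 6; 7; 8; 9]))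
(Fork 2 4
(Cite 6 [:: 0; 1; 2; 4; 3; 5; 6; 7; 8; 9])
(Fork 2 5
(Cite 7 [:: 0; 1; 2; 5; 3; 4; 6; 7; 8; 9])
(Fork 2 6
(Cite 8 [:: 0; 1; 2; 6; 3; 4; 5; 7; 8; 9])
(Fork 2 7
(Cite 9 [:: 0; 1; 2; 7; 3; 4; 5; 6; 8; 9])
(Fork 2 8
(Cite 10 [:: 0; 1; 2; 8; 3; 4; 5; 6; 7; 9])
(Fork 2 9
(Cite 11 [:: 0; 1; 2; 9; 3; 4; 5; 6; 7; 8])
(Cite 0 [:: 0; 1; 2; 3; 4; 5; 6; 7; 8; 9]))))))));
(([:: (0, 1)], [:: (0, 2); (0, 3); (0, 4); (0, 5); (0, 6); (0, 7); (0, 8)]),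
 Fork 0 9
(Cite 37 [:: 0; 1; 9; 2; 3; 4; 5; 6; 7; 8])
(Cite 0 [:: 0; 1; 2; 3; 4; 5; 6; 7; 8; 9]));
(([:: (0, 1)], [:: (0, 2); (0, 3); (0, 4); (0, 5); (0, 6); (0, 7)]),
 Fork 0 8
(Cite 37 [:: 0; 1; 8; 2; 3; 4; 5; 6; 7; 9])
(Cite 0 [:: 0; 1; 2; 3; 4; 5; 6; 7; 8; 9]));
(([:: (0, 1)], [:: (0, 2); (0, 3); (0, 4); (0, 5); (0, 6)]),
 Fork 0 7
(Cite 37 [:: 0; 1; 7; 2; 3; 4; 5; 6; 8; 9])
(Cite 0 [:: 0; 1; 2; 3; 4; 5; 6; 7; 8; 9]));
(([:: (0, 1)], [:: (0, 2); (0, 3); (0, 4); (0, 5)]),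
 Fork 0 6
(Cite 37 [:: 0; 1; 6; 2; 3; 4; 5; 7; 8; 9])
(Cite 0 [:: 0; 1; 2; 3; 4; 5; 6; 7; 8; 9]));
(([:: (0, 1)], [:: (0, 2); (0, 3); (0, 4)]),
 Fork 0 5
(Cite 37 [:: 0; 1; 5; 2; 3; 4; 6; 7; 8; 9])
(Cite 0 [:: 0; 1; 2; 3; 4; 5; 6; 7; 8; 9]));
(([:: (0, 1)], [:: (0, 2); (0, 3)]),
 Fork 0 4
(Cite 37 [:: 0; 1; 4; 2; 3; 5; 6; 7; 8; 9])
(Cite 0 [:: 0; 1; 2; 3; 4; 5; 6; 7; 8; 9]));
(([:: (0, 1)], [:: (0, 2)]),
 Fork 0 3
(Cite 37 [:: 0; 1; 3; 2; 4; 5; 6; 7; 8; 9])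
(Cite 0 [:: 0; 1; 2; 3; 4; 5; 6; 7; 8; 9]))].

(** * Certificate: the empty clause *)

Definition cert_tree : tree :=
(* The positive branches collect neighbours of 0. The six citations that close them are the last
   clauses of the six degree parts, from large degree to small. *)
Fork 0 1
(Fork 0 2
(Fork 0 3
(Fork 0 4
(Fork 0 5
(Fork 0 6
(Cite 323 [:: 0; 1; 2; 3; 4; 5; 6; 7; 8; 9])
(Cite 297 [:: 0; 1; 2; 3; 4; 5; 6; 7; 8; 9]))
(Cite 210 [:: 0; 1; 2; 3; 4; 5; 6; 7; 8; 9]))
(Cite 95 [:: 0; 1; 2; 3; 4; 5; 6; 7; 8; 9]))
(Cite 38 [:: 0; 1; 2; 3; 4; 5; 6; 7; 8; 9]))
(Cite 0 [:: 0; 1; 2; 3; 4; 5; 6; 7; 8; 9]))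
(* Here 0 1 is a non-edge. Every other edge that turns up is relabelled to the pair 0 1 of a clause
   of degree 1. *)
(Fork 0 2
(Cite 0 [:: 0; 2; 1; 3; 4; 5; 6; 7; 8; 9])
(Fork 0 3
(Cite 1 [:: 0; 3; 1; 2; 4; 5; 6; 7; 8; 9])
(Fork 0 4
(Cite 2 [:: 0; 4; 1; 2; 3; 5; 6; 7; 8; 9])
(Fork 0 5
(Cite 3 [:: 0; 5; 1; 2; 3; 4; 6; 7; 8; 9])
(Fork 0 6
(Cite 4 [:: 0; 6; 1; 2; 3; 4; 5; 7; 8; 9])
(Fork 0 7
(Cite 5 [:: 0; 7; 1; 2; 3; 4; 5; 6; 8; 9])
(Fork 0 8
(Cite 6 [:: 0; 8; 1; 2; 3; 4; 5; 6; 7; 9])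
(Fork 0 9
(Cite 7 [:: 0; 9; 1; 2; 3; 4; 5; 6; 7; 8])
(Fork 1 2
(Cite 0 [:: 1; 2; 0; 3; 4; 5; 6; 7; 8; 9])
(Fork 1 3
(Cite 1 [:: 1; 3; 0; 2; 4; 5; 6; 7; 8; 9])
(Fork 1 4
(Cite 2 [:: 1; 4; 0; 2; 3; 5; 6; 7; 8; 9])
(Fork 1 5
(Cite 3 [:: 1; 5; 0; 2; 3; 4; 6; 7; 8; 9])
(Fork 1 6
(Cite 4 [:: 1; 6; 0; 2; 3; 4; 5; 7; 8; 9])
(Fork 1 7
(Cite 5 [:: 1; 7; 0; 2; 3; 4; 5; 6; 8; 9])
(Fork 1 8
(Cite 6 [:: 1; 8; 0; 2; 3; 4; 5; 6; 7; 9])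
(Fork 1 9
(Cite 8 [:: 1; 9; 0; 2; 3; 4; 5; 6; 7; 8])
(Fork 2 3
(Cite 1 [:: 2; 3; 0; 1; 4; 5; 6; 7; 8; 9])
(Fork 2 4
(Cite 2 [:: 2; 4; 0; 1; 3; 5; 6; 7; 8; 9])
(Fork 2 5
(Cite 3 [:: 2; 5; 0; 1; 3; 4; 6; 7; 8; 9])
(Fork 2 6
(Cite 4 [:: 2; 6; 0; 1; 3; 4; 5; 7; 8; 9])
(Fork 2 7
(Cite 5 [:: 2; 7; 0; 1; 3; 4; 5; 6; 8; 9])
(Fork 2 8
(Cite 6 [:: 2; 8; 0; 1; 3; 4; 5; 6; 7; 9])
(Fork 2 9
(Cite 9 [:: 2; 9; 0; 1; 3; 4; 5; 6; 7; 8])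
(Fork 3 4
(Cite 2 [:: 3; 4; 0; 1; 2; 5; 6; 7; 8; 9])
(Fork 3 5
(Cite 3 [:: 3; 5; 0; 1; 2; 4; 6; 7; 8; 9])
(Fork 3 6
(Cite 4 [:: 3; 6; 0; 1; 2; 4; 5; 7; 8; 9])
(Fork 3 7
(Cite 5 [:: 3; 7; 0; 1; 2; 4; 5; 6; 8; 9])
(Fork 3 8
(Cite 6 [:: 3; 8; 0; 1; 2; 4; 5; 6; 7; 9])
(Fork 3 9
(Cite 10 [:: 3; 9; 0; 1; 2; 4; 5; 6; 7; 8])
(Fork 4 5
(Cite 3 [:: 4; 5; 0; 1; 2; 3; 6; 7; 8; 9])
(Fork 4 6
(Cite 4 [:: 4; 6; 0; 1; 2; 3; 5; 7; 8; 9])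
(Fork 4 7
(Cite 5 [:: 4; 7; 0; 1; 2; 3; 5; 6; 8; 9])
(Fork 4 8
(Cite 6 [:: 4; 8; 0; 1; 2; 3; 5; 6; 7; 9])
(Fork 4 9
(Cite 11 [:: 4; 9; 0; 1; 2; 3; 5; 6; 7; 8])
(Fork 5 6
(Cite 4 [:: 5; 6; 0; 1; 2; 3; 4; 7; 8; 9])
(Fork 5 7
(Cite 5 [:: 5; 7; 0; 1; 2; 3; 4; 6; 8; 9])
(Fork 5 8
(Cite 6 [:: 5; 8; 0; 1; 2; 3; 4; 6; 7; 9])
(Fork 5 9
(Cite 12 [:: 5; 9; 0; 1; 2; 3; 4; 6; 7; 8])
(Fork 6 7
(Cite 13 [:: 6; 7; 0; 1; 2; 3; 4; 5; 8; 9])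
(Fork 6 8
(Cite 13 [:: 6; 8; 0; 1; 2; 3; 4; 5; 7; 9])
(Fork 7 8
(Cite 13 [:: 7; 8; 0; 1; 2; 3; 4; 5; 6; 9])
(* Only 6 9, 7 9 and 8 9 are undecided. A robber on an isolated label can never leave it, so the
   free cop can walk to him; the later traps merge such labels until cops on 8 and 9 account for all
   ten. *)
(Play 9 8 [:: Trap 1 2 [:: 2]; Trap 5 0 [:: 0]; Trap 7 3 [:: 3]; Trap 9 6 [:: 6]; Trap 4 5 [:: 0; 5]; Trap 7 1 [:: 1; 2]; Trap 8 4 [:: 0; 4; 5]; Trap 9 7 [:: 1; 2; 3; 7]])))))))))))))))))))))))))))))))))))))))))).

Lemma cert_ok : check_cert [:: petersen_clause] cert_lemmas cert_tree.
Proof. by vm_compute. Qed.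

Theorem theorem2 :
  (#|petersen| = 10 /\ connected_graph petersen /\ cop_number petersen = 3) /\
  (forall G : sgraph,
     #|G| = 10 -> connected_graph G -> cop_number G = 3 ->
     graph_iso G petersen).
Proof.
split; first by split; [exact: card_petersen | split;
  [exact: petersen_connected | exact: cop_number_petersen]].
move=> G G10 conG copG.
have /card_gt0P[x0 _] : 0 < #|G| by rewrite G10.
(* The enumeration of the vertices serves as the labelling. It remains to see that two cops do not
   win, that the initial library consisting of [petersen_clause] is sound, and that ten labels reach
   every vertex. *)
apply: (check_cert_sound conG _ _ cert_ok (f := nth x0 (enum G))).
- by move=> win2; case: (cop_number_not_win (G := G) (k := 2)); rewrite ?copG.
- by case=> [|i] l; [case=> <- f; apply: petersen_clauseP | case: i].
move=> x; exists (index x (enum G)); last by rewrite nth_index ?mem_enum.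
by rewrite -G10 cardE index_mem mem_enum.
Qed.
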